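(* Let $E$ be the vertex set of a countable, locally finite, connected graph with symmetric weights $c_{x,y}$ whose induced random walk is transient. Let $(L_{x,u})_{x\in E}$ be the field of occupation times, at level $u$, of continuous-time random interlacements on $E$, with law governed by $\mathbb{P}$, and let $P^G$ be the law on $\mathbb{R}^E$ of the Gaussian free field $(\varphi_x)_{x\in E}$, i.e. the centered Gaussian field with covariance $E^{P^G}[\varphi_x\varphi_y]=g(x,y)$, $x,y\in E$. Then for each $u\ge 0$, $$\Big(L_{x,u}+\tfrac12\varphi_x^2\Big)_{x\in E}\ \text{ under } \mathbb{P}\otimes P^G \quad\text{has the same law as}\quad \Big(\tfrac12\big(\varphi_x+\sqrt{2u}\big)^2\Big)_{x\in E}\ \text{ under } P^G .$$
   Context: Weighted graph. $E$ is the vertex set of a countable, locally finite, connected graph, with weights $c_{x,y}=c_{y,x}\ge 0$, $x,y\in E$, that are positive exactly when $x\neq y$ and $\{x,y\}$ is an edge. Set $\lambda_x=\sum_{z\in E}c_{x,z}$ and $p_{x,y}=c_{x,y}/\lambda_x$. The discrete-time Markov chain on $E$ with transition probability $p_{x,y}$ (called simple random walk) is assumed transient. Walk and Green function. $P_x$ is the law under which $(Z_n)_{n\ge0}$ is simple random walk starting at $x$ and $(\sigma_n)_{n\ge 0}$ are i.i.d. exponential variables with parameter $1$, independent of $(Z_n)$; $E_x$ is the corresponding expectation. $X_t=Z_k$ for $\sigma_0+\dots+\sigma_{k-1}\le t<\sigma_0+\dots+\sigma_k$ is the continuous-time walk with jump rate $1$. The Green function is $g(x,y)=\frac1{\lambda_y}E_x\big[\int_0^\infty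 1\{X_s=y\}\,ds\big]$, which is finite and symmetric. Equilibrium measure. For finite $K\subseteq E$, $e_K(x)=P_x[\widetilde H_K=\infty]\,\lambda_x\,1_K(x)$, where $\{\widetilde H_K=\infty\}$ is the event that $Z_n\notin K$ for all $n\ge1$. Continuous-time random interlacements. $\widehat W$ is the space of doubly infinite sequences $(Z_n,\sigma_n)_{n\in\mathbb{Z}}$ with values in $E\times(0,\infty)$ such that $(Z_n)_{n\in\mathbb{Z}}$ is a nearest-neighbor trajectory visiting each finite subset of $E$ only for finitely many $n$, and $\sum_{n\ge0}\sigma_n=\sum_{n<0}\sigma_n=\infty$; it carries its canonical $\sigma$-algebra. $\widehat W^*=\widehat W/\!\sim$, where $\widehat w\sim\widehat w'$ if $\widehat w(\cdot)=\widehat w'(\cdot+k)$ for some $k\in\mathbb{Z}$; $\pi^*:\widehat W\to\widehat W^*$ is the canonical map and $\widehat W^*$ carries the $\sigma$-algebra of sets whose inverse image under $\pi^*$ is measurable. For finite $K\subseteq E$, $\widehat Q_K$ is the finite measure on $\widehat W$ such that $\widehat Q_K(Z_0=x)=e_K(x)$ for $x\in E$ and, when $e_K(x)>0$, conditionally on $Z_0=x$, the sequences $(Z_n)_{n\ge0}$, $(Z_{-n})_{n\ge0}$, $(\sigma_n)_{n\in\mathbb{Z}}$ are independent and distributed respectively as simple random walk starting at $x$, as simple random walk starting at $x$ conditioned never to return to $K$ (at times $n\geq 1$), and as i.i.d. exponential variables with parameter $1$. There is a unique $\sigma$-finite measure $\widehat\nu$ on $\widehat W^*$ such that for every finite $K\subseteq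 E$ the restriction of $\widehat\nu$ to the set of $\widehat w^*$ whose $E$-valued trajectory enters $K$ equals the image of $\widehat Q_K$ under $\pi^*$ (its existence and uniqueness are known). On a probability space $(\Omega,\mathcal{A},\mathbb{P})$, $\omega=\sum_{i\ge0}\delta_{(\widehat w_i^*,u_i)}$ is a Poisson point process on $\widehat W^*\times\mathbb{R}_+$ with intensity measure $\widehat\nu(d\widehat w^* )\,du$. Occupation times. For $x\in E$, $u\ge0$, $$L_{x,u}(\omega)=\frac1{\lambda_x}\sum_{i\ge0}\sum_{n\in\mathbb{Z}}\sigma_n(\widehat w_i)\,1\{Z_n(\widehat w_i)=x,\ u_i\le u\},$$ where $\omega=\sum_{i\ge0}\delta_{(\widehat w_i^*,u_i)}$ and $\pi^*(\widehat w_i)=\widehat w_i^*$ for each $i$. Laws of fields indexed by $E$ are laws on $\mathbb{R}^E$ with the product $\sigma$-algebra. *)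

(* Defs.v *)
Set Warnings "-notation-overridden,-ambiguous-paths,-notation-incompatible-prefix,-redundant-canonical-projection".
From HB Require Import structures.
From mathcomp Require Import all_boot all_order all_algebra generic_quotient.
From mathcomp Require Import all_classical all_reals all_analysis measurable_realfun.

Set Implicit Arguments.
Unset Strict Implicit.
Unset Printing Implicit Defensive.

Import Order.TTheory GRing.Theory Num.Theory.
Import numFieldNormedType.Exports.

Local Open Scope classical_set_scope.
Local Open Scope ring_scope.
Local Open Scope quotient_scope.

(* Alias of E carrying the sigma-algebra of all subsets. *)
Definition vertex (E : pointedType) : Type := E.

HB.instance Definition _ (E : pointedType) := Pointed.copy (vertex E) E.
HB.instance Definition _ (E : pointedType) :=
  @isMeasurable.Build default_measure_display (vertex E)
    discrete_measurable discrete_measurable0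
    discrete_measurableC discrete_measurableU.

Definition cylinders (I : Type) d (T : measurableType d) : set (set (I -> T)) :=
  \bigcup_i preimage_set_system setT (fun f : I -> T => f i) measurable.

Definition prod_space (I : Type) d (T : measurableType d) : Type :=
  g_sigma_algebraType (@cylinders I d T).

Definition independent_RVs d d' (T : measurableType d) (T' : measurableType d')
    (R : realType) (m : set T -> \bar R) (I : eqType) (X : I -> T -> T') : Prop :=
  forall (J : seq I) (B : I -> set T'), uniq J ->
    (forall j, measurable (B j)) ->
    m (\bigcap_(j in [set` J]) (X j @^-1` B j)) =
      (\prod_(j <- J) m (X j @^-1` B j))%E.

Definition conditional (T : Type) (R : realType) (m : set T -> \bar R)
    (D : set T) : set T -> \bar R :=
  fun A => (m (A `&` D) / m D)%E.

Definition iid_exp1 d (T : measurableType d) (R : realType)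
    (m : set T -> \bar R) (I : eqType) (s : T -> I -> R) : Prop :=
  independent_RVs m (fun i w => s w i) /\
  forall i (B : set R), measurable B ->
    m [set w | B (s w i)] = exponential_prob 1 B.

(* The edges are the pairs of positive weight. *)
Record weighted_graph (R : realType) (E : pointedType) (c : E -> E -> R) : Prop :=
  WeightedGraph {
    graph_countable : countable [set: E] ;
    weight_sym : forall x y, c x y = c y x ;
    weight_ge0 : forall x y, 0 <= c x y ;
    weight_noloop : forall x, c x x = 0 ;
    graph_locally_finite : forall x, finite_set [set y | 0 < c x y] ;
    graph_connected : forall x y,
      exists2 s : seq E, path (fun a b => 0 < c a b) x s & last x s = y }.

Section walk.
Variables (R : realType) (E : pointedType) (c : E -> E -> R).

(* A finite sum, by local finiteness. *)
Definition total_weight (x : E) : R := \sum_(z \in [set: E]) c x z.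

Definition transition (x y : E) : R := c x y / total_weight x.

Definition simple_random_walk (T : Type) (m : set T -> \bar R)
    (Z : T -> nat -> E) (x : E) : Prop :=
  forall (n : nat) (z : nat -> E),
    m [set w | forall i, (i <= n)%N -> Z w i = z i] =
      ((z 0%N == x)%:R * \prod_(i < n) transition (z i) (z i.+1))%:E.

Definition path_space : Type := prod_space nat (vertex E * R)%type.

Definition pathZ (w : path_space) : prod_space nat (vertex E) :=
  fun n => (w n).1.
Definition pathsigma (w : path_space) : prod_space nat R := fun n => (w n).2.

Definition walk_law (x : E) (P : set path_space -> \bar R) : Prop :=
  [/\ simple_random_walk P pathZ x, iid_exp1 P pathsigma &
      forall (A : set (prod_space nat (vertex E))) (B : set (prod_space nat R)),
        measurable A -> measurable B ->
        P (pathZ @^-1` A `&` pathsigma @^-1` B) =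
          (P (pathZ @^-1` A) * P (pathsigma @^-1` B))%E].

Definition no_return (K : set E) : set path_space :=
  [set w | forall n, (1 <= n)%N -> ~ K (pathZ w n)].

(* X_t = y *)
Definition continuous_walk_at (w : path_space) (t : R) (y : E) : Prop :=
  exists k : nat,
    \sum_(i < k) pathsigma w i <= t < \sum_(i < k.+1) pathsigma w i /\
    pathZ w k = y.

Variable P : E -> probability path_space R.

Definition transient : Prop := forall x, (0 < P x (no_return [set x]))%E.

Definition green (x y : E) : \bar R :=
  ((total_weight y)^-1%:E *
   \int[P x]_w \int[lebesgue_measure]_(t in [set t : R | (0 <= t)%R])
     (\1_[set t : R | continuous_walk_at w t y] t)%:E)%E.

Definition equilibrium (K : set E) (x : E) : \bar R :=
  (P x (no_return K) * (total_weight x)%:E * (\1_K x)%:E)%E.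

End walk.

Section trajectories.
Variables (R : realType) (E : pointedType).

Definition bipath_space : Type := prod_space int (vertex E * R)%type.

Definition bipathZ (w : bipath_space) : int -> E := fun n => (w n).1.
Definition bipathsigma (w : bipath_space) : prod_space int R :=
  fun n => (w n).2.
Definition forwardZ (w : bipath_space) : prod_space nat (vertex E) :=
  fun n => bipathZ w n%:Z.
Definition backwardZ (w : bipath_space) : prod_space nat (vertex E) :=
  fun n => bipathZ w (- n%:Z).

(* Admissible trajectories are a (shift-invariant, measurable) subset of the
   full coordinate space, rather than a type of their own: a measurableType is
   pointed, and no admissible trajectory is available before transience is used.
   Measures on admissible trajectories are measures on the full space for which
   the complement is null, and likewise on the quotient below. *)
Definition admissible (c : E -> E -> R) : set bipath_space :=
  [set w | [/\ forall n, 0 < bipathsigma w n,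
    forall n, 0 < c (bipathZ w n) (bipathZ w (n + 1)),
    forall K : set E, finite_set K -> finite_set (bipathZ w @^-1` K),
    \esum_(n in [set n : int | 0 <= n]) (bipathsigma w n)%:E = +oo%E &
    \esum_(n in [set n : int | n < 0]) (bipathsigma w n)%:E = +oo%E ]].

Definition shift_rel : rel bipath_space :=
  fun w w' => `[< exists k : int, forall n, w n = w' (n + k) >].

Lemma shift_rel_equiv : equiv_class_of shift_rel.
Proof.
split=> [w|w w'|w2 w1 w3].
- by apply/asboolP; exists 0 => n; rewrite addr0.
- by apply/asboolP/asboolP => -[k wk]; exists (- k) => n; rewrite wk subrK.
- move=> /asboolP[k wk] /asboolP[l wl]; apply/asboolP.
  by exists (k + l) => n; rewrite wk wl addrA.
Qed.

Canonical shift_equiv := EquivRelPack shift_rel_equiv.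

Definition traj_space : Type := {eq_quot shift_equiv}.

HB.instance Definition _ := Choice.copy traj_space {eq_quot shift_equiv}.

Definition traj (w : bipath_space) : traj_space := \pi_({eq_quot shift_equiv}) w.

HB.instance Definition _ := isPointed.Build traj_space (traj point).

Definition traj_measurable : set (set traj_space) :=
  [set A | measurable (traj @^-1` A)].

Lemma traj_measurable0 : traj_measurable set0.
Proof. by rewrite /traj_measurable /= preimage_set0; exact: measurable0. Qed.

Lemma traj_measurableC A : traj_measurable A -> traj_measurable (~` A).
Proof. by rewrite /traj_measurable /= preimage_setC; exact: measurableC. Qed.

Lemma traj_measurableU (F : (set traj_space)^nat) :
  (forall i, traj_measurable (F i)) -> traj_measurable (\bigcup_i F i).
Proof.
by move=> mF; rewrite /traj_measurable /= preimage_bigcup; exact: bigcupT_measurable.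
Qed.

HB.instance Definition _ := @isMeasurable.Build default_measure_display
  traj_space traj_measurable traj_measurable0 traj_measurableC traj_measurableU.

Definition traj_admissible (c : E -> E -> R) : set traj_space :=
  traj @` admissible c.

Definition traj_entering (c : E -> E -> R) (K : set E) : set traj_space :=
  traj @` [set w | admissible c w /\ exists n, K (bipathZ w n)].

End trajectories.

Section interlacements.
Variables (R : realType) (E : pointedType) (c : E -> E -> R).
Variable P : E -> probability (path_space R E) R.

Definition is_interlacement_Q (K : set E) (Q : set (bipath_space R E) -> \bar R) : Prop :=
  [/\ Q (~` admissible c) = 0%E,
    forall x, Q [set w | bipathZ w 0 = x] = equilibrium c P K x &
    forall x, (0 < equilibrium c P K x)%E ->
      let Qx := conditional Q [set w | bipathZ w 0 = x] in
      [/\ forall (A B : set (prod_space nat (vertex E)))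
                 (C : set (prod_space int R)),
            measurable A -> measurable B -> measurable C ->
            Qx (@forwardZ R E @^-1` A `&` @backwardZ R E @^-1` B
                `&` @bipathsigma R E @^-1` C) =
              (Qx (@forwardZ R E @^-1` A) * Qx (@backwardZ R E @^-1` B)
               * Qx (@bipathsigma R E @^-1` C))%E,
          forall A : set (prod_space nat (vertex E)), measurable A ->
            Qx (@forwardZ R E @^-1` A) = P x (@pathZ R E @^-1` A),
          forall B : set (prod_space nat (vertex E)), measurable B ->
            Qx (@backwardZ R E @^-1` B) =
              conditional (P x) (no_return K) (@pathZ R E @^-1` B) &
          iid_exp1 Qx (@bipathsigma R E)]].

Definition interlacement_measure (nu : set (traj_space R E) -> \bar R) : Prop :=
  nu (~` traj_admissible c) = 0%E /\
  forall K : set E, finite_set K ->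
    exists2 Q : {finite_measure set (bipath_space R E) -> \bar R},
      is_interlacement_Q K Q &
      forall A : set (traj_space R E), measurable A ->
        nu (A `&` traj_entering c K) = pushforward Q (@traj R E) A.

(* nu(dw) du on trajectories x [0, +oo[. *)
Definition intensity (nu : set (traj_space R E) -> \bar R) :
    set (traj_space R E * R) -> \bar R :=
  fun A => (nu \x lebesgue_measure)%E (A `&` (setT `*` [set t : R | (0 <= t)%R])).

End interlacements.

(* The number of points in A of the point measure \sum_i \d_(p i). *)
Definition point_count d (T : measurableType d) (R : realType) (p : nat -> T)
    (A : set T) : \bar R :=
  (\sum_(i <oo) \d_(p i) A)%E.

(* The points themselves need not be measurably enumerated: only the point
   measure they define is random. The second argument of [poisson_prob], here
   0, is a dummy. *)
Definition poisson_point_process d d' (Omega : measurableType d)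
    (T : measurableType d') (R : realType) (Pr : probability Omega R)
    (p : Omega -> nat -> T) (mu : set T -> \bar R) : Prop :=
  let N A om : \bar R := point_count R (p om) A in
  [/\ forall A, measurable A -> measurable_fun setT (N A),
    forall A, measurable A -> (mu A < +oo)%E -> forall k : nat,
      Pr [set om | N A om = k%:R%:E] = poisson_prob (fine (mu A)) 0 [set k],
    forall A, measurable A -> mu A = +oo%E ->
      Pr [set om | N A om = +oo%E] = 1%E &
    forall n (A : 'I_n -> set T), (forall i, measurable (A i)) ->
      trivIset setT A -> independent_RVs Pr (fun i => N (A i))].

Definition occupation_time (R : realType) (E : pointedType) (c : E -> E -> R)
    (w : nat -> bipath_space R E) (s : nat -> R) (x : E) (u : R) : \bar R :=
  ((total_weight c x)^-1%:E *
   \esum_(i in [set i : nat | s i <= u]%R)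
     \esum_(n in [set n : int | bipathZ (w i) n = x]) (bipathsigma (w i) n)%:E)%E.

(* The normal law N(0, sd^2), where sd = 0 gives the Dirac mass at 0
   ([normal_prob] has another convention there). *)
Definition centered_normal (R : realType) (sd : R) : set R -> \bar R :=
  fun B => if sd == 0 then \d_(0 : R) B else normal_prob 0 sd B.

Definition centered_gaussian_field (R : realType) (E : pointedType)
    (PG : probability (prod_space E R) R) : Prop :=
  forall (s : seq E) (a : E -> R), exists sd : R,
    forall B : set R, measurable B ->
      PG [set phi | B (\sum_(x <- s) a x * phi x)] = centered_normal sd B.

Definition gaussian_free_field (R : realType) (E : pointedType)
    (c : E -> E -> R) (P : E -> probability (path_space R E) R)
    (PG : probability (prod_space E R) R) : Prop :=
  centered_gaussian_field PG /\
  forall x y, ('E_PG[fun phi => (phi x * phi y)%R] = green c P x y)%E.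

Definition same_field_law (R : realType) (E : Type) d1 d2
    (T1 : measurableType d1) (T2 : measurableType d2)
    (m1 : set T1 -> \bar R) (F1 : T1 -> prod_space E R)
    (m2 : set T2 -> \bar R) (F2 : T2 -> prod_space E R) : Prop :=
  forall A : set (prod_space E R), measurable A ->
    pushforward m1 F1 A = pushforward m2 F2 A.

(* Main.v *)
(* Both fields are nonnegative, so it suffices to compare the Laplace transforms
   of their finite-dimensional marginals. Let V >= 0 be supported in a finite set
   K, and let h x be the expectation, under the walk started at x, of
   exp (- sum_n sigma_n V (Z_n) / lambda_(Z_n)). The resolvent identity gives
   h + G V h = 1, and similarly G e_K = 1 on K.

   The Laplace functional of a Poisson process reduces E[exp (- <V, L_u>)] to the
   integral of 1 - exp (- <V, L>) over one trajectory, that is, under Q_K. There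
   only the forward part of the trajectory meets K after time 0, so this integral
   is <e_K, 1 - h> = <e_K, G V h> = <V, h>, and E[exp (- <V, L_u>)] equals
   exp (- u <V, h>). Replacing V by V / n shows that L_u is finite.

   On the Gaussian side, with b = sqrt (2 u), the Cameron-Martin formula with
   density exp (b <V h, phi> - b^2 <V h, G V h> / 2) shifts phi by
   b G V h = b (1 - h); completing the square gives
   E[exp (- <V, (phi + b)^2> / 2)] =
     exp (- b^2 / 2 <V, h>) E[exp (- <V, phi^2> / 2)],
   and b^2 / 2 = u. *)

From HB Require Import structures.
From mathcomp Require Import all_boot all_order all_algebra.
From mathcomp Require Import all_classical all_reals all_analysis measurable_realfun.
From mathcomp Require Import finmap ring lra.
Require Import Defs.

Set Implicit Arguments.
Unset Strict Implicit.
Unset Printing Implicit Defensive.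

Import Order.TTheory GRing.Theory Num.Theory.
Import numFieldNormedType.Exports.

Local Open Scope classical_set_scope.
Local Open Scope ring_scope.

(** * Weighted laws and independence *)

(** Two steps of the overview rest on uniqueness facts, proved here without complex characteristic
    functions. For Laplace transforms, [(1 - e^(- s Y))^N] is a combination of exponentials and
    approximates the indicator of [Y > a]. For Cameron-Martin, [e^(- x^2 / 2)] is the limit of
    [cos (x / n)^(n^2)], and products of cosines are combinations of cosines; so the shift is needed
    only for cosines of linear forms, where it follows from equality of moment generating functions,
    by way of the moments. Both facts are stated with a weight [H], which is the contribution of the
    other coordinates in the first case and the density in the second.

    The resolvent identities do not follow from the fixed-point equations alone, which leave
    harmonic functions free. The right solution is singled out because it lies below the potential
    of a finitely supported function, so that its image under [P^n] tends to 0. The finiteness of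
    the Green function used there is read off from its being the covariance of the Gaussian
    field. *)

Lemma measurable_preimage d d' (T : measurableType d) (T' : measurableType d')
    (f : T -> T') (B : set T') :
  measurable_fun setT f -> measurable B -> measurable (f @^-1` B).
Proof. by move=> mf mB; rewrite -[_ @^-1` _]setTI; exact: mf. Qed.

Lemma measurable_vertex_fun (E : pointedType) d
    (T' : measurableType d) (f : vertex E -> T') : measurable_fun setT f.
Proof. by move=> _ B _. Qed.

Lemma measurable_prod_coordinate (I : Type) d (T : measurableType d) (i : I) :
  measurable_fun setT (fun f : prod_space I T => f i).
Proof.
move=> _ B mB; apply: sub_sigma_algebra; exists i => //.
by exists B.
Qed.

(** The image under [X] of the measure with density [H] with respect to [m]. The proofs [H0], [mH]
    and [mX] are arguments so that a measure structure can be attached to this term. *)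
Definition weighted_law d d' (T : measurableType d) (T' : measurableType d')
    (R : realType) (m : {measure set T -> \bar R}) (H : T -> R) (X : T -> T')
    (H0 : forall w, 0 <= H w) (mH : measurable_fun setT H)
    (mX : measurable_fun setT X) (B : set T') : \bar R :=
  (\int[m]_(w in X @^-1` B) (H w)%:E)%E.

Section weighted_law.
Local Open Scope ereal_scope.
Context d d' (T : measurableType d) (T' : measurableType d') (R : realType).
Variables (m : {measure set T -> \bar R}) (H : T -> R) (X : T -> T').
Hypotheses (H0 : forall w, (0 <= H w)%R) (mH : measurable_fun setT H).
Hypothesis mX : measurable_fun setT X.

Local Notation mu := (weighted_law m H0 mH mX).

Let mX1 B : measurable B -> measurable (X @^-1` B).
Proof. by move=> mB; rewrite -[_ @^-1` _]setTI; exact: mX. Qed.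

Let mu0 : mu set0 = 0.
Proof. by rewrite /weighted_law preimage_set0 integral_set0. Qed.

Let mu_ge0 B : 0 <= mu B.
Proof. by apply: integral_ge0 => w _; rewrite lee_fin. Qed.

Let mu_sigma_additive : semi_sigma_additive mu.
Proof.
move=> F mF tF mUF; rewrite /weighted_law preimage_bigcup ge0_integral_bigcup//=.
- by apply: is_cvg_ereal_nneg_natsum_cond => n _ _; exact: mu_ge0.
- by move=> k; exact: mX1.
- by apply: measurable_funTS; exact/measurable_EFinP.
- by move=> x _; rewrite lee_fin.
- apply/trivIsetP => i j _ _ ij; rewrite -preimage_setI.
  by move/trivIsetP : tF => ->//; rewrite preimage_set0.
Qed.

HB.instance Definition _ :=
  isMeasure.Build _ _ _ mu mu0 mu_ge0 mu_sigma_additive.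

Import HBNNSimple.

(** Change of variables, by increasing approximation with simple functions. *)
Lemma integral_weighted_law (g : T' -> \bar R) :
    measurable_fun setT g -> (forall x, 0 <= g x) ->
  \int[mu]_x g x = \int[m]_w (g (X w) * (H w)%:E).
Proof.
move=> mg g0; pose f_ := nnsfun_approx measurableT mg.
have mfX n : measurable_fun setT (f_ n \o X).
  by apply: measurableT_comp => //; exact: measurable_funP.
have cvf x : (f_ n x)%:E @[n --> \oo] --> g x by exact: cvg_nnsfun_approx.
have mfXH n : measurable_fun setT (fun w => (f_ n (X w) * H w)%:E).
  by apply/measurable_EFinP/measurable_funM => //; exact: mfX.
have -> : \int[mu]_x g x = limn (fun n => \int[mu]_x (f_ n x)%:E).
  rewrite -monotone_convergence//.
  - by apply: eq_integral => y _; apply/esym/cvg_lim.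
  - by move=> n; exact/measurable_EFinP/measurable_funP.
  - by move=> n y _; rewrite lee_fin.
  - by move=> y _ a b ab; rewrite lee_fin; exact/lefP/nd_nnsfun_approx.
have -> : \int[m]_w (g (X w) * (H w)%:E) =
    limn (fun n => \int[m]_w (f_ n (X w) * H w)%:E).
  rewrite -monotone_convergence//.
  - apply: eq_integral => y _; apply/esym/cvg_lim => //.
    under eq_fun do rewrite EFinM.
    by apply: cvgeZr => //; exact: cvf.
  - by move=> n y _; rewrite lee_fin mulr_ge0.
  - move=> y _ a b ab; rewrite lee_fin ler_wpM2r//.
    exact/lefP/nd_nnsfun_approx.
apply/congr_lim/funext => n.
have ge0' r w : 0 <= (r * \1_(f_ n @^-1` [set r]) (X w) * H w)%:E.
  rewrite EFinM mule_ge0// ?lee_fin//; exact: (nnfun_muleindic_ge0 (f_ n)).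
transitivity (\sum_(r \in range (f_ n))
    \int[m]_w (r * \1_(f_ n @^-1` [set r]) (X w) * H w)%:E).
  under eq_integral do rewrite fimfunE -fsumEFin//.
  rewrite ge0_integral_fsum//; last 2 first.
  - by move=> y; exact/measurable_EFinP/measurable_funM.
  - by move=> y x _; rewrite nnfun_muleindic_ge0.
  apply: eq_fsbigr => r /set_mem[x _ <-]; rewrite integralZl_indic_nnsfun//.
  rewrite integral_indic// setIT /= /weighted_law.
  under [RHS]eq_integral do rewrite -mulrA EFinM.
  rewrite ge0_integralZl_EFin//; last 2 first.
  - by move=> w _; rewrite lee_fin mulr_ge0.
  - apply/measurable_EFinP/measurable_funM => //.
    by apply: (measurableT_comp _ mX); exact: measurable_indic.
  congr (_ * _); rewrite integral_mkcond; apply: eq_integral => w _.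
  rewrite patchE indicE -[w \in _]/(X w \in f_ n @^-1` [set f_ n x]).
  by case: ifPn; rewrite ?mul1r ?mul0r.
rewrite -ge0_integral_fsum//.
- apply: eq_integral => w _.
  rewrite fsumEFin// [in RHS]fimfunE; congr EFin.
  rewrite !fsbig_finite//= mulr_suml; exact: eq_bigr.
- move=> r; apply/measurable_EFinP/measurable_funM => //.
  apply: measurable_funM => //.
  by apply: (measurableT_comp _ mX); exact: measurable_indic.
Qed.

End weighted_law.

Section integral_transfer.
Context d1 d2 d' (T1 : measurableType d1) (T2 : measurableType d2)
  (T' : measurableType d') (R : realType).
Variables (m1 : {measure set T1 -> \bar R}) (m2 : {measure set T2 -> \bar R}).
Variables (H1 : T1 -> R) (H2 : T2 -> R) (X1 : T1 -> T') (X2 : T2 -> T').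
Hypotheses (H10 : forall w, 0 <= H1 w) (H20 : forall w, 0 <= H2 w).
Hypotheses (mH1 : measurable_fun setT H1) (mH2 : measurable_fun setT H2).
Hypotheses (mX1 : measurable_fun setT X1) (mX2 : measurable_fun setT X2).
Hypothesis H12 : forall B, measurable B ->
  (\int[m1]_(w in X1 @^-1` B) (H1 w)%:E = \int[m2]_(w in X2 @^-1` B) (H2 w)%:E)%E.

(** Equality on sets extends to nonnegative functions. Depending on the weights, the hypothesis
    expresses that a variable has a given density, that it is independent of an event, or that a
    measure is conditioned or pushed forward. *)
Lemma eq_weighted_integral (g : T' -> \bar R) :
    measurable_fun setT g -> (forall x, (0 <= g x)%E) ->
  (\int[m1]_w (g (X1 w) * (H1 w)%:E) = \int[m2]_w (g (X2 w) * (H2 w)%:E))%E.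
Proof.
move=> mg g0.
rewrite -(integral_weighted_law m1 H10 mH1 mX1)//.
rewrite -(integral_weighted_law m2 H20 mH2 mX2)//.
by apply: eq_measure_integral => B mB _; exact: H12.
Qed.

End integral_transfer.

Section independent_product.
Context d d' (T : measurableType d) (T' : measurableType d') (R : realType).
Variables (m : probability T R) (I : eqType) (X : I -> T -> T') (g : I -> T' -> R).
Hypotheses (mX : forall i, measurable_fun setT (X i))
  (mg : forall i, measurable_fun setT (g i)) (g01 : forall i x, 0 <= g i x <= 1).

Let mXB i B : measurable B -> measurable (X i @^-1` B).
Proof. by move=> mB; rewrite -[_ @^-1` _]setTI; exact: mX. Qed.

Let mgX i : measurable_fun setT (fun w => g i (X i w)).
Proof. exact: measurableT_comp. Qed.

Let mprod (l : seq I) :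
  measurable_fun setT (fun w => (\prod_(j <- l) g j (X j w))%R).
Proof. exact: measurable_prod. Qed.

Let prod_ge0 (l : seq I) w : 0 <= \prod_(j <- l) g j (X j w).
Proof. by apply: prodr_ge0 => i _; case/andP: (g01 i (X i w)). Qed.

Let mcap (l : seq I) B : (forall i, measurable (B i)) ->
  measurable (\bigcap_(j in [set` l]) X j @^-1` B j).
Proof.
by move=> mB; apply: fin_bigcap_measurable => // i _; exact: mXB.
Qed.

Let int_fin i : (\int[m]_w (g i (X i w))%:E \is a fin_num)%E.
Proof.
rewrite ge0_fin_numE; last first.
  by apply: integral_ge0 => w _; rewrite lee_fin; case/andP: (g01 i (X i w)).
apply: (@le_lt_trans _ _ (\int[m]_w (cst 1 w))%E).
  apply: ge0_le_integral => //.
  - by move=> w _; rewrite lee_fin; case/andP: (g01 i (X i w)).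
  - exact/measurable_EFinP.
  - by move=> w _; rewrite lee_fin; case/andP: (g01 i (X i w)).
by rewrite integral_cst// mul1e -ge0_fin_numE// fin_num_measure.
Qed.

(** Indicators on the coordinates of [l2] are replaced by the functions [g], one coordinate at a
    time. The induction hypothesis holds for every choice of sets, so letting the set at coordinate
    [j] vary determines the law of [X j] weighted by all other factors. *)
Let independent_integral_mixed : independent_RVs m X ->
  forall (l1 l2 : seq I) (B : I -> set T'), uniq (l1 ++ l2) ->
    (forall i, measurable (B i)) ->
  (\int[m]_(w in \bigcap_(j in [set` l2]) X j @^-1` B j)
     (\prod_(j <- l1) g j (X j w))%:E =
   (\prod_(j <- l1) \int[m]_w (g j (X j w))%:E) *
   \prod_(j <- l2) m (X j @^-1` B j))%E.
Proof.
move=> indep; elim=> [|j l1 IH] l2 B.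
  move=> /= ul2 mB; rewrite big_nil mul1e -(indep l2 B ul2 mB).
  under eq_integral do rewrite big_nil.
  by rewrite integral_cst// ?mul1e//; exact: mcap.
move=> ul mB; set D := \bigcap_(_ in _) _.
have mD : measurable D by exact: mcap.
pose H1 w := \1_D w * \prod_(j <- l1) g j (X j w).
pose C := (\prod_(j <- l1) \int[m]_w (g j (X j w))%:E *
   \prod_(j <- l2) m (X j @^-1` B j))%E.
have Cfin : (C \is a fin_num)%E.
  rewrite /C fin_numM//; first by apply: prode_fin_num => i _; exact: int_fin.
  by apply: prode_fin_num => i _; rewrite fin_num_measure//; exact: mXB.
have C0 : 0 <= fine C.
  rewrite fine_ge0// /C mule_ge0//.
    apply: prode_ge0 => i _; apply: integral_ge0 => w _.
    by rewrite lee_fin; case/andP: (g01 i (X i w)).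
  exact: prode_ge0.
(* Weighted by the remaining factors [H1], the variable [X j] has [C] times its own law; integrating
   [g j] against both gives the next case. *)
have key B' : measurable B' ->
  (\int[m]_(w in X j @^-1` B') (H1 w)%:E =
   \int[m]_(w in X j @^-1` B') (cst (fine C) w)%:E)%E.
  move=> mB'; transitivity ((fine C)%:E * m (X j @^-1` B'))%E; last first.
    by rewrite -integral_cst//; exact: mXB.
  rewrite fineK//.
  pose B2 i := if i == j then B' else B i.
  have jl : j \notin l1 ++ l2 by case/andP: ul.
  have jl2 : j \notin l2 by move: jl; rewrite mem_cat negb_or => /andP[].
  have eqB i : i \in l2 -> B2 i = B i.
    by move=> il2; rewrite /B2; case: eqP => // ij; rewrite -ij il2 in jl2.
  have := IH (j :: l2) B2.
  have -> : uniq (l1 ++ j :: l2).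
    by rewrite -cat1s uniq_catCA.
  move=> /(_ isT).
  have mB2 i : measurable (B2 i) by rewrite /B2; case: ifP.
  have -> : (\prod_(i <- j :: l2) m (X i @^-1` B2 i) =
      m (X j @^-1` B') * \prod_(i <- l2) m (X i @^-1` B i))%E.
    rewrite big_cons {1}/B2 eqxx; congr (_ * _)%E.
    by apply: eq_big_seq => i il2; rewrite eqB.
  move=> /(_ mB2); rewrite muleCA muleC -/C => <-.
  rewrite /H1 -[in RHS](setTI (\bigcap_(_ in _) _)).
  rewrite [in LHS]integral_mkcond [in RHS]integral_mkcondr [in RHS]integral_mkcond.
  apply: eq_integral => w _; rewrite !patchE in_setT.
  have -> : (w \in \bigcap_(j0 in [set` (j :: l2)]) X j0 @^-1` B2 j0) =
            (w \in X j @^-1` B') && (w \in D).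
    apply/idP/idP => [/set_mem wB|/andP[/set_mem w1 /set_mem w2]].
      apply/andP; split; apply/mem_set.
        by have := wB j; rewrite /= mem_head {1}/B2 eqxx; exact.
      move=> i /= il2; have := wB i; rewrite /= in_cons il2 orbT => /(_ isT).
      by rewrite eqB.
    apply/mem_set => i /=; rewrite in_cons /B2; case: eqP => [-> _//|_ /= il2].
    exact: w2.
  case: ifP => //= _; rewrite indicE.
  by case: ifP; rewrite ?mul1r ?mul0r.
transitivity (\int[m]_w ((g j (X j w))%:E * (H1 w)%:E))%E.
  rewrite integral_mkcond; apply: eq_integral => w _.
  rewrite patchE big_cons /H1 indicE -EFinM; case: ifP => _.
    by rewrite mul1r.
  by rewrite mul0r mulr0.
have -> := @eq_weighted_integral _ _ _ _ _ _ _ m m H1 (cst (fine C)) (X j) (X j) _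
  _ _ _ (mX j) (mX j) key (EFin \o g j) _ _.
- rewrite /= ge0_integralZr//=.
  + rewrite big_cons -muleA; congr (_ * _)%E.
    by rewrite fineK.
  + exact/measurable_EFinP.
  + by move=> w _; rewrite lee_fin; case/andP: (g01 j (X j w)).
- by move=> w; rewrite mulr_ge0// indicE.
- by [].
- apply: measurable_funM => //; exact: measurable_indic.
- exact: measurable_cst.
- exact/measurable_EFinP.
- by move=> x; rewrite lee_fin; case/andP: (g01 j x).
Qed.

Lemma independent_integral_prod (l : seq I) : independent_RVs m X -> uniq l ->
  (\int[m]_w (\prod_(j <- l) g j (X j w))%:E =
   \prod_(j <- l) \int[m]_w (g j (X j w))%:E)%E.
Proof.
move=> indep ul.
have := @independent_integral_mixed indep l [::] (fun=> setT).
rewrite cats0 big_nil mule1 => <- //.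
by rewrite (_ : \bigcap_(_ in _) _ = setT)//; apply/seteqP; split.
Qed.

End independent_product.

Section dominated_real.
Context d (T : measurableType d) (R : realType) (m : {measure set T -> \bar R}).

Lemma cvg_Rintegral_dominated (f_ : nat -> T -> R) (f g : T -> R) :
    (forall n, measurable_fun setT (f_ n)) -> measurable_fun setT f ->
    m.-integrable setT (EFin \o g) ->
    (forall x, f_ n x @[n --> \oo] --> f x) ->
    (forall n x, `|f_ n x| <= g x) ->
  m.-integrable setT (EFin \o f) /\
  \int[m]_x f_ n x @[n --> \oo] --> \int[m]_x f x.
Proof.
move=> mf_ mf ig cvf fg.
have [] := @dominated_convergence _ _ _ m setT measurableT
  (fun n => EFin \o f_ n) (EFin \o f) (EFin \o g) _ _ _ ig _.
- by move=> n; exact/measurable_EFinP.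
- exact/measurable_EFinP.
- by apply/aeW => x _; apply: cvg_EFin; [exact: nearW|exact: cvf].
- by apply/aeW => x n _ /=; rewrite lee_fin.
move=> intf _ /= h; split=> //.
apply: fine_cvg; rewrite /Rintegral fineK//.
exact: integrable_fin_num.
Qed.

End dominated_real.

Section bounded_integrable.
Context d (T : measurableType d) (R : realType).
Variable m : {finite_measure set T -> \bar R}.

Lemma bounded_integrable (f : T -> R) (M : R) : measurable_fun setT f ->
  (forall x, `|f x| <= M) -> m.-integrable setT (EFin \o f).
Proof.
move=> mf fM; apply: (@le_integrable _ _ _ _ setT _ _ (EFin \o cst M)) => //.
- exact/measurable_EFinP.
- by move=> x _ /=; rewrite lee_fin (le_trans (fM x))// ler_norm.
- exact: finite_measure_integrable_cst.
Qed.

End bounded_integrable.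

Lemma integrable_mul_sqr d (T : measurableType d) (R : realType)
    (m : {measure set T -> \bar R}) (f g : T -> R) :
    measurable_fun setT f -> measurable_fun setT g ->
    m.-integrable setT (fun x => (f x ^+ 2)%:E) ->
    m.-integrable setT (fun x => (g x ^+ 2)%:E) ->
  m.-integrable setT (fun x => (f x * g x)%:E).
Proof.
move=> mf mg if2 ig2; apply: (le_integrable _ _ _ (integrableD measurableT if2 ig2)) => //.
  by apply/measurable_EFinP; exact: measurable_funM.
move=> x _ /=; rewrite lee_fin normrM [leRHS]ger0_norm ?addr_ge0 ?sqr_ge0//.
rewrite -(real_normK (num_real (f x))) -(real_normK (num_real (g x))).
move: (normr_ge0 (f x)) (normr_ge0 (g x)); move: `|f x| `|g x| => a b a0 b0.
by have := sqr_ge0 (a - b); nra.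
Qed.

(** * Uniqueness of Laplace transforms *)

Lemma eq_cvg_lim (R : realType) (u v : nat -> R) (a b : R) :
  u =1 v -> u n @[n --> \oo] --> a -> v n @[n --> \oo] --> b -> a = b.
Proof.
by move=> /funext -> cva cvb; rewrite -(cvg_lim (@Rhausdorff R) cva);
  exact: cvg_lim cvb.
Qed.

Lemma bernoulli_le (R : realType) (x : R) (n : nat) : 0 <= x <= 1 ->
  1 - n%:R * x <= (1 - x) ^+ n.
Proof.
move=> /andP[x0 x1]; elim: n => [|n IH]; first by rewrite mul0r subr0 expr0.
have := ler_wpM2r (_ : 0 <= 1 - x) IH; rewrite subr_ge0 => /(_ x1).
rewrite exprSr; apply: le_trans; rewrite -natr1.
have : 0 <= n%:R * x ^+ 2 by rewrite mulr_ge0// sqr_ge0.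
by move: (n%:R : R) => k; nra.
Qed.

(** Since [1 + x ^ 2 / 2 <= expR x], the term is at most [2 / (delta ^ 2 n)] for positive [n];
    doubling the constant allows [n + 1] in the denominator. *)
Lemma cvg_nat_mul_expRN (R : realType) (delta : R) : 0 < delta ->
  n%:R * expR (- (n%:R * delta)) @[n --> \oo] --> (0 : R).
Proof.
move=> d0; apply: (@squeeze_cvgr _ _ _ _ (fun=> 0)
    (fun n => (4 / delta ^+ 2) * n.+1%:R^-1)).
- near=> n; apply/andP; split; first by rewrite mulr_ge0// expR_ge0.
  have := @expR_ge1Dxn R (n%:R * delta) 1 (mulr_ge0 (ler0n _ _) (ltW d0)).
  rewrite -[(2`!)%N]/2%N expRN => h.
  have e0 := expR_gt0 (n%:R * delta).
  have -> : n.+1%:R = n%:R + 1 :> R by rewrite natr1.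
  have NN : n%:R <= n%:R ^+ 2 :> R.
    by rewrite -natrX ler_nat; case: (n) => // k; rewrite expnS leq_pmulr.
  have N0 : 0 <= n%:R :> R by [].
  set e := expR (n%:R * delta) in h e0 *.
  clearbody e; move: NN N0 h; move: (n%:R : R) => N NN N0 h.
  have D0 : 0 < delta ^+ 2 by rewrite exprn_gt0.
  rewrite ler_pdivrMr//.
  rewrite (_ : _ * e = (4 * e) / (delta ^+ 2 * (N + 1))); last first.
    field; apply/andP; split; rewrite gt_eqF// ltr_wpDl//.
  rewrite ler_pdivlMr; last by rewrite mulr_gt0// ltr_wpDl.
  move: h D0; rewrite exprMn mulrDr mulr1; move: (delta ^+ 2) => D h D0.
  rewrite mulrDr mulrCA -expr2.
  by have := ler_wpM2r (ltW D0) NN; lra.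
- exact: cvg_cst.
- rewrite -[X in _ --> X](mulr0 (4 / delta ^+ 2)).
  apply: cvgMr; exact: cvg_harmonic.
Unshelve. all: by end_near. Qed.

(* Since [e ^ (- n ln 2 y / a) = 2 ^ (- n y / a)], the exponent [n 2 ^ n] pushes
   the power to 0 when [y <= a] and to 1 when [a < y]. *)
Lemma cvg_laplace_step (R : realType) (a y : R) : 0 < a -> 0 <= y ->
  (1 - expR (- (n%:R * (ln 2 / a) * y))) ^+ (n * 2 ^ n) @[n --> \oo]
    --> ((a < y)%R%:R : R).
Proof.
move=> a0 y0.
have l2 : 0 < ln 2 :> R by rewrite ln_gt0// ltr1n.
have e2 n : expR (n%:R * ln 2) = 2 ^+ n :> R by rewrite expRM_natl lnK// posrE.
have k0 : 0 <= ln 2 / a :> R by rewrite divr_ge0// ltW.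
have x01 n : 0 <= expR (- (n%:R * (ln 2 / a) * y)) <= 1.
  by rewrite expR_ge0 expR_le1 oppr_le0 mulr_ge0// mulr_ge0.
have [ya|ay] := leP y a => /=.
- apply: (@squeeze_cvgr _ _ _ _ (fun=> 0) (fun n => expR (- 1) ^+ n)).
  + near=> n; case/andP: (x01 n) => xn0 xn1.
    rewrite exprn_ge0 ?subr_ge0//=.
    apply: (@le_trans _ _ (expR (- (2 ^+ n)^-1) ^+ (n * 2 ^ n))).
      apply: lerXn2r; rewrite ?nnegrE ?expR_ge0 ?subr_ge0//.
      apply: le_trans (expR_ge1Dx _); rewrite lerD2l lerN2 -e2 -expRN ler_expR lerN2.
      rewrite -mulrA ler_wpM2l// mulrAC ler_pdivrMr// ler_wpM2l// ltW//.
    have n2 : 2 ^+ n != 0 :> R by rewrite expf_neq0.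
    by rewrite -!expRM_natl natrM natrX !mulrN -mulrA divff.
  + exact: cvg_cst.
  + by apply: cvg_expr; rewrite ger0_norm ?expR_ge0// expR_lt1 oppr_lt0.
- have delta0 : 0 < ln 2 / a * y - ln 2.
    by rewrite subr_gt0 mulrAC ltr_pdivlMr// ltr_pM2l.
  apply: (@squeeze_cvgr _ _ _ _
     (fun n => 1 - n%:R * expR (- (n%:R * (ln 2 / a * y - ln 2)))) (fun=> 1)).
  + near=> n; case/andP: (x01 n) => xn0 xn1.
    rewrite exprn_ile1 ?subr_ge0 ?andbT ?gerBl//.
    apply: le_trans (bernoulli_le _ (x01 n)).
    rewrite lerD2l lerN2 natrM natrX -mulrA -e2 -expRD.
    rewrite (_ : _ + _ = - (n%:R * (ln 2 / a * y - ln 2)))//.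
    by ring.
  + rewrite -[X in _ --> X]subr0; apply: cvgB; first exact: cvg_cst.
    exact: cvg_nat_mul_expRN.
  + exact: cvg_cst.
Unshelve. all: by end_near. Qed.

Lemma measurable_natr_gt d (T : measurableType d) (R : realType) (Y : T -> R)
    (a : R) : measurable_fun setT Y ->
  measurable_fun setT (fun w => (a < Y w)%R%:R : R).
Proof.
move=> mY; rewrite (_ : (fun w => _) = \1_[set w | a < Y w]); last first.
  by apply/funext => w; rewrite indicE mem_setE.
apply: measurable_indic; rewrite -[X in measurable X]setTI.
exact: measurable_fun_ltr.
Qed.

Section laplace_uniqueness.
Context d1 d2 (T1 : measurableType d1) (T2 : measurableType d2) (R : realType).
Variables (m1 : {measure set T1 -> \bar R}) (m2 : {measure set T2 -> \bar R}).
Variables (H1 : T1 -> R) (H2 : T2 -> R) (Y1 : T1 -> R) (Y2 : T2 -> R).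
Hypotheses (H10 : forall w, 0 <= H1 w) (H20 : forall w, 0 <= H2 w).
Hypotheses (mH1 : m1.-integrable setT (EFin \o H1))
  (mH2 : m2.-integrable setT (EFin \o H2)).
Hypotheses (mY1 : measurable_fun setT Y1) (mY2 : measurable_fun setT Y2).
Hypotheses (Y10 : forall w, 0 <= Y1 w) (Y20 : forall w, 0 <= Y2 w).
Hypothesis laplace12 : forall v : R, 0 <= v ->
  \int[m1]_w (expR (- (v * Y1 w)) * H1 w) = \int[m2]_w (expR (- (v * Y2 w)) * H2 w).

(** Expanding the power yields a combination of functions [expR (- v Y)], so the Laplace transform
    determines the integral. The factor with [t] makes an induction on [N] possible: raising [N] by
    one subtracts the same expression with [t] replaced by [t + s]. *)
Let bnd (T : Type) (Y : T -> R) t s N w := expR (- (t * Y w)) * (1 - expR (- (s * Y w))) ^+ N.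

Let bnd_le1 (T : Type) (Y : T -> R) t s N w : (forall w, 0 <= Y w) -> 0 <= t -> 0 <= s ->
  0 <= bnd Y t s N w <= 1.
Proof.
move=> Y0 t0 s0.
have h r : 0 <= r -> 0 <= expR (- (r * Y w)) <= 1.
  by move=> r0; rewrite expR_ge0 expR_le1 oppr_le0 mulr_ge0.
case/andP: (h _ t0) => t1 t2; case/andP: (h _ s0) => s1 s2.
by rewrite /bnd mulr_ge0 ?exprn_ge0 ?subr_ge0//= mulr_ile1 ?exprn_ile1 ?exprn_ge0 ?subr_ge0 ?gerBl.
Qed.

Let mbnd d (T : measurableType d) (Y : T -> R) t s N : measurable_fun setT Y ->
  measurable_fun setT (bnd Y t s N).
Proof.
move=> mY; apply: measurable_funM.
  by apply: measurableT_comp => //; apply: measurableT_comp => //; exact: measurable_funM.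
apply: measurable_funX; apply: measurable_funB => //.
by apply: measurableT_comp => //; apply: measurableT_comp => //; exact: measurable_funM.
Qed.

Let ibnd d (T : measurableType d) (m : {measure set T -> \bar R}) (H Y : T -> R) t s N :
    m.-integrable setT (EFin \o H) -> (forall w, 0 <= H w) ->
    measurable_fun setT Y -> (forall w, 0 <= Y w) -> 0 <= t -> 0 <= s ->
  m.-integrable setT (EFin \o (fun w => bnd Y t s N w * H w)).
Proof.
move=> iH H0 mY Y0 t0 s0.
have mH : measurable_fun setT H by apply/measurable_EFinP; exact: measurable_int iH.
apply: le_integrable iH => //.
  by apply/measurable_EFinP/measurable_funM => //; exact: mbnd.
move=> w _ /=; rewrite lee_fin; case/andP: (@bnd_le1 _ Y t s N w Y0 t0 s0) => b0 b1.
by rewrite normrM (ger0_norm b0) ler_piMl.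
Qed.

Let eq_bnd N : forall t s, 0 <= t -> 0 <= s ->
  \int[m1]_w (bnd Y1 t s N w * H1 w) = \int[m2]_w (bnd Y2 t s N w * H2 w).
Proof.
elim: N => [|N IH] t s t0 s0.
  rewrite /bnd; under eq_Rintegral do rewrite expr0 mulr1.
  by under [RHS]eq_Rintegral do rewrite expr0 mulr1; exact: laplace12.
have E (T : Type) (Y H : T -> R) w : bnd Y t s N.+1 w * H w =
    bnd Y t s N w * H w - bnd Y (t + s) s N w * H w.
  by rewrite /bnd mulrDl opprD expRD exprSr; ring.
under eq_Rintegral do rewrite E.
under [RHS]eq_Rintegral do rewrite E.
have ts : 0 <= t + s by rewrite addr_ge0.
by rewrite !RintegralB// ?IH//; exact: ibnd.
Qed.

Let cvg_tail d (T : measurableType d) (m : {measure set T -> \bar R}) (H Y : T -> R) a :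
    m.-integrable setT (EFin \o H) -> (forall w, 0 <= H w) ->
    measurable_fun setT Y -> (forall w, 0 <= Y w) -> 0 < a ->
  \int[m]_w (bnd Y 0 (n%:R * (ln 2 / a)) (n * 2 ^ n) w * H w) @[n --> \oo] -->
  \int[m]_w ((a < Y w)%R%:R * H w).
Proof.
move=> iH H0 mY Y0 a0.
have s0 n : 0 <= n%:R * (ln 2 / a) by rewrite mulr_ge0// divr_ge0 ?ltW// ln_gt0// ltr1n.
have mH : measurable_fun setT H by apply/measurable_EFinP; exact: measurable_int iH.
have := @cvg_Rintegral_dominated _ _ _ m
   (fun n w => bnd Y 0 (n%:R * (ln 2 / a)) (n * 2 ^ n) w * H w)
   (fun w => (a < Y w)%R%:R * H w) H.
case=> //.
- by move=> n; apply: measurable_funM => //; exact: mbnd.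
- by apply: measurable_funM => //; exact: measurable_natr_gt.
- move=> w; apply: cvgMl; rewrite /bnd.
  under eq_fun do rewrite mul0r oppr0 expR0 mul1r.
  exact: cvg_laplace_step.
- move=> n w; case/andP: (@bnd_le1 _ Y 0 (n%:R * (ln 2 / a)) (n * 2 ^ n) w Y0 (lexx _) (s0 n)) => b0 b1.
  by rewrite normrM (ger0_norm b0) (ger0_norm (H0 w)) ler_piMl.
Qed.

Let eq_tail a : 0 < a ->
  \int[m1]_w ((a < Y1 w)%R%:R * H1 w) = \int[m2]_w ((a < Y2 w)%R%:R * H2 w).
Proof.
move=> a0; apply: (eq_cvg_lim _ (cvg_tail mH1 H10 mY1 Y10 a0)
  (cvg_tail mH2 H20 mY2 Y20 a0)) => n; apply: eq_bnd => //.
by rewrite mulr_ge0// divr_ge0 ?ltW// ln_gt0// ltr1n.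
Qed.

Let tailE d (T : measurableType d) (m : {measure set T -> \bar R}) (H Y : T -> R) a :
    m.-integrable setT (EFin \o H) -> (forall w, 0 <= H w) -> measurable_fun setT Y ->
  (\int[m]_(w in Y @^-1` `]a, +oo[) (H w)%:E =
   (\int[m]_w ((a < Y w)%R%:R * H w))%:E)%E.
Proof.
move=> iH H0 mY.
have mH : measurable_fun setT H by apply/measurable_EFinP; exact: measurable_int iH.
have E : (\int[m]_(w in Y @^-1` `]a, +oo[) (H w)%:E =
   \int[m]_w ((a < Y w)%R%:R * H w)%:E)%E.
  rewrite integral_mkcond; apply: eq_integral => w _; rewrite patchE.
  rewrite (_ : (w \in _) = (a < Y w)); last first.
    apply/idP/idP => [/set_mem|h]; first by rewrite /= in_itv /= andbT.
    by apply/mem_set; rewrite /= in_itv /= h.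
  by case: ifP => _; rewrite ?mul1r ?mul0r.
rewrite E /Rintegral fineK//; apply: integrable_fin_num => //.
apply: (le_integrable _ _ _ iH) => //.
  by apply/measurable_EFinP/measurable_funM => //; exact: measurable_natr_gt.
by move=> w _ /=; rewrite lee_fin normrM; case: (_ < _); rewrite ?normr1 ?normr0 ?mul1r ?mul0r.
Qed.

(** The half-lines []a, +oo[] form a generating class stable under intersection. The weight [H] lets
    further factors be carried along, which the multivariate case uses to treat one coordinate at a
    time. *)
Lemma laplace_unique B : measurable B ->
  (\int[m1]_(w in Y1 @^-1` B) (H1 w)%:E = \int[m2]_(w in Y2 @^-1` B) (H2 w)%:E)%E.
Proof.
have m1H : measurable_fun setT H1 by apply/measurable_EFinP; exact: measurable_int mH1.
have m2H : measurable_fun setT H2 by apply/measurable_EFinP; exact: measurable_int mH2.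
move=> mB.
pose mu1 : {measure set R -> \bar R} := weighted_law m1 H10 m1H mY1.
pose mu2 : {measure set R -> \bar R} := weighted_law m2 H20 m2H mY2.
rewrite -[LHS]/(mu1 B) -[RHS]/(mu2 B).
apply: (measure_unique (@RGenOInfty.G R) (fun n => `](- n%:R)%R, +oo[%classic)) => //.
- exact: RGenOInfty.measurableE.
- move=> _ _ [x ->] [y ->]; exists (Num.max x y); apply/seteqP; split => z /=;
    by rewrite !in_itv /= !andbT gt_max => /andP.
- by move=> n; exists (- n%:R).
- apply/seteqP; split=> // z _.
  exists (Num.truncn `|z|).+1 => //=; rewrite in_itv /= andbT ltrNl.
  by apply: le_lt_trans (truncnS_gt _); rewrite -normrN ler_norm.
- move=> _ [a ->]; rewrite /= /weighted_law !tailE//; congr EFin.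
  have lim0 d (T : measurableType d) (m : {measure set T -> \bar R}) (H Y : T -> R) :
     m.-integrable setT (EFin \o H) -> (forall w, 0 <= H w) -> measurable_fun setT Y ->
     \int[m]_w ((n.+1%:R^-1 < Y w)%R%:R * H w) @[n --> \oo] -->
     \int[m]_w ((0 < Y w)%R%:R * H w).
    move=> iH H0 mY.
    have mH : measurable_fun setT H by apply/measurable_EFinP; exact: measurable_int iH.
    have mt b : measurable_fun setT (fun w => (b < Y w)%R%:R * H w).
      by apply: measurable_funM => //; exact: measurable_natr_gt.
    have [] // := @cvg_Rintegral_dominated _ _ _ m
       (fun n w => (n.+1%:R^-1 < Y w)%R%:R * H w) (fun w => (0 < Y w)%R%:R * H w) H.
    + move=> w; apply: cvgMl; have [Yw|Yw] := ltP 0 (Y w); last first.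
        rewrite (_ : (fun n => _) = cst 0); first exact: cvg_cst.
        by apply/funext => n; rewrite ltNge (le_trans Yw).
      apply: cvg_near_cst.
      have := @cvg_harmonic R => /cvgr_lt /(_ _ Yw); apply: filterS => n.
      by rewrite /harmonic /= => ->.
    + move=> n w; rewrite ger0_norm ?mulr_ge0//.
      by case: (_ < _); rewrite ?mul1r ?mul0r.
  (* For [a < 0] the half-line has full mass, given by the Laplace transform at 0; for [a = 0] it is
     the increasing limit of the half-lines from [1 / (n + 1)]. *)
  have [a0|a0|->] := ltgtP a 0.
  + have h d (T : measurableType d) (m : {measure set T -> \bar R}) (H Y : T -> R) :
        (forall w, 0 <= Y w) ->
        \int[m]_w ((a < Y w)%R%:R * H w) = \int[m]_w (expR (- (0 * Y w)) * H w).
      move=> Y0; apply: eq_Rintegral => w _.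
      by rewrite (lt_le_trans a0)// mul0r oppr0 expR0.
    by rewrite !h//; exact: laplace12.
  + exact: eq_tail.
  + apply: (eq_cvg_lim _ (lim0 _ _ _ _ _ mH1 H10 mY1)
      (lim0 _ _ _ _ _ mH2 H20 mY2)) => n; apply: eq_tail.
    by rewrite invr_gt0.
- by move=> k; rewrite /= /weighted_law tailE// ltry.
Qed.

End laplace_uniqueness.

Lemma integral_preimage_indic d d' (T : measurableType d) (T' : measurableType d')
    (R : realType) (m : {measure set T -> \bar R}) (H : T -> R) (X : T -> T') B :
  (\int[m]_(w in X @^-1` B) (H w)%:E = \int[m]_w (\1_B (X w) * H w)%:E)%E.
Proof.
rewrite integral_mkcond; apply: eq_integral => w _.
rewrite patchE indicE -[w \in _]/(X w \in B).
by case: ifPn; rewrite ?mul1r ?mul0r.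
Qed.

Section multivariate_laplace.
Context d1 d2 (T1 : measurableType d1) (T2 : measurableType d2) (R : realType)
  (I : eqType).
Variables (m1 : probability T1 R) (m2 : probability T2 R).
Variables (Y1 : I -> T1 -> R) (Y2 : I -> T2 -> R).
Hypotheses (mY1 : forall i, measurable_fun setT (Y1 i))
  (mY2 : forall i, measurable_fun setT (Y2 i)).
Hypotheses (Y10 : forall i w, 0 <= Y1 i w) (Y20 : forall i w, 0 <= Y2 i w).
Hypothesis laplace12 : forall (l : seq I) (V : I -> R), uniq l ->
  (forall i, 0 <= V i) ->
  \int[m1]_w expR (- \sum_(i <- l) V i * Y1 i w) =
  \int[m2]_w expR (- \sum_(i <- l) V i * Y2 i w).

Let H (T : Type) (Y : I -> T -> R) (B : I -> set R) V l1 l2 w : R :=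
  (\prod_(i <- l2) \1_(B i) (Y i w)) * expR (- \sum_(i <- l1) V i * Y i w).

Let H01 (T : Type) (Y : I -> T -> R) B (V : I -> R) l1 l2 (w : T) : (forall i w, 0 <= Y i w) -> (forall i, 0 <= V i) ->
  0 <= H Y B V l1 l2 w <= 1.
Proof.
move=> Y0 V0; have p01 : 0 <= \prod_(i <- l2) (\1_(B i) (Y i w) : R) <= 1.
  have h i : 0 <= (\1_(B i) (Y i w) : R) <= 1.
    by rewrite indicE; case: (_ \in _); rewrite /= ?ler01 ?lexx.
  rewrite prodr_ile1 ?andbT; last by move=> i _; exact: h.
  by apply: prodr_ge0 => i _; case/andP: (h i).
case/andP: p01 => p0 p1.
by rewrite /H mulr_ge0 ?expR_ge0//= mulr_ile1 ?expR_ge0// expR_le1 oppr_le0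
  sumr_ge0// => i _; exact: mulr_ge0.
Qed.

Let mH d (T : measurableType d) (Y : I -> T -> R) B V l1 l2 :
  (forall i, measurable_fun setT (Y i)) -> (forall i, measurable (B i)) ->
  measurable_fun setT (H Y B V l1 l2).
Proof.
move=> mY mB; apply: measurable_funM.
  by apply: measurable_prod => i _; apply: measurableT_comp.
apply: measurableT_comp => //; apply: measurableT_comp => //.
by apply: measurable_sum => i; exact: measurable_funM.
Qed.

Let iH d (T : measurableType d) (m : probability T R) (Y : I -> T -> R) B (V : I -> R) l1 l2 :
    (forall i, measurable_fun setT (Y i)) -> (forall i, measurable (B i)) ->
    (forall i w, 0 <= Y i w) -> (forall i, 0 <= V i) ->
  m.-integrable setT (EFin \o H Y B V l1 l2).
Proof.
move=> mY mB Y0 V0; apply: (@bounded_integrable _ _ _ _ _ 1); first exact: mH.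
by move=> w; case/andP: (@H01 _ Y B V l1 l2 w Y0 V0) => h0 h1; rewrite ger0_norm.
Qed.

(** A coordinate [x] passes from an exponential factor to an indicator by one-dimensional
    uniqueness, applied to [Y x] weighted by all other factors: equality of the Laplace transforms
    is the induction hypothesis for [x :: l1], with the transform variable as the coefficient of
    [x]. *)
Let eq_mixed B : (forall i, measurable (B i)) ->
  forall l2 l1 V, uniq (l1 ++ l2) -> (forall i, 0 <= V i) ->
  \int[m1]_w H Y1 B V l1 l2 w = \int[m2]_w H Y2 B V l1 l2 w.
Proof.
move=> mB; elim=> [|x l2 IH] l1 V.
  rewrite cats0 => ul1 V0; rewrite /H.
  under eq_Rintegral do rewrite big_nil mul1r.
  by under [RHS]eq_Rintegral do rewrite big_nil mul1r; exact: laplace12.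
move=> ul V0.
have ul' : uniq ((x :: l1) ++ l2) by rewrite -cat1s uniq_catCA in ul.
have xl1 : x \notin l1 by move: ul' => /= /andP[]; rewrite mem_cat negb_or => /andP[].
have key : (\int[m1]_(w in Y1 x @^-1` B x) (H Y1 B V l1 l2 w)%:E =
    \int[m2]_(w in Y2 x @^-1` B x) (H Y2 B V l1 l2 w)%:E)%E.
  apply: laplace_unique; rewrite //.
  - by move=> w; case/andP: (@H01 _ Y1 B V l1 l2 w Y10 V0).
  - by move=> w; case/andP: (@H01 _ Y2 B V l1 l2 w Y20 V0).
  - exact: iH.
  - exact: iH.
  - move=> v v0; pose V' i := if i == x then v else V i.
    have E (T : Type) (Y : I -> T -> R) w :
        expR (- (v * Y x w)) * H Y B V l1 l2 w = H Y B V' (x :: l1) l2 w.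
      rewrite /H mulrCA big_cons /V' eqxx opprD expRD; congr (_ * (_ * expR (- _))).
      by apply: eq_big_seq => i il1; case: eqP => // ix; rewrite -ix il1 in xl1.
    under eq_Rintegral do rewrite E.
    under [RHS]eq_Rintegral do rewrite E.
    by apply: IH => // i; rewrite /V'; case: ifP.
have E d (T : measurableType d) (m : probability T R) (Y : I -> T -> R) :
  \int[m]_w H Y B V l1 (x :: l2) w =
  fine (\int[m]_(w in Y x @^-1` B x) (H Y B V l1 l2 w)%:E)%E.
  rewrite integral_preimage_indic; apply: eq_Rintegral => w _.
  by rewrite /H big_cons mulrA.
by rewrite !E key.
Qed.

Lemma multivariate_laplace_unique (l : seq I) (B : I -> set R) : uniq l ->
    (forall i, measurable (B i)) ->
  m1 (\bigcap_(i in [set` l]) Y1 i @^-1` B i) =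
  m2 (\bigcap_(i in [set` l]) Y2 i @^-1` B i).
Proof.
move=> ul mB; have := @eq_mixed B mB l [::] (fun=> 0) ul (fun=> lexx _).
have E d (T : measurableType d) (m : probability T R) (Y : I -> T -> R) :
    (forall i, measurable_fun setT (Y i)) ->
  (\int[m]_w H Y B (fun=> 0) [::] l w)%:E = m (\bigcap_(i in [set` l]) Y i @^-1` B i).
  move=> mY; have mC : measurable (\bigcap_(i in [set` l]) Y i @^-1` B i).
    apply: fin_bigcap_measurable => // i _; rewrite -[X in measurable X]setTI.
    exact: mY.
  have -> : \int[m]_w H Y B (fun=> 0) [::] l w =
      \int[m]_w \1_(\bigcap_(i in [set` l]) Y i @^-1` B i) w.
    apply: eq_Rintegral => w _; rewrite /H big_nil oppr0 expR0 mulr1 indicE.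
    have [/set_mem wB|wB] := boolP (w \in _).
      rewrite big_seq big1// => i il; rewrite indicE mem_set//; exact: wB.
    apply/eqP; rewrite prodf_seq_eq0; apply: contraNT wB => /hasPn h.
    apply/mem_set => i /= il; have := h i il; rewrite /= indicE pnatr_eq0 eqb0 negbK.
    by move/set_mem.
  by rewrite /Rintegral integral_indic// setIT fineK// fin_num_measure.
by move=> h; rewrite -(E _ _ m1)// -(E _ _ m2)// h.
Qed.

End multivariate_laplace.

Section product_space_unique.
Context (R : realType) (I : choiceType).

Definition rectangles : set (set (prod_space I R)) :=
  [set A | exists (l : seq I) (B : I -> set R), [/\ uniq l,
     forall i, measurable (B i) &
     A = \bigcap_(i in [set` l]) (fun f : prod_space I R => f i) @^-1` B i]].

Lemma prod_space_measure_unique (m1 m2 : {measure set (prod_space I R) -> \bar R}) :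
    (m1 setT < +oo)%E -> (forall A, rectangles A -> m1 A = m2 A) ->
  forall A, measurable A -> m1 A = m2 A.
Proof.
move=> m1fin m12.
have Gm : rectangles `<=` measurable.
  move=> _ [l [B [_ mB ->]]]; apply: fin_bigcap_measurable => // i _.
  by rewrite -[X in measurable X]setTI; exact: measurable_prod_coordinate.
have GT : rectangles setT.
  exists [::], (fun=> setT); split=> //.
  by apply/seteqP; split.
have GI : setI_closed rectangles.
  move=> _ _ [l1 [B1 [u1 mB1 ->]]] [l2 [B2 [u2 mB2 ->]]].
  (* The two lists may differ; a coordinate absent from one of them is unconstrained there. *)
  pose B i := (if i \in l1 then B1 i else setT) `&` (if i \in l2 then B2 i else setT).
  exists (undup (l1 ++ l2)), B; split.
  - exact: undup_uniq.
  - by move=> i; apply: measurableI; case: ifP.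
  - apply/seteqP; split => f /=.
      by move=> [h1 h2] i /= _; split; case: ifP => //= il; [exact: h1|exact: h2].
    move=> h; split => i /= il; have := h i.
      by rewrite /= mem_undup mem_cat il /B => /(_ isT)[]; rewrite il.
    by rewrite /= mem_undup mem_cat il orbT /B => /(_ isT)[_]; rewrite il.
move=> A mA; apply: (g_sigma_algebra_measure_unique rectangles Gm (fun=> setT) (fun=> GT)) => //.
  by apply/seteqP; split => // x _; exists 0%N.
have sub : @cylinders I _ R `<=` <<s rectangles>>; last first.
  by apply: (smallest_sub _ sub mA); exact: smallest_sigma_algebra.
move=> _ [i _ [B mB <-]]; apply: sub_sigma_algebra.
exists [:: i], (fun=> B); split=> //; rewrite setTI.
apply/seteqP; split => f /= h.
  by move=> j /=; rewrite inE => /eqP ->.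
by apply: h => /=; rewrite inE.
Qed.

End product_space_unique.

(** * Potential theory of the walk *)

Section walk_operator.
Context (R : realType) (E : pointedType) (c : E -> E -> R).
Hypotheses (gc : weighted_graph c) (lam0 : forall x, 0 < total_weight c x).

Definition neighbors (x : E) : seq E := fset_set [set y | 0 < c x y].

Definition walk_op (f : E -> R) (x : E) : R :=
  \sum_(z <- neighbors x) transition c x z * f z.

Lemma neighborsP x y : (y \in neighbors x) = (0 < c x y).
Proof.
by rewrite /neighbors in_fset_set ?mem_setE//; exact: (graph_locally_finite gc).
Qed.

Lemma uniq_neighbors x : uniq (neighbors x).
Proof. exact: fset_uniq. Qed.

Lemma weight_eq0 x y : y \notin neighbors x -> c x y = 0.
Proof.
rewrite neighborsP -leNgt => h; apply/eqP.
by rewrite eq_le h (weight_ge0 gc).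
Qed.

Lemma total_weightE x : total_weight c x = \sum_(z <- neighbors x) c x z.
Proof.
rewrite /total_weight -(@fsbig_widen _ _ _ _ [set y | 0 < c x y])//; last first.
  by move=> y [_ /= /negP]; rewrite -neighborsP; exact: weight_eq0.
by rewrite fsbig_finite//=; exact: (graph_locally_finite gc).
Qed.

Lemma transition_ge0 x y : 0 <= transition c x y.
Proof. by rewrite divr_ge0 ?(weight_ge0 gc)// ltW. Qed.

Lemma walk_op1 x : walk_op (fun=> 1) x = 1.
Proof.
rewrite /walk_op; under eq_bigr do rewrite mulr1.
by rewrite -mulr_suml -total_weightE divff// gt_eqF.
Qed.

Lemma walk_opD f g x : walk_op (fun y => f y + g y) x = walk_op f x + walk_op g x.
Proof. by rewrite -big_split; apply: eq_bigr => z _; rewrite mulrDr. Qed.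

Lemma walk_opB f g x : walk_op (fun y => f y - g y) x = walk_op f x - walk_op g x.
Proof. by rewrite -sumrB; apply: eq_bigr => z _; rewrite mulrBr. Qed.

Lemma walk_op_sum (I : Type) (s : seq I) (F : I -> E -> R) x :
  walk_op (fun y => \sum_(i <- s) F i y) x = \sum_(i <- s) walk_op (F i) x.
Proof.
by rewrite exchange_big; apply: eq_bigr => z _; rewrite mulr_sumr.
Qed.

Lemma walk_opZ a f x : walk_op (fun y => a * f y) x = a * walk_op f x.
Proof. by rewrite mulr_sumr; apply: eq_bigr => z _; rewrite mulrCA. Qed.

Lemma le_walk_op f g x : (forall y, f y <= g y) -> walk_op f x <= walk_op g x.
Proof. by move=> fg; apply: ler_sum => z _; rewrite ler_wpM2l ?transition_ge0. Qed.

Lemma walk_op_ge0 f x : (forall y, 0 <= f y) -> 0 <= walk_op f x.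
Proof. by move=> f0; apply: sumr_ge0 => z _; rewrite mulr_ge0 ?transition_ge0. Qed.

Lemma cvg_walk_op (f_ : nat -> E -> R) f x :
  (forall y, f_ n y @[n --> \oo] --> f y) ->
  walk_op (f_ n) x @[n --> \oo] --> walk_op f x.
Proof.
move=> cvf; rewrite /walk_op; elim: (neighbors x) => [|z s IH].
  by rewrite big_nil; under eq_fun do rewrite big_nil; exact: cvg_cst.
rewrite big_cons; under eq_fun do rewrite big_cons.
by apply: cvgD => //; apply: cvgMr; exact: cvf.
Qed.

(** Partial sums of the potential [sum_n P^n f] of the discrete walk. For the indicator of [y] the
    limit is the expected number of visits [g x y * lambda_y], which is what [ghat] stands for
    below. *)
Definition green_partial (f : E -> R) (n : nat) (x : E) : R :=
  \sum_(0 <= i < n) iter i walk_op f x.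

Lemma iter_walk_op_sum (I : Type) (s : seq I) (F : I -> E -> R) n x :
  iter n walk_op (fun y => \sum_(i <- s) F i y) x =
  \sum_(i <- s) iter n walk_op (F i) x.
Proof.
elim: n x => //= n IH x; rewrite -walk_op_sum; congr walk_op.
exact/funext.
Qed.

Lemma iter_walk_opZ a f n x :
  iter n walk_op (fun y => a * f y) x = a * iter n walk_op f x.
Proof.
elim: n x => //= n IH x; rewrite -walk_opZ; congr walk_op.
exact/funext.
Qed.

Lemma green_partialS f n x :
  green_partial f n.+1 x = f x + walk_op (green_partial f n) x.
Proof.
rewrite /green_partial walk_op_sum big_nat_recl//.
Qed.

(* A function [k] dominated by a potential satisfies [P^n k --> 0], so that
   [k = f + P k] iterates to [k = sum_n P^n f]. *)
Lemma green_partial_cvg (f k phi G : E -> R) :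
    (forall x, green_partial phi n x @[n --> \oo] --> G x) ->
    (forall y, 0 <= k y <= G y) ->
    (forall y, k y = f y + walk_op k y) ->
  forall x, green_partial f n x @[n --> \oo] --> k x.
Proof.
move=> cvG kG kE x.
have opG y : walk_op G y = G y - phi y.
  apply: (@eq_cvg_lim _ (fun n => walk_op (green_partial phi n) y)
    (fun n => green_partial phi n.+1 y - phi y)).
  - by move=> n; rewrite green_partialS addrC addKr.
  - exact: cvg_walk_op.
  - apply: cvgB; last exact: cvg_cst.
    by rewrite (cvg_shiftS (green_partial phi ^~ y)); exact: cvG.
have iterG n y : iter n walk_op G y = G y - green_partial phi n y.
  elim: n y => [|n IH] y; first by rewrite /green_partial big_geq// subr0.
  rewrite iterS (_ : iter n walk_op G = fun y => G y - green_partial phi n y);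
    last exact/funext.
  by rewrite walk_opB opG green_partialS; ring.
have iterk n y : 0 <= iter n walk_op k y <= iter n walk_op G y.
  elim: n y => [|n IH] y //=.
  rewrite walk_op_ge0 ?le_walk_op// => z; by case/andP: (IH z).
have iterk0 : iter n walk_op k x @[n --> \oo] --> (0 : R).
  apply: (@squeeze_cvgr _ _ _ _ (fun=> 0) (fun n => G x - green_partial phi n x)).
  - by near=> n; rewrite -iterG.
  - exact: cvg_cst.
  - by rewrite -[X in _ --> X](subrr (G x)); apply: cvgB (cvG x); exact: cvg_cst.
have E1 n : green_partial f n x = k x - iter n walk_op k x.
  elim: n => [|n IH]; first by rewrite /green_partial big_geq//= subrr.
  rewrite /green_partial big_nat_recr//= -/(green_partial f n x) IH.
  rewrite -iterS iterSr (_ : k = fun y => f y + walk_op k y); last exact/funext.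
  have -> m y : iter m walk_op (fun y => f y + walk_op k y) y =
      iter m walk_op f y + iter m walk_op (walk_op k) y.
    elim: m y => //= m IHm y; rewrite -walk_opD; congr walk_op; exact/funext.
  rewrite (_ : (fun y => f y + walk_op k y) = k); last by apply/esym/funext.
  by ring.
have -> : green_partial f ^~ x = fun n => k x - iter n walk_op k x by exact/funext.
by rewrite -[X in _ --> X]subr0; apply: cvgB => //; exact: cvg_cst.
Unshelve. all: by end_near. Qed.

Variable ghat : E -> E -> R.
Hypothesis cvg_ghat : forall x y,
  green_partial (fun z => (z == y)%:R) n x @[n --> \oo] --> ghat x y.

Lemma cvg_green_finite (K : seq E) (phi : E -> R) x :
    uniq K -> (forall y, y \notin K -> phi y = 0) ->
  green_partial phi n x @[n --> \oo] --> \sum_(y <- K) phi y * ghat x y.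
Proof.
move=> uK phi0.
have E1 : phi = fun z => \sum_(y <- K) phi y * (z == y)%:R.
  apply/funext => z; have [zK|zK] := boolP (z \in K).
    rewrite (bigD1_seq z)//= eqxx mulr1 big1 ?addr0// => y yz.
    by rewrite eq_sym (negbTE yz) mulr0.
  rewrite phi0// big_seq big1// => y yK; case: eqP => [zy|]; rewrite ?mulr0//.
  by rewrite zy yK in zK.
have E2 n : green_partial phi n x =
    \sum_(y <- K) phi y * green_partial (fun z => (z == y)%:R) n x.
  rewrite /green_partial; under [RHS]eq_bigr do rewrite mulr_sumr.
  rewrite exchange_big; apply: eq_bigr => i _; rewrite {1}E1 iter_walk_op_sum.
  by apply: eq_bigr => y _; rewrite iter_walk_opZ.
have -> : green_partial phi ^~ x = fun n =>
    \sum_(y <- K) phi y * green_partial (fun z => (z == y)%:R) n x by exact/funext.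
elim: (K) => [|y s IH].
  by rewrite big_nil; under eq_fun do rewrite big_nil; exact: cvg_cst.
rewrite big_cons; under eq_fun do rewrite big_cons.
by apply: cvgD => //; apply: cvgMr; exact: cvg_ghat.
Qed.

(** The equation [k = f + P k] leaves [k] undetermined up to harmonic functions; lying below the
    potential of a finitely supported [phi] selects the solution [G f]. The domination is required
    of approximations [k_] because there it can be checked by induction on [n]. *)
Lemma green_fixpoint (K : seq E) (f k phi : E -> R) : uniq K ->
    (forall y, y \notin K -> f y = 0) -> (forall y, y \notin K -> phi y = 0) ->
    (forall y, 0 <= k y) -> (forall y, k y = f y + walk_op k y) ->
    (exists k_ : nat -> E -> R, (forall y, k_ n y @[n --> \oo] --> k y) /\
       forall n y, k_ n y <= green_partial phi n y) ->
  forall x, k x = \sum_(y <- K) f y * ghat x y.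
Proof.
move=> uK f0 phi0 k0 kE [k_ [cvk k_le]] x.
apply: (@eq_cvg_lim _ (fun n => green_partial f n x) (fun n => green_partial f n x)) => //.
- apply: (@green_partial_cvg f k phi (fun x => \sum_(y <- K) phi y * ghat x y)) => //.
    by move=> y; exact: cvg_green_finite.
  move=> y; rewrite k0/=; apply: (ler_cvg_to (cvk y) (@cvg_green_finite K phi y uK phi0)).
  exact: nearW.
- exact: cvg_green_finite.
Qed.

End walk_operator.

(** * Killed walks and their potentials *)

Section killed_walk.
Context (R : realType) (E : pointedType) (c : E -> E -> R).
Hypotheses (gc : weighted_graph c) (lam0 : forall x, 0 < total_weight c x).

(* [path_functional phi N x] is [E_x (prod_(i <= N) phi i (Z_i))]. *)
Fixpoint path_functional (phi : nat -> E -> R) (N : nat) (x : E) : R :=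
  if N is N'.+1 then phi 0%N x * walk_op c (path_functional (fun i => phi i.+1) N') x
  else phi 0%N x.

Lemma eq_path_functional phi psi N x : (forall i y, phi i y = psi i y) ->
  path_functional phi N x = path_functional psi N x.
Proof.
move=> h; congr path_functional; apply/funext => i; exact/funext.
Qed.

Lemma path_functional_last (f : E -> R) N x :
  path_functional (fun i z => if i == N then f z else 1) N x = iter N (walk_op c) f x.
Proof.
elim: N x => [|N IH] x //=; rewrite mul1r; congr walk_op.
by apply/funext => y; rewrite -IH.
Qed.

Variables (r : E -> R) (K : seq E).
Hypotheses (r01 : forall y, 0 <= r y <= 1) (r1 : forall y, y \notin K -> r y = 1).
Hypothesis uK : uniq K.

Definition killed_partial (N : nat) (x : E) : R := path_functional (fun=> r) N x.

Lemma killed_partialS N x :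
  killed_partial N.+1 x = r x * walk_op c (killed_partial N) x.
Proof. by []. Qed.

Lemma killed_partial_ge0 N x : 0 <= killed_partial N x.
Proof.
elim: N x => [|N IH] x; first by case/andP: (r01 x).
by rewrite killed_partialS mulr_ge0 ?walk_op_ge0//; case/andP: (r01 x).
Qed.

Lemma killed_partial_le N x : killed_partial N.+1 x <= killed_partial N x.
Proof.
elim: N x => [|N IH] x; rewrite killed_partialS; case/andP: (r01 x) => rx0 rx1.
  rewrite -[leRHS]mulr1 ler_wpM2l// -(walk_op1 gc lam0 x) le_walk_op// => y.
  by case/andP: (r01 y).
by rewrite [leRHS]killed_partialS ler_wpM2l// le_walk_op.
Qed.

Lemma killed_partial_le1 N x : killed_partial N x <= 1.
Proof.
elim: N x => [|N IH] x; first by case/andP: (r01 x).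
exact: le_trans (killed_partial_le _ _) _.
Qed.

(** Two choices of [r] occur: [(1 + V / lambda)^-1], for the exponential of occupation times, and
    the indicator of the complement of [K], for the probability of never being in [K], time 0
    included. *)
Definition killed (x : E) : R := limn (killed_partial ^~ x).

Lemma cvg_killed x : killed_partial n x @[n --> \oo] --> killed x.
Proof.
apply: nonincreasing_is_cvgn.
  by apply/nonincreasing_seqP => n; exact: killed_partial_le.
exists 0 => _ [n _ <-]; exact: killed_partial_ge0.
Qed.

Lemma killed_ge0 x : 0 <= killed x.
Proof.
apply: (ler_cvg_to (cvg_cst (0 : R)) (cvg_killed (x := x))).
by apply: nearW => n; exact: killed_partial_ge0.
Qed.

Lemma killed_le1 x : killed x <= 1.
Proof.
apply: (ler_cvg_to (cvg_killed (x := x)) (cvg_cst (1 : R))).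
by apply: nearW => n; exact: killed_partial_le1.
Qed.

Lemma killedE x : killed x = r x * walk_op c killed x.
Proof.
apply: (@eq_cvg_lim _ (fun n => killed_partial n.+1 x)
  (fun n => r x * walk_op c (killed_partial n) x)) => //.
  by rewrite (cvg_shiftS (killed_partial ^~ x)); exact: cvg_killed.
by apply: cvgMr; apply: cvg_walk_op => y; exact: cvg_killed.
Qed.

Variable ghat : E -> E -> R.
Hypothesis cvg_ghat : forall x y,
  green_partial c (fun z => (z == y)%:R) n x @[n --> \oo] --> ghat x y.

(** From [killed = r P killed] follows [1 - killed = (1 - r) P killed + P (1 - killed)], a
    fixed-point equation with finitely supported source. The domination is the union bound
    [1 - prod r (Z_i) <= sum (1 - r (Z_i))], by the potential of [1 - r]. *)
Lemma killed_potential x :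
  1 - killed x = \sum_(y <- K) (1 - r y) * walk_op c killed y * ghat x y.
Proof.
have op1B y (f : E -> R) : walk_op c (fun y => 1 - f y) y = 1 - walk_op c f y.
  by rewrite walk_opB walk_op1.
apply: (@green_fixpoint _ _ _ gc lam0 _ cvg_ghat K
  (fun y => (1 - r y) * walk_op c killed y) (fun y => 1 - killed y)
  (fun y => 1 - r y)) => //.
- by move=> y /r1 ->; rewrite subrr mul0r.
- by move=> y /r1 ->; rewrite subrr.
- by move=> y; rewrite subr_ge0 killed_le1.
- by move=> y; rewrite op1B {1}killedE; ring.
(* Shifted by one: [killed_partial n] has [n + 1] factors, at times 0 to [n], and is compared with
   [green_partial] with [n + 1] terms. *)
- exists (fun n => if n is n'.+1 then (fun y => 1 - killed_partial n' y) else fun=> 0).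
  split.
    move=> y; rewrite -(cvg_shiftS (fun n => _)).
    by apply: cvgB; [exact: cvg_cst|exact: cvg_killed].
  case=> [|n] y; first by rewrite /green_partial big_geq.
  elim: n y => [|n IH] y.
    by rewrite /green_partial big_nat1.
  rewrite killed_partialS green_partialS.
  rewrite (_ : 1 - _ = (1 - r y) * walk_op c (killed_partial n) y
    + (1 - walk_op c (killed_partial n) y)); last by ring.
  apply: lerD; last by rewrite -op1B le_walk_op.
  rewrite -[leRHS]mulr1 ler_wpM2l ?subr_ge0//; first by case/andP: (r01 y).
  by rewrite -(walk_op1 gc lam0 y) le_walk_op// => z; exact: killed_partial_le1.
Qed.

End killed_walk.

(** * Resolvent identity and equilibrium measure *)

Section potential_identities.
Context (R : realType) (E : pointedType) (c : E -> E -> R).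
Hypotheses (gc : weighted_graph c) (lam0 : forall x, 0 < total_weight c x).
Variables (g : E -> E -> R) (K : seq E) (V : E -> R).
Hypothesis cvg_g : forall x y,
  green_partial c (fun z => (z == y)%:R) n x @[n --> \oo] --> g x y * total_weight c y.
Hypotheses (gC : forall x y, g x y = g y x) (uK : uniq K).
Hypotheses (V0 : forall y, 0 <= V y) (VK : forall y, y \notin K -> V y = 0).

(* [survival x = E_x (exp (- sum_n sigma_n V (Z_n) / lambda_(Z_n)))]: integrating
   out an exponential time of rate 1 yields the factor [(1 + V y / lambda_y)^-1]. *)
Definition survival : E -> R := killed c (fun y => (1 + V y / total_weight c y)^-1).

(** The probability of avoiding [K] at all times from 1 on: [killed] also tests time 0, so it is
    taken after one step. On [K], multiplication by [total_weight c x] gives the equilibrium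
    measure. *)
Definition escape : E -> R := walk_op c (killed c (fun y => (y \notin K)%:R)).

Let r01 y : 0 <= (1 + V y / total_weight c y)^-1 <= 1.
Proof.
have v0 : 0 <= V y / total_weight c y by rewrite divr_ge0// ltW.
by rewrite invr_ge0 addr_ge0//= invf_le1 ?lerDl// ltr_pwDl.
Qed.

Let r1 y : y \notin K -> (1 + V y / total_weight c y)^-1 = 1.
Proof. by move=> /VK ->; rewrite mul0r addr0 invr1. Qed.

Lemma survival_ge0 x : 0 <= survival x. Proof. exact: killed_ge0. Qed.

Lemma survival_le1 x : survival x <= 1. Proof. exact: killed_le1. Qed.

(** The case [r = (1 + V / lambda)^-1] of [killed_potential]. There [P killed = killed / r], so the
    source [(1 - r) P killed] is [V / lambda] times [survival], and this [lambda] cancels the one in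
    the number of visits [g x y * lambda_y]. *)
Lemma survival_green x : survival x + \sum_(y <- K) g x y * V y * survival y = 1.
Proof.
apply/eqP; rewrite addrC -subr_eq0 -addrA -opprB subr_eq0; apply/eqP.
rewrite [RHS](killed_potential gc lam0 r01 r1 uK cvg_g).
apply: eq_bigr => y _.
have v0 : 0 <= V y / total_weight c y by rewrite divr_ge0// ltW.
have l0 : total_weight c y != 0 by rewrite gt_eqF.
have v1 : 1 + V y / total_weight c y != 0 by rewrite gt_eqF// ltr_pwDl.
have -> : walk_op c (killed c (fun y => (1 + V y / total_weight c y)^-1)) y =
    (1 + V y / total_weight c y) * survival y.
  by rewrite /survival [in RHS](killedE gc lam0 r01) mulrA divff// mul1r.
rewrite [X in _ = X * _](_ : _ = V y / total_weight c y * survival y).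
  by rewrite -[in LHS](divfK l0 (V y)); ring.
by rewrite mulrA mulrBl mul1r mulVf// addrAC subrr add0r.
Qed.

(** The case where [r] is the indicator of the complement of [K]: from a point of [K] the walk is
    killed at time 0, so [killed x = 0], and [1 - r] is 1 on [K]. *)
Lemma escape_green x : x \in K ->
  \sum_(y <- K) g x y * (total_weight c y * escape y) = 1.
Proof.
move=> xK.
have e01 y : 0 <= ((y \notin K)%:R : R) <= 1 by case: (y \notin K); rewrite /= ?lexx ?ler01.
have e1 y : y \notin K -> (y \notin K)%:R = 1 :> R by move=> ->.
have := killed_potential gc lam0 e01 e1 uK cvg_g x.
rewrite (killedE gc lam0 e01) xK mul0r subr0 => ->.
by rewrite !big_seq; apply: eq_bigr => y ->; rewrite /= /escape; ring.
Qed.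

Lemma equilibrium_survival :
  \sum_(x <- K) total_weight c x * escape x * (1 - survival x) =
  \sum_(y <- K) V y * survival y.
Proof.
transitivity (\sum_(x <- K) \sum_(y <- K)
    total_weight c x * escape x * (g x y * V y * survival y)).
  apply: eq_bigr => x _; rewrite -mulr_sumr; congr (_ * _).
  by rewrite -[in LHS](survival_green x) addrAC subrr add0r.
rewrite exchange_big big_seq [RHS]big_seq; apply: eq_bigr => y yK.
rewrite -[RHS]mul1r -(escape_green yK) mulr_suml.
by apply: eq_bigr => x _; rewrite gC; ring.
Qed.

End potential_identities.

(** * The continuous-time walk *)

Section exponential_law.
Context d (T : measurableType d) (R : realType) (m : probability T R).
Variable X : T -> R.
Hypothesis mX : measurable_fun setT X.
Hypothesis lawX : forall B : set R, measurable B ->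
  m [set w | B (X w)] = exponential_prob 1 B.

Lemma integral_exponential_law (g : R -> \bar R) :
    measurable_fun setT g -> (forall x, (0 <= g x)%E) ->
  (\int[m]_w g (X w) =
   \int[lebesgue_measure]_x (g x * (exponential_pdf 1 x)%:E))%E.
Proof.
move=> mg g0.
transitivity (\int[m]_w (g (X w) * (cst 1 w)%:E))%E.
  by apply: eq_integral => w _; rewrite mule1.
apply: (@eq_weighted_integral _ _ _ _ _ _ R m (@lebesgue_measure R)
  (cst 1) (exponential_pdf 1) X id) => //.
- by move=> x; apply: exponential_pdf_ge0.
- exact: measurable_exponential_pdf.
- move=> B mB; rewrite preimage_id -[RHS]/(exponential_prob 1 B) -lawX//.
  rewrite -[RHS]mul1e -integral_cst//.
  exact: measurable_preimage.
Qed.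

Lemma exponential_law_lt0 : m [set w | X w < 0] = 0%E.
Proof.
rewrite (_ : [set w | _] = [set w | `]-oo, 0[%classic (X w)]); last first.
  by apply/seteqP; split=> w /=; rewrite in_itv.
rewrite lawX// /exponential_prob; apply: integral0_eq => x.
by rewrite /= in_itv /= => x0; rewrite lt0_exponential_pdf.
Qed.

(** [X] is nonnegative only almost surely; the absolute value bounds the integrand by 1 everywhere.
    Tilting the density of rate 1 by [expR (- a x)] gives [(1 + a)^-1] times the density of rate
    [1 + a]. *)
Lemma exponential_law_laplace (a : R) : 0 <= a ->
  (\int[m]_w (expR (- (a * `|X w|)))%:E = ((1 + a)^-1)%:E)%E.
Proof.
move=> a0; have a1 : 0 < 1 + a by rewrite ltr_pwDl.
rewrite (@integral_exponential_law (fun x => (expR (- (a * `|x|)))%:E)); last 2 first.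
- apply/measurable_EFinP/measurableT_comp => //; apply: measurableT_comp => //.
  by apply: measurable_funM => //; exact: measurableT_comp.
- by move=> x; rewrite lee_fin expR_ge0.
transitivity (\int[lebesgue_measure]_x ((1 + a)^-1%:E * (exponential_pdf (1 + a) x)%:E))%E.
  apply: eq_integral => x _; rewrite -!EFinM; congr EFin.
  have [x0|x0] := ltP x 0; first by rewrite !lt0_exponential_pdf// !mulr0.
  rewrite !exponential_pdfE// ger0_norm// mul1r mulrA mulVf ?gt_eqF// mul1r -expRD.
  by congr expR; ring.
rewrite ge0_integralZl_EFin//.
- by rewrite integral_exponential_pdf// mule1.
- by move=> x _; rewrite lee_fin exponential_pdf_ge0// ltW.
- by apply/measurable_EFinP; exact: measurable_exponential_pdf.
- by rewrite invr_ge0 ltW.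
Qed.

(** The tail formula turns the mean into the integral over [r >= 0] of the probability of [X > r],
    which is [expR (- r)], again the density of rate 1. *)
Lemma exponential_law_mean : (\int[m]_w (Num.max 0 (X w))%:E = 1)%E.
Proof.
pose Y w := Num.max 0 (X w).
have mY : measurable_fun setT Y by exact: measurable_maxr.
pose mixY := isMeasurableFun.Build _ _ _ _ Y mY.
pose Y' : {mfun T >-> R} := HB.pack Y mixY.
have := @ge0_expectation_ccdf _ _ _ m Y'.
rewrite unlock => ->; last by move=> w; rewrite /= /Y le_max lexx.
rewrite -[RHS](@integral_exponential_pdf R 1)// integral_mkcond.
apply: eq_integral => r _; rewrite patchE; case: ifPn => [/set_mem|r0]; last first.
  rewrite lt0_exponential_pdf// ltNge; apply: contra r0 => r0.
  by apply/mem_set; rewrite /= in_itv /= r0.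
rewrite /= in_itv /= andbT => r0.
rewrite exponential_pdfE// mul1r mulN1r /ccdf /distribution /pushforward /=.
have -> : Y @^-1` `]r, +oo[ = ~` (X @^-1` `]-oo, r]).
  apply/seteqP; split=> w /=; rewrite !in_itv /= andbT /Y lt_max.
    by case/orP; [rewrite ltNge r0|rewrite ltNge => /negP].
  by move/negP; rewrite -ltNge => ->; rewrite orbT.
rewrite probability_setC; last exact: measurable_preimage.
rewrite -[X @^-1` _]/[set w | `]-oo, r]%classic (X w)] lawX//.
rewrite (_ : exponential_prob 1 `]-oo, r] = exponential_prob 1 `[0, r]); last first.
  rewrite /exponential_prob integral_mkcond [RHS]integral_mkcond.
  apply: eq_integral => x _; rewrite !patchE.
  case: ifPn => [/set_mem|h1]; case: ifPn => [/set_mem|h2] //=.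
  - rewrite in_itv /= => xr; rewrite lt0_exponential_pdf// ltNge.
    by apply: contra h2 => x0; apply/mem_set; rewrite /= in_itv /= x0.
  - rewrite in_itv /= => /andP[_ xr]; move/negP: h1; case.
    by apply/mem_set; rewrite /= in_itv /=.
have -> : exponential_prob 1 `[0, r] = (1 - expR (- r))%:E.
  move: r0; rewrite le_eqVlt => /predU1P[<-|r0].
    by rewrite set_itv1 /exponential_prob integral_set1 oppr0 expR0 subrr.
  by rewrite exponential_prob_itv0c// mulN1r.
rewrite -[LHS]/((1 - (1 - expR (- r)))%:E).
by rewrite opprB addrC subrK.
Qed.

End exponential_law.

(** * Walks with exponential holding times on an arbitrary probability space *)

Section walk_law.
Context d (T : measurableType d) (R : realType) (E : pointedType) (c : E -> E -> R).
Variables (m : probability T R) (Z : T -> prod_space nat (vertex E))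
  (sigma : T -> prod_space nat R) (x : E).
Hypotheses (mZ : measurable_fun setT Z) (msigma : measurable_fun setT sigma).
Hypothesis srw : simple_random_walk c m (Z : T -> nat -> E) x.
Hypothesis gc : weighted_graph c.

Let cylinder (n : nat) (z : nat -> E) : set T :=
  [set w | forall i, (i <= n)%N -> Z w i = z i].

Let cylinder_prob n z : R :=
  (z 0%N == x)%:R * \prod_(i < n) transition c (z i) (z i.+1).

Let mZi i : measurable_fun setT (fun w => Z w i).
Proof. exact: (measurableT_comp (measurable_prod_coordinate i) mZ). Qed.

Let mfZ (f : E -> R) i : measurable_fun setT (fun w => f (Z w i)).
Proof. exact: (measurableT_comp (measurable_vertex_fun f) (mZi i)). Qed.

Let msigmai i : measurable_fun setT (fun w => sigma w i).
Proof. exact: (measurableT_comp (measurable_prod_coordinate i) msigma). Qed.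

Let cylinderE n z : cylinder n z = Z @^-1` [set f | forall i, (i <= n)%N -> f i = z i].
Proof. by []. Qed.

Lemma measurable_cylinder n (z : nat -> E) :
  measurable [set f : prod_space nat (vertex E) | forall i, (i <= n)%N -> f i = z i].
Proof.
rewrite (_ : [set f | _] = \bigcap_(i in [set i | (i <= n)%N])
    (fun f : prod_space nat (vertex E) => f i) @^-1` [set z i]) //.
apply: bigcap_measurable; first by exists 0%N.
move=> i _; rewrite -[X in measurable X]setTI.
exact: measurable_prod_coordinate.
Qed.

Let mcyl n z : measurable (cylinder n z).
Proof.
rewrite cylinderE; apply: measurable_preimage => //; exact: measurable_cylinder.
Qed.

Let cylinder_probE n z : m (cylinder n z) = (cylinder_prob n z)%:E.
Proof. exact: srw. Qed.

Lemma total_weight_ge0 y : 0 <= total_weight c y.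
Proof. by rewrite total_weightE//; apply: sumr_ge0 => z _; exact: (weight_ge0 gc). Qed.

Let start_prob1 : m [set w | Z w 0%N = x] = 1%E.
Proof.
have := srw 0%N (fun=> x); rewrite big_ord0 mulr1 eqxx => <-.
congr (m _); apply/seteqP; split => w /=; last exact.
by move=> h i; rewrite leqn0 => /eqP ->.
Qed.

(** If the total weight at [x] were 0, every [transition c x y] would be 0 by the convention for
    division by 0, so each possible second vertex would have probability 0; as [E] is countable,
    this contradicts that the walk starts at [x] with probability 1. *)
Lemma walk_total_weight_gt0 : 0 < total_weight c x.
Proof.
rewrite lt_neqAle total_weight_ge0 andbT eq_sym; apply/eqP => l0.
have /countable_injP[f injf] := graph_countable gc.
have null y : m [set w | Z w 0%N = x /\ Z w 1%N = y] = 0%E.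
  have := srw 1%N (fun i => if i is 0%N then x else y).
  rewrite big_ord_recl big_ord0 /= /transition l0 invr0 mulr0 mul0r mulr0 => h'.
  rewrite -[0%E]/(0%R%:E) -h' {h'}.
  congr (m _); apply/seteqP; split => w /=.
    by move=> [h0 h1] [|[|]].
  by move=> h; rewrite (h 0%N)// (h 1%N).
have mn y : measurable [set w | Z w 0%N = x /\ Z w 1%N = y].
  rewrite (_ : [set w | _] = (fun w => Z w 0%N) @^-1` [set x] `&`
    (fun w => Z w 1%N) @^-1` [set y])//.
  by apply: measurableI; rewrite -[X in measurable X]setTI; exact: mZi.
have : m.-negligible [set w | Z w 0%N = x].
  apply: (@negligibleS _ _ _ _ (\bigcup_n [set w | Z w 0%N = x /\ f (Z w 1%N) = n])).
    by move=> w /= Zw; exists (f (Z w 1%N)).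
  apply: negligible_bigcup => n; have [[y fy]|nf] := pselect (exists y, f y = n).
    exists [set w | Z w 0%N = x /\ Z w 1%N = y]; split=> // [|w /= [Zw fw]].
      exact: null.
    by split=> //; apply: injf; rewrite ?in_setT// fw -fy.
  apply: (@negligibleS _ _ _ _ set0); last exact: negligible_set0.
  by move=> w /= [_ h]; apply: nf; exists (Z w 1%N).
have mS : measurable [set w | Z w 0%N = x].
  by rewrite -[X in measurable X]setTI; exact: (@mZi 0%N measurableT [set x] I).
move=> /(measure_negligible mS) h.
suff : (1%E : \bar R) = 0%E by move=> /(congr1 fine) /= /eqP; rewrite oner_eq0.
by rewrite -start_prob1 h.
Qed.

Hypothesis lam0 : forall y, 0 < total_weight c y.

Let upd (z : nat -> E) n y i := if (i <= n)%N then z i else y.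

Let cylinder_upd n z y : cylinder n.+1 (upd z n y) =
  cylinder n z `&` [set w | Z w n.+1 = y].
Proof.
apply/seteqP; split => w /=.
  move=> h; split=> [i i_n|]; last by rewrite h// /upd ltnn.
  by rewrite h ?(leq_trans i_n)// /upd i_n.
move=> [h1 h2] i; rewrite leq_eqVlt => /orP[/eqP ->|]; first by rewrite h2 /upd ltnn.
by rewrite ltnS => i_n; rewrite h1// /upd i_n.
Qed.

Let cylinder_prob_upd n z y : cylinder_prob n.+1 (upd z n y) =
  cylinder_prob n z * transition c (z n) y.
Proof.
rewrite /cylinder_prob big_ord_recr /= mulrA /upd leqnn ltnn /=; congr (_ * _ * _).
by apply: eq_bigr => i _; rewrite ltnW//= ltn_ord.
Qed.

Let cylinder_prob_sum n z : cylinder_prob n z =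
  \sum_(y <- neighbors c (z n)) cylinder_prob n.+1 (upd z n y).
Proof.
rewrite -[LHS]mulr1 -(walk_op1 gc lam0 (z n)) mulr_sumr.
by apply: eq_bigr => y _; rewrite cylinder_prob_upd mulr1.
Qed.

Let cyls n z := \big[setU/set0]_(y <- neighbors c (z n)) cylinder n.+1 (upd z n y).

Let trivIset_cyls n z : trivIset [set` neighbors c (z n)]
  (fun y => cylinder n.+1 (upd z n y)).
Proof.
move=> y1 y2 _ _ [w []]; rewrite !cylinder_upd => -[_ /= <-] [_ /= <-].
by [].
Qed.

(** The cylinder may contain paths whose next vertex is not a neighbor. They form a null set,
    because the probabilities of the extensions by neighbors already add up to that of the
    cylinder. *)
Let integral_cylinder_split n z (f : T -> R) : measurable_fun setT f ->
    (forall w, 0 <= f w) ->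
  (\int[m]_(w in cylinder n z) (f w)%:E =
   \sum_(y <- neighbors c (z n))
     \int[m]_(w in cylinder n.+1 (upd z n y)) (f w)%:E)%E.
Proof.
move=> mf f0.
have mE : measurable_fun setT (EFin \o f) by exact/measurable_EFinP.
have mcyls : measurable (cyls n z) by apply: bigsetU_measurable => y _; exact: mcyl.
have sub : cyls n z `<=` cylinder n z.
  by rewrite /cyls -bigcup_seq => w [y _]; rewrite cylinder_upd => -[].
have null : m (cylinder n z `\` cyls n z) = 0%E.
  rewrite measureD//; last by rewrite -ge0_fin_numE// fin_num_measure.
  rewrite setIidr//.
  have e : m (cyls n z) = (\sum_(y <- neighbors c (z n)) m (cylinder n.+1 (upd z n y)))%E.
    rewrite -[LHS]mul1e -integral_cst// /cyls ge0_integral_bigsetU//.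
    - by apply: eq_bigr => y _; rewrite integral_cst// mul1e.
    - exact: uniq_neighbors.
  transitivity (m (cylinder n z) - m (cyls n z))%E => //; rewrite e.
  under eq_bigr do rewrite cylinder_probE.
  by rewrite cylinder_probE sumEFin -cylinder_prob_sum -EFinB subrr.
rewrite (@ge0_negligible_integral _ _ _ m _ (cylinder n z `\` cyls n z))//.
- rewrite setDD setIidr// /cyls ge0_integral_bigsetU//.
  + exact: uniq_neighbors.
  + exact: measurable_funTS.
  + by move=> w _; rewrite lee_fin.
- exact: measurableD.
- exact: measurable_funTS.
- by move=> w _; rewrite lee_fin.
Qed.

Hypothesis iid : iid_exp1 m (sigma : T -> nat -> R).
Hypothesis indep : forall (A : set (prod_space nat (vertex E)))
    (B : set (prod_space nat R)), measurable A -> measurable B ->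
  m (Z @^-1` A `&` sigma @^-1` B) = (m (Z @^-1` A) * m (sigma @^-1` B))%E.

(** Independence, extended from sets to functions of [sigma]: the law of [sigma] weighted by the
    indicator of the path event is compared with its law weighted by a constant. *)
Lemma integral_path_times (A : set (prod_space nat (vertex E)))
    (G : prod_space nat R -> \bar R) :
    measurable A -> measurable_fun setT G -> (forall s, (0 <= G s)%E) ->
  (\int[m]_(w in Z @^-1` A) G (sigma w) = m (Z @^-1` A) * \int[m]_w G (sigma w))%E.
Proof.
move=> mA mG G0.
have mZA : measurable (Z @^-1` A) by exact: measurable_preimage.
have mAfin : (m (Z @^-1` A) \is a fin_num)%E by rewrite fin_num_measure.
have mGs : measurable_fun setT (fun w => G (sigma w)) by exact: measurableT_comp.
have a0 : 0 <= fine (m (Z @^-1` A)) by rewrite fine_ge0.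
have := @eq_weighted_integral _ _ _ T T (prod_space nat R) R m m
  \1_(Z @^-1` A) (cst (fine (m (Z @^-1` A)))) sigma sigma _ _ _ _ msigma msigma _ G mG G0.
have -> : (\int[m]_w (G (sigma w) * (\1_(Z @^-1` A) w)%:E) =
    \int[m]_(w in Z @^-1` A) G (sigma w))%E.
  rewrite [RHS]integral_mkcond; apply: eq_integral => w _.
  by rewrite patchE indicE; case: ifP => _; rewrite ?mule1 ?mule0.
have -> : (\int[m]_w (G (sigma w) * (cst (fine (m (Z @^-1` A))) w)%:E) =
   m (Z @^-1` A) * \int[m]_w G (sigma w))%E.
  by rewrite /= ge0_integralZr//= fineK// muleC.
apply => //.
move=> B mB; have msB : measurable (sigma @^-1` B).
  exact: measurable_preimage.
rewrite integral_indic//= [in LHS]indep//.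
transitivity ((fine (m (Z @^-1` A)))%:E * m (sigma @^-1` B))%E.
  by rewrite fineK.
by rewrite -integral_cst.
Qed.

Let rate_factor (a : nat -> R) n w := \prod_(i < n) expR (- (a i * `|sigma w i|)).

Let integral_rates (a : nat -> R) n z : (forall i, 0 <= a i) ->
  (\int[m]_(w in cylinder n z) (rate_factor a n.+1 w)%:E =
   (cylinder_prob n z * \prod_(i < n.+1) (1 + a i)^-1)%:E)%E.
Proof.
move=> a0; pose g i (s : R) := expR (- (a i * `|s|)).
have mg i : measurable_fun setT (g i).
  apply: measurableT_comp => //; apply: measurableT_comp => //.
  by apply: measurable_funM => //; exact: measurableT_comp.
have g01 i s : 0 <= g i s <= 1.
  by rewrite expR_ge0 expR_le1 oppr_le0 mulr_ge0.
pose G (s : prod_space nat R) := (\prod_(i <- index_iota 0 n.+1) g i (s i))%:E.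
transitivity (\int[m]_(w in Z @^-1` [set f | forall i, (i <= n)%N -> f i = z i])
    G (sigma w))%E.
  by apply: eq_integral => w _; rewrite /G big_mkord.
rewrite (integral_path_times (measurable_cylinder n z) (G := G)); last 2 first.
- apply/measurable_EFinP; apply: measurable_prod => i _.
  exact: (measurableT_comp (mg i) (measurable_prod_coordinate i)).
- by move=> s; rewrite lee_fin prodr_ge0// => i _; case/andP: (g01 i (s i)).
rewrite -cylinderE cylinder_probE [RHS]EFinM; congr mule.
rewrite (@independent_integral_prod _ _ _ _ _ m nat (fun i w => sigma w i) g)//.
- rewrite -[in RHS](big_mkord xpredT (fun i => (1 + a i)^-1)) -prodEFin.
  by apply: eq_bigr => i _; apply: exponential_law_laplace => //; exact: iid.2.
- exact: iid.1.
- exact: iota_uniq.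
Qed.

Let weight_factor (phi v : nat -> E -> R) n N w :=
  \prod_(j < N.+1) (phi j (Z w (n + j)%N) *
                    expR (- (v j (Z w (n + j)%N) * `|sigma w (n + j)%N|))).

Let m_rate a n : measurable_fun setT (rate_factor a n).
Proof.
apply: measurable_prod => i _; apply: measurableT_comp => //.
apply: measurableT_comp => //; apply: measurable_funM => //.
exact: measurableT_comp.
Qed.

Let m_weight phi v n N : measurable_fun setT (weight_factor phi v n N).
Proof.
apply: measurable_prod => i _; apply: measurable_funM; first exact: mfZ.
apply: measurableT_comp => //.
apply: measurableT_comp => //; apply: measurable_funM; first exact: mfZ.
exact: measurableT_comp.
Qed.

Let rate_ge0 a n w : 0 <= rate_factor a n w.
Proof. by apply: prodr_ge0 => i _; exact: expR_ge0. Qed.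

Let weight_ge0 phi v n N w : (forall i y, 0 <= phi i y) ->
  0 <= weight_factor phi v n N w.
Proof. by move=> phi0; apply: prodr_ge0 => i _; rewrite mulr_ge0 ?expR_ge0. Qed.

(** The first [n] holding times carry fixed rates [a], the next [N + 1] carry rates depending on the
    vertex. Fixing the path up to time [n] turns the rate at time [n] into the number [v 0 (z n)],
    which joins the fixed ones; splitting over the next vertex then gives the recursion that defines
    [path_functional]. *)
Let integral_path_from N : forall n z a phi v,
    (forall i, 0 <= a i) -> (forall i y, 0 <= phi i y) -> (forall i y, 0 <= v i y) ->
  (\int[m]_(w in cylinder n z) (rate_factor a n w * weight_factor phi v n N w)%:E =
   (cylinder_prob n z * (\prod_(i < n) (1 + a i)^-1) *
    path_functional c (fun i y => phi i y * (1 + v i y)^-1) N (z n))%:E)%E.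
Proof.
elim: N => [|N IH] n z a phi v a0 phi0 v0;
  pose a' i := if i == n then v 0%N (z n) else a i;
  have a'0 : forall i, 0 <= a' i by move=> i; rewrite /a'; case: ifP.
- transitivity (\int[m]_(w in cylinder n z)
      ((phi 0%N (z n))%:E * (rate_factor a' n.+1 w)%:E))%E.
    apply: eq_integral => w /set_mem wz; rewrite -EFinM; congr EFin.
    rewrite /weight_factor big_ord1 addn0 wz// /rate_factor big_ord_recr /=.
    rewrite /a' eqxx mulrCA; congr (_ * (_ * _)).
    by apply: eq_bigr => i _; rewrite ltn_eqF.
  rewrite ge0_integralZl_EFin//; last 2 first.
  - by move=> w _; rewrite lee_fin.
  - by apply: measurable_funTS; exact/measurable_EFinP.
  rewrite integral_rates// -EFinM; congr EFin.
  rewrite big_ord_recr /= {2}/a' eqxx.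
  rewrite (eq_bigr (fun i : 'I_n => (1 + a i)^-1)); first by ring.
  by move=> i _; rewrite /a' ltn_eqF.
- rewrite integral_cylinder_split; last 2 first.
  + exact: measurable_funM.
  + by move=> w; rewrite mulr_ge0// weight_ge0.
  rewrite /= mulrA -[X in _ * X * _]/(phi 0%N (z n) * (1 + v 0%N (z n))^-1).
  rewrite /walk_op mulr_sumr -sumEFin; apply: eq_bigr => y _.
  transitivity (\int[m]_(w in cylinder n.+1 (upd z n y)) ((phi 0%N (z n))%:E *
     (rate_factor a' n.+1 w *
      weight_factor (fun i => phi i.+1) (fun i => v i.+1) n.+1 N w)%:E))%E.
    apply: eq_integral => w /set_mem; rewrite cylinder_upd => -[wz _].
    rewrite -EFinM; congr EFin.
    rewrite /weight_factor big_ord_recl /= addn0 wz// /rate_factor [in RHS]big_ord_recr /=.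
    rewrite /a' eqxx.
    have -> : \prod_(i < n) expR (- ((if i == n :> nat then v 0%N (z n) else a i) * `|sigma w i|)) =
        \prod_(i < n) expR (- (a i * `|sigma w i|)).
      by apply: eq_bigr => i _; rewrite ltn_eqF.
    have -> : \prod_(i < N.+1) (phi (bump 0 i) (Z w (n + bump 0 i)%N) *
        expR (- (v (bump 0 i) (Z w (n + bump 0 i)%N) * `|sigma w (n + bump 0 i)%N|))) =
        \prod_(j < N.+1) (phi j.+1 (Z w (n.+1 + j)%N) *
        expR (- (v j.+1 (Z w (n.+1 + j)%N) * `|sigma w (n.+1 + j)%N|))).
      by apply: eq_bigr => i _; rewrite /bump leq0n add1n addSnnS.
    by ring.
  rewrite ge0_integralZl_EFin//; last 2 first.
  - by move=> w _; rewrite lee_fin mulr_ge0// weight_ge0.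
  - by apply: measurable_funTS; apply/measurable_EFinP; exact: measurable_funM.
  rewrite IH// -EFinM; congr EFin.
  rewrite cylinder_prob_upd big_ord_recr /= {2}/a' eqxx /upd ltnn.
  rewrite (eq_bigr (fun i : 'I_n => (1 + a i)^-1)); first by ring.
  by move=> i _; rewrite /a' ltn_eqF.
Qed.

(** The case with no fixed rates: each step contributes [phi] times the Laplace transform
    [(1 + v)^-1] of its holding time. *)
Lemma integral_walk (phi v : nat -> E -> R) N :
    (forall i y, 0 <= phi i y) -> (forall i y, 0 <= v i y) ->
  (\int[m]_w (\prod_(j < N.+1) (phi j (Z w j) * expR (- (v j (Z w j) * `|sigma w j|))))%:E =
   (path_functional c (fun i y => phi i y * (1 + v i y)^-1) N x)%:E)%E.
Proof.
move=> phi0 v0; have := @integral_path_from N 0%N (fun=> x) (fun=> 0) phi v.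
rewrite /cylinder_prob !big_ord0 eqxx !mul1r => <- //.
have c1 : m (cylinder 0 (fun=> x)) = 1%E.
  by rewrite cylinder_probE /cylinder_prob big_ord0 eqxx mulr1.
have c0 : m (~` cylinder 0 (fun=> x)) = 0%E.
  by rewrite probability_setC// c1 subee.
rewrite (@ge0_negligible_integral _ _ _ m _ (~` cylinder 0 (fun=> x)))//.
- rewrite setDE setCK setTI; apply: eq_integral => w _.
  by rewrite /rate_factor big_ord0 mul1r.
- exact: measurableC.
- exact/measurable_EFinP/(@m_weight phi v 0%N N).
- by move=> w _; rewrite lee_fin; exact: (@weight_ge0 phi v 0%N N w).
Qed.

End walk_law.

Lemma measurable_set_ltr d (T : measurableType d) (R : realType) (f g : T -> R) :
  measurable_fun setT f -> measurable_fun setT g -> measurable [set w | f w < g w].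
Proof.
by move=> mf mg; rewrite -[X in measurable X]setTI; exact: measurable_fun_ltr.
Qed.

Lemma measurable_set_ler d (T : measurableType d) (R : realType) (f g : T -> R) :
  measurable_fun setT f -> measurable_fun setT g -> measurable [set w | f w <= g w].
Proof.
by move=> mf mg; rewrite -[X in measurable X]setTI; exact: measurable_fun_ler.
Qed.

Lemma measurable_prod_space (I : Type) d d' (T : measurableType d)
    (T' : measurableType d') (F : T -> prod_space I T') :
  (forall i, measurable_fun setT (fun w => F w i)) -> measurable_fun setT F.
Proof.
move=> mF; apply: (measurability (@cylinders I _ T' : set (set (prod_space I T')))) => //.
move=> _ [_ [i _ [B mB <-]] <-]; rewrite !setTI.
by rewrite -[X in measurable X]setTI; exact: (mF i measurableT B mB).
Qed.

Section path_measurability.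
Context (R : realType) (E : pointedType).

Lemma measurable_pathZ : measurable_fun setT (@pathZ R E).
Proof.
apply: measurable_prod_space => i.
apply: (measurableT_comp measurable_fst); exact: measurable_prod_coordinate.
Qed.

Lemma measurable_pathsigma : measurable_fun setT (@pathsigma R E).
Proof.
apply: measurable_prod_space => i.
apply: (measurableT_comp measurable_snd); exact: measurable_prod_coordinate.
Qed.

End path_measurability.

(** * Green function and escape probabilities of the walk *)

Section green_function.
Context (R : realType) (E : pointedType) (c : E -> E -> R)
  (P : E -> probability (path_space R E) R).
Hypotheses (gc : weighted_graph c) (walkP : forall x, walk_law c x (P x)).

Lemma total_weight_gt0 x : 0 < total_weight c x.
Proof.
have [srw _ _] := walkP x.
exact: (walk_total_weight_gt0 (measurable_pathZ (R := R) (E := E)) srw gc).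
Qed.

Let lam0 := total_weight_gt0.

Let n_step (n : nat) (x y : E) : R := iter n (walk_op c) (fun z => (z == y)%:R) x.

Let mpathZi i : measurable_fun setT (fun w : path_space R E => pathZ w i : vertex E).
Proof.
exact: (measurableT_comp (measurable_prod_coordinate i) (measurable_pathZ (E := E))).
Qed.

Let msigmai i : measurable_fun setT (fun w : path_space R E => pathsigma w i).
Proof.
exact: (measurableT_comp (measurable_prod_coordinate i) (measurable_pathsigma (E := E))).
Qed.

Lemma walk_functional x (phi : nat -> E -> R) N : (forall i y, 0 <= phi i y) ->
  (\int[P x]_w (\prod_(j < N.+1) phi j (pathZ w j))%:E =
   (path_functional c phi N x)%:E)%E.
Proof.
move=> phi0; have [srw iid indep] := walkP x.
have := integral_walk (measurable_pathZ (E := E)) (measurable_pathsigma (E := E))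
  srw gc lam0 iid indep N phi0 (v := fun _ _ => 0) (fun _ _ => lexx _).
under eq_integral do under eq_bigr do rewrite mul0r oppr0 expR0 mulr1.
move=> ->; congr EFin; apply: eq_path_functional => i y.
by rewrite addr0 invr1 mulr1.
Qed.

Lemma walk_at x y n : P x [set w | pathZ w n = y] = (n_step n x y)%:E.
Proof.
rewrite /n_step -path_functional_last -walk_functional; last first.
  by move=> i z; case: ifP => // _; case: (z == y).
have mS : measurable [set w : path_space R E | pathZ w n = y].
  by rewrite -[X in measurable X]setTI; exact: (@mpathZi n measurableT [set y] I).
rewrite -[in LHS](setIT [set w | _]) -integral_indic//.
apply: eq_integral => w _; congr EFin.
rewrite big_ord_recr /= eqxx big1 ?mul1r; last by move=> i _; rewrite ltn_eqF.
rewrite indicE; congr ((nat_of_bool _)%:R).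
by apply/idP/eqP => [/set_mem//|h]; exact/mem_set.
Qed.

Let sojourn (w : path_space R E) k : set R :=
  `[\sum_(i < k) pathsigma w i, \sum_(i < k.+1) pathsigma w i[.

Let time_at (y : E) (w : path_space R E) : \bar R :=
  (\sum_(k <oo) ((pathZ w k == y)%:R * Num.max 0 (pathsigma w k))%:E)%E.

Let sigma_ge0 x : {ae P x, forall w, forall k, 0 <= pathsigma w k}.
Proof.
have [srw iid indep] := walkP x.
exists (\bigcup_k [set w | pathsigma w k < 0]); split.
- by apply: bigcupT_measurable => k; exact: measurable_set_ltr.
- apply/eqP; rewrite -measure_le0.
  apply: le_trans (measure_sigma_subadditive _ _ _ (@subset_refl _ _)) _.
  + by move=> k; exact: measurable_set_ltr.
  + by apply: bigcupT_measurable => k; exact: measurable_set_ltr.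
  + rewrite eseries0// => k _ _; apply: exponential_law_lt0 => // B mB.
    exact: iid.2.
- move=> w /= /existsNP[k /negP]; rewrite -ltNge => h; by exists k.
Qed.

Let at_set (y : E) : set (path_space R E * R) :=
  [set wt | 0 <= wt.2 /\ continuous_walk_at wt.1 wt.2 y].

Let partial_sum k (w : path_space R E) : R := \sum_(i < k) pathsigma w i.

Let mpartial k : measurable_fun setT (partial_sum k).
Proof. exact: measurable_sum. Qed.

Let mat_set y : measurable (at_set y).
Proof.
rewrite (_ : at_set y = (setT `*` [set t | 0 <= t]) `&` \bigcup_k
   (((fun w => pathZ w k : vertex E) @^-1` [set y] `*` setT) `&`
   ([set wt | partial_sum k wt.1 <= wt.2] `&` [set wt | wt.2 < partial_sum k.+1 wt.1]))).
  apply: measurableI.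
    apply: measurableX => //; rewrite (_ : [set t | _] = `[0, +oo[%classic)//.
    by apply/seteqP; split => t /=; rewrite in_itv /= andbT.
  apply: bigcupT_measurable => k; apply: measurableI.
    apply: measurableX => //; rewrite -[X in measurable X]setTI.
    exact: (@mpathZi k measurableT [set y] I).
  have m1 j : measurable_fun setT (fun wt : path_space R E * R => partial_sum j wt.1).
    exact: measurableT_comp.
  apply: measurableI.
    by apply: measurable_set_ler => //; exact: measurable_snd.
  by apply: measurable_set_ltr => //; exact: measurable_snd.
apply/seteqP; split => -[w t] /=.
  by move=> [t0 [k [/andP[h1 h2] Zk]]]; split => //; exists k.
move=> [[_ t0] [k _ [[Zk _] [h1 h2]]]]; split => //; exists k; split => //.
by apply/andP.
Qed.

Let xsection_at y w : xsection (at_set y) w =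
  [set t | 0 <= t] `&` \bigcup_(k in [set k | pathZ w k = y]) sojourn w k.
Proof.
apply/seteqP; split => t; rewrite /xsection /= in_setE /=.
  by move=> [t0 [k [h Zk]]]; split => //; exists k => //; rewrite /sojourn /= in_itv.
move=> [t0 [k Zk]]; rewrite /sojourn /= in_itv /= => h; split => //.
by exists k.
Qed.

(** For nonnegative holding times the sojourn intervals are disjoint, so the time spent at [y] is
    the sum of their lengths. The hypothesis holds only almost surely, hence the [Num.max 0] in
    [time_at], which keeps its terms nonnegative on every path. *)
Let measure_xsection y w : (forall k, 0 <= pathsigma w k) ->
  lebesgue_measure (xsection (at_set y) w) = time_at y w.
Proof.
move=> s0.
have ndS : {homo (fun k => \sum_(i < k) pathsigma w i) : a b / (a <= b)%N >-> a <= b}.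
  apply: homo_leq => // [? ? ?|k]; first exact: le_trans.
  by rewrite big_ord_recr /= lerDl.
pose F k := if pathZ w k == y then sojourn w k else set0.
have -> : xsection (at_set y) w = \bigcup_k F k.
  rewrite xsection_at; apply/seteqP; split => t.
    by move=> [_ [k /= Zk h]]; exists k => //; rewrite /F Zk eqxx.
  move=> [k _]; rewrite /F; case: eqP => // Zk h; split; last by exists k.
  move: h; rewrite /sojourn /= in_itv /= => /andP[+ _]; apply: le_trans.
  by rewrite sumr_ge0.
have mF k : measurable (F k).
  by rewrite /F; case: ifP => _; [exact: measurable_itv|exact: measurable0].
have tF : trivIset setT F.
  apply/trivIsetP => i j _ _; wlog ij : i j / (i < j)%N.
    move=> wl; rewrite neq_ltn => /orP[ij|ji]; first by rewrite wl// ltn_eqF.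
    by rewrite setIC wl// ltn_eqF.
  move=> _; apply/seteqP; split => // t [].
  rewrite /F; case: ifP => // _; case: ifP => // _.
  rewrite /sojourn /= !in_itv /= => /andP[_ t1] /andP[t2 _].
  by have := lt_le_trans t1 (ndS _ _ ij); rewrite ltNge t2.
rewrite (@measure_bigcup _ R _ lebesgue_measure setT F (fun k _ => mF k) tF).
transitivity (\sum_(k <oo) lebesgue_measure (F k))%E.
  by apply: eq_eseriesl => k; rewrite in_setT.
rewrite /time_at; apply: eq_eseriesr => k _; rewrite /F.
case: eqP => _; last by rewrite measure0 mul0r.
rewrite /sojourn lebesgue_measure_itv/= lte_fin mul1r big_ord_recr /= ltrDl.
rewrite -EFinB addrAC subrr add0r.
have := s0 k; rewrite le_eqVlt => /predU1P[<-|sk]; first by rewrite ltxx maxxx.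
by rewrite sk; congr EFin; rewrite max_r// ltW.
Qed.

(** The total time at [y] is a sum over the steps of an indicator times an independent holding time
    of mean 1. The identity is one of extended reals: both sides may be [+oo]. *)
Let green_series x y : (green c P x y * (total_weight c y)%:E =
  \sum_(k <oo) (n_step k x y)%:E)%E.
Proof.
have [srw iid indep] := walkP x.
have l0 : total_weight c y != 0 by rewrite gt_eqF.
rewrite /green muleAC -EFinM mulVf// mul1e.
have mt k : measurable_fun setT (fun w : path_space R E =>
    ((pathZ w k == y)%:R * Num.max 0 (pathsigma w k))%:E).
  apply/measurable_EFinP/measurable_funM; last exact: measurable_maxr.
  exact: (measurableT_comp (@measurable_vertex_fun E _ R (fun z => (z == y)%:R)) (mpathZi k)).
have t0 k (w : path_space R E) :
    (0 <= ((pathZ w k == y)%:R * Num.max 0 (pathsigma w k))%:E)%E.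
  by rewrite lee_fin mulr_ge0// le_max lexx.
transitivity (\int[P x]_w lebesgue_measure (xsection (at_set y) w))%E.
  apply: eq_integral => w _.
  have mS : measurable [set t : R | continuous_walk_at w t y].
    rewrite (_ : [set t | _] = \bigcup_(k in [set k | pathZ w k = y]) sojourn w k).
      by apply: bigcup_measurable => k _; exact: measurable_itv.
    apply/seteqP; split => t /=.
      by move=> [k [h Zk]]; exists k => //; rewrite /sojourn /= in_itv.
    by move=> [k Zk]; rewrite /sojourn /= in_itv /= => h; exists k.
  have m0 : measurable [set t : R | 0 <= t].
    rewrite (_ : [set t | _] = `[0, +oo[%classic)//.
    by apply/seteqP; split => t /=; rewrite in_itv /= andbT.
  rewrite integral_indic//; congr (lebesgue_measure _).
  apply/seteqP; split => t; rewrite /xsection /= in_setE /=.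
    by move=> [].
  by move=> [].
transitivity (\int[P x]_w time_at y w)%E.
  apply: ge0_ae_eq_integral => //.
  - exact: (measurable_fun_xsection (@lebesgue_measure R) (mat_set y)).
  - by apply: ge0_emeasurable_sum => [k w _ _|k _]; [exact: t0|exact: mt].
  - by move=> w _; apply: nneseries_ge0 => k _ _; exact: t0.
  - by apply: filterS (sigma_ge0 x) => w sw _; exact: measure_xsection.
rewrite integral_nneseries//; apply: eq_eseriesr => k _.
rewrite -walk_at.
have mA : measurable [set f : prod_space nat (vertex E) | f k = y].
  rewrite -[X in measurable X]setTI.
  exact: (@measurable_prod_coordinate nat _ (vertex E) k measurableT [set y]).
have mG : measurable_fun setT (fun s : prod_space nat R => (Num.max 0 (s k))%:E).
  apply/measurable_EFinP/measurable_maxr => //; exact: measurable_prod_coordinate.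
have := integral_path_times (measurable_pathZ (E := E)) (measurable_pathsigma (E := E))
  indep mA mG (fun s => _).
rewrite exponential_law_mean// ?mule1; last by move=> B mB; exact: iid.2.
move=> <-; last by move=> s; rewrite lee_fin le_max lexx.
rewrite [RHS]integral_mkcond; apply: eq_integral => w _; rewrite patchE.
rewrite (_ : (w \in _) = (pathZ w k == y)); last first.
  by apply/idP/eqP => [/set_mem//|h]; exact/mem_set.
by case: ifP => _; rewrite ?mul1r ?mul0r.
Qed.

Lemma cvg_green x y : (green c P x y \is a fin_num)%E ->
  green_partial c (fun z => (z == y)%:R) n x @[n --> \oo] -->
    fine (green c P x y) * total_weight c y.
Proof.
move=> gfin; have := green_series x y.
rewrite -[in LHS](fineK gfin) -EFinM => gs.
suff h : (green_partial c (fun z => (z == y)%:R) n x)%:E @[n --> \oo] -->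
    (fine (green c P x y) * total_weight c y)%:E by exact: (fine_cvg h).
rewrite gs.
have -> : (fun n => (green_partial c (fun z => (z == y)%:R) n x)%:E) =
    (fun n => \sum_(0 <= k < n) (n_step k x y)%:E)%E.
  by apply/funext => n; rewrite sumEFin.
apply: is_cvg_nneseries => n _ _; rewrite lee_fin /n_step.
elim: n x {gfin gs} => [|n IH] x /=; first by case: (x == y).
by apply: walk_op_ge0.
Qed.

(** Both sides are limits of the probability of avoiding [K] at times 1 to [n + 1]; [phi] is 1 at
    time 0 because the starting point is not tested. *)
Lemma no_return_prob (K : seq E) x :
  P x (no_return [set` K]) = (escape c K x)%:E.
Proof.
pose phi (i : nat) (y : E) : R := if i is 0%N then 1 else (y \notin K)%:R.
pose A n : set (path_space R E) := [set w | forall i, (1 <= i <= n)%N -> ~ [set` K] (pathZ w i)].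
have e01 y : 0 <= ((y \notin K)%:R : R) <= 1.
  by case: (y \notin K); rewrite /= ?lexx ?ler01.
have mA n : measurable (A n).
  rewrite (_ : A n = \bigcap_(i in [set i | (1 <= i <= n)%N])
     (fun w => pathZ w i : vertex E) @^-1` (~` [set` K]))//.
  have [->|/set0P ne] := eqVneq [set i | (1 <= i <= n)%N] set0.
    by rewrite bigcap_set0.
  apply: bigcap_measurable => // i _; rewrite -[X in measurable X]setTI.
  exact: (@mpathZi i measurableT (~` [set` K]) I).
have PA n : P x (A n.+1) = (walk_op c (killed_partial c (fun y => (y \notin K)%:R) n) x)%:E.
  have -> : walk_op c (killed_partial c (fun y => (y \notin K)%:R) n) x =
      path_functional c phi n.+1 x by rewrite /= mul1r.
  rewrite -walk_functional; last by move=> [|i] y //=; case: (y \notin K).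
  rewrite -[in LHS](setIT (A _)) -integral_indic//.
  apply: eq_integral => w _; congr EFin.
  rewrite big_ord_recl /= mul1r indicE.
  have [/set_mem wA|wA] := boolP (w \in A n.+1).
    rewrite big1// => i _; rewrite /bump leq0n add1n.
    have -> // : pathZ w i.+1 \notin K.
    by apply/negP; apply: wA; rewrite /= ltn_ord.
  apply/esym/eqP; rewrite prodf_seq_eq0; apply: contraNT wA => /hasPn h.
  apply/mem_set => -[|i] //= i_n iK.
  have /= := h (Ordinal i_n) (mem_index_enum _).
  by rewrite /bump leq0n add1n iK eqxx.
have h1 : P x (A n.+1) @[n --> \oo] --> P x (no_return [set` K]).
  have -> : no_return [set` K] = \bigcap_n A n.+1.
    apply/seteqP; split => w /=.
      by move=> h n _ i /andP[i1 _]; exact: h.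
    by move=> h n n1; apply: (h n Logic.I n); rewrite /= n1 ltnW.
  apply: nonincreasing_cvg_mu.
  - by rewrite -ge0_fin_numE// fin_num_measure.
  - by [].
  - exact: bigcapT_measurable.
  - move=> n k nk; apply/subsetPset => w /= h i /andP[i1 i_n]; apply: h.
    by rewrite i1 (leq_trans i_n).
have h2 : P x (A n.+1) @[n --> \oo] --> (escape c K x)%:E.
  have -> : (fun n => P x (A n.+1)) =
      (fun n => (walk_op c (killed_partial c (fun y => (y \notin K)%:R) n) x)%:E).
    exact/funext.
  apply: cvg_EFin; first exact: nearW.
  by apply: cvg_walk_op => y; apply: cvg_killed.
by rewrite -(cvg_lim (@ereal_hausdorff R) h1); exact: cvg_lim h2.
Qed.

End green_function.

(** * Laplace functional of a Poisson point process *)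

Section exp_opp.
Context (R : realType).

(** [expR (- x)] with value 0 at [+oo], since occupation times are a priori possibly infinite. The
    value at [-oo] is a default: the arguments of interest are nonnegative. *)
Definition exp_opp (x : \bar R) : R := if x is r%:E then expR (- r) else 0.

Lemma exp_opp01 x : (0 <= x)%E -> 0 <= exp_opp x <= 1.
Proof.
case: x => [r| |] //=; rewrite ?lexx ?ler01// lee_fin => r0.
by rewrite expR_ge0 expR_le1 oppr_le0.
Qed.

Lemma exp_opp_ge0 x : 0 <= exp_opp x.
Proof. by case: x => [r| |] //=; exact: expR_ge0. Qed.

Lemma exp_oppD x y : (0 <= x)%E -> (0 <= y)%E ->
  exp_opp (x + y) = exp_opp x * exp_opp y.
Proof.
case: x => [r| |] //; case: y => [s| |] //= _ _; rewrite ?mul0r ?mulr0//.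
by rewrite opprD expRD.
Qed.

Lemma exp_opp0 : exp_opp 0%E = 1.
Proof. by rewrite -[RHS]expR0 -[X in expR X]oppr0. Qed.

Lemma exp_opp_sum (I : Type) (s : seq I) (F : I -> \bar R) :
  (forall i, (0 <= F i)%E) -> exp_opp (\sum_(i <- s) F i)%E = \prod_(i <- s) exp_opp (F i).
Proof.
move=> F0; elim: s => [|i s IH]; first by rewrite !big_nil /= oppr0 expR0.
by rewrite !big_cons exp_oppD ?IH// sume_ge0.
Qed.

Lemma measurable_exp_opp : measurable_fun setT exp_opp.
Proof.
rewrite (_ : exp_opp = fun x => expR (- fine x) * \1_[set x : \bar R | x \is a fin_num] x).
  apply: measurable_funM.
    by apply: measurableT_comp => //; apply: measurableT_comp => //; exact: fine_measurable.
  apply: measurable_indic; rewrite -[X in measurable X]setTI.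
  exact: emeasurable_fin_num.
apply/funext => -[r| |] /=; rewrite indicE.
- by rewrite mem_set ?mulr1.
- by rewrite memNset ?mulr0.
- by rewrite memNset ?mulr0.
Qed.

Lemma measurable_funexp_opp d (T : measurableType d) (g : T -> \bar R) :
  measurable_fun setT g -> measurable_fun setT (fun x => exp_opp (g x)).
Proof. by move=> mg; exact: (measurableT_comp measurable_exp_opp mg). Qed.

Lemma cvg_exp_opp (u : nat -> \bar R) (l : \bar R) : (forall n, (0 <= u n)%E) ->
  u n @[n --> \oo] --> l -> exp_opp (u n) @[n --> \oo] --> exp_opp l.
Proof.
move=> u0 ul; have l0 : (0 <= l)%E.
  by rewrite -(cvg_lim _ ul)//; apply: lime_ge; [apply/cvg_ex; exists l|exact: nearW].
case: l ul l0 => [r| |] // ul _.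
- have /fine_cvgP[ufin uf] := ul.
  have h : expR (- fine (u n)) @[n --> \oo] --> expR (- r).
    apply: (cvg_comp _ _ (cvgN uf)); exact: continuous_expR.
  apply: cvg_trans h; apply: near_eq_cvg.
  by apply: filterS ufin => n; case: (u n).
- rewrite /=; apply/cvgrPdist_lt => e e0.
  have [A hA] : exists A, expR (- A) < e.
    by exists (- ln (e / 2)); rewrite opprK lnK ?posrE ?divr_gt0// ltr_pdivrMr// ltr_pMr// ltr1n.
  move/cvgeyPge : ul => /(_ A); apply: filterS => n Au.
  rewrite sub0r normrN ger0_norm ?exp_opp_ge0//; apply: le_lt_trans hA.
  by case: (u n) Au => [s| |] //=; rewrite ?lee_fin ?expR_ge0// ler_expR lerN2.
Qed.

End exp_opp.

Section poisson_laplace.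
Context d (Omega : measurableType d) (R : realType) (Pr : probability Omega R).

Lemma nneseries_exp (x : R) : 0 <= x ->
  (\sum_(k <oo) (x ^+ k / k`!%:R)%:E = (expR x)%:E)%E.
Proof.
move=> x0; rewrite expRE -EFin_lim; last first.
  rewrite /pseries/=; under eq_fun do rewrite mulrC.
  exact: is_cvg_series_exp_coeff.
apply/congr_lim/funext => n; rewrite /pseries/= /series/= -sumEFin.
by apply: eq_bigr => i _; rewrite mulrC.
Qed.

Lemma poisson_prob1 (l : R) k : 0 <= l ->
  poisson_prob l 0 [set k] = (l ^+ k / k`!%:R * expR (- l))%:E.
Proof.
rewrite /poisson_prob; case: ltP => [l0 _|l0 l0'].
  by rewrite esum_set1 /poisson_pmf l0// lee_fin !mulr_ge0 ?expR_ge0 ?exprn_ge0 ?invr_ge0// ltW.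
(* At rate 0 [poisson_prob] is the Dirac mass at 0, in agreement with [0 ^ 0 = 1]. *)
have -> : l = 0 by apply/eqP; rewrite eq_le l0 l0'.
rewrite oppr0 expR0 mulr1 diracE; case: k => [|k].
  by rewrite mem_set// expr0 fact0 divr1.
by rewrite memNset// expr0n mul0r.
Qed.

(** [N] is not assumed to be integer-valued, but the masses at the integers sum to 1, so all other
    values can be discarded. What remains is the exponential series in [l * expR (- r)]. *)
Lemma poisson_count_laplace (N : Omega -> \bar R) (l r : R) :
    measurable_fun setT N -> 0 <= l -> 0 <= r ->
    (forall k : nat, Pr [set om | N om = k%:R%:E] = poisson_prob l 0 [set k]) ->
  (\int[Pr]_om (exp_opp (r%:E * N om))%:E = (expR (- (l * (1 - expR (- r)))))%:E)%E.
Proof.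
move=> mN l0 r0 hN; pose B k := [set om | N om = k%:R%:E].
have mB k : measurable (B k).
  exact: (measurable_preimage mN (emeasurable_set1 _)).
have tB : trivIset setT B.
  move=> i j _ _ [om [h1 h2]]; apply/eqP; rewrite -(@eqr_nat R); apply/eqP.
  by apply: EFin_inj; rewrite -h1 -h2.
have mf : measurable_fun setT (fun om => (exp_opp (r%:E * N om))%:E).
  apply/measurable_EFinP; apply: measurable_funexp_opp.
  exact: measurable_funeM.
have f0 om : (0 <= (exp_opp (r%:E * N om))%:E)%E by rewrite lee_fin exp_opp_ge0.
have mU : measurable (\bigcup_k B k) by exact: bigcupT_measurable.
have PU : Pr (\bigcup_k B k) = 1%E.
  rewrite measure_bigcup//; transitivity (\sum_(k <oo) Pr (B k))%E.
    by apply: eq_eseriesl => k; rewrite in_setT.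
  transitivity (\sum_(k <oo) ((expR (- l))%:E * (l ^+ k / k`!%:R)%:E))%E.
    by apply: eq_eseriesr => k _; rewrite hN poisson_prob1// mulrC EFinM.
  rewrite nneseriesZl; last by move=> k _; rewrite lee_fin divr_ge0 ?exprn_ge0.
  by rewrite nneseries_exp// -EFinM mulrC expRxMexpNx_1.
have PUC : Pr (~` \bigcup_k B k) = 0%E by rewrite probability_setC// PU subee.
rewrite (ge0_negligible_integral (measurableC mU))//.
rewrite setDE setCK setTI ge0_integral_bigcup//; last exact: measurable_funTS.
transitivity (\sum_(k <oo) ((expR (- l))%:E * ((l * expR (- r)) ^+ k / k`!%:R)%:E))%E.
  apply: eq_eseriesr => k _.
  transitivity (\int[Pr]_(om in B k) (cst (expR (- (r * k%:R)))%:E om))%E.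
    by apply: eq_integral => om /set_mem /= ->.
  rewrite integral_cst//.
  transitivity ((expR (- (r * k%:R)))%:E * Pr (B k))%E => //.
  rewrite hN poisson_prob1// -!EFinM; congr EFin.
  by rewrite exprMn -expRM_natr mulNr; ring.
rewrite nneseriesZl; last first.
  by move=> k _; rewrite lee_fin divr_ge0 ?exprn_ge0// mulr_ge0 ?expR_ge0.
rewrite nneseries_exp ?mulr_ge0 ?expR_ge0// -EFinM -expRD; congr (expR _)%:E.
by ring.
Qed.

End poisson_laplace.

Section poisson_process_laplace.
Context d d' (Omega : measurableType d) (T : measurableType d') (R : realType)
  (Pr : probability Omega R) (p : Omega -> nat -> T)
  (mu : {measure set T -> \bar R}).
Hypothesis ppp : poisson_point_process Pr p mu.

Import HBNNSimple.

Let N A om : \bar R := point_count R (p om) A.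

Let N_ge0 A om : (0 <= N A om)%E.
Proof. by apply: nneseries_ge0 => i _ _; rewrite diracE lee_fin. Qed.

Let mN A : measurable A -> measurable_fun setT (N A).
Proof. by case: ppp => h _ _ _; exact: h. Qed.

Section simple.
Variables (f : {nnsfun T >-> R}) (D : set T).
Hypotheses (mD : measurable D) (muD : (mu D < +oo)%E).
Hypothesis fD : forall x, ~ D x -> f x = 0.

(** The value 0 is left out: its level set may have infinite measure, and it contributes nothing to
    either side. *)
Let vals : seq R := [seq r <- fset_set (range f) | r != 0].

Let uniq_vals : uniq vals.
Proof. by rewrite filter_uniq// fset_uniq. Qed.

Let val_gt0 r : r \in vals -> 0 < r.
Proof.
rewrite mem_filter lt_neqAle eq_sym => /andP[-> /=].
by rewrite in_fset_set// => /set_mem[x _ <-].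
Qed.

Let level r : set T := f @^-1` [set r].

Let mlevel r : measurable (level r).
Proof. by rewrite /level; apply: measurable_funPTI; exact: measurable_set1. Qed.

Let mu_level r : r \in vals -> (mu (level r) < +oo)%E.
Proof.
move=> rv; apply: le_lt_trans muD.
apply: le_measure; [exact/mem_set/mlevel|exact/mem_set|].
move=> x /= fx; apply: contrapT => /fD; rewrite fx => r0.
by have := val_gt0 rv; rewrite r0 ltxx.
Qed.

Let simpleE x : f x = \sum_(r <- vals) r * \1_(level r) x.
Proof.
rewrite {1}fimfunE fsbig_finite//= /vals big_filter [LHS](bigID (fun r => r != 0))/=.
rewrite [X in _ + X]big1 ?addr0// => r /negPn/eqP ->.
by rewrite mul0r.
Qed.

Let sum_simple om : (\sum_(i <oo) (f (p om i))%:E = \sum_(r <- vals) r%:E * N (level r) om)%E.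
Proof.
transitivity (\sum_(i <oo) \sum_(r <- vals) (r%:E * \d_(p om i) (level r)))%E.
  apply: eq_eseriesr => i _; rewrite simpleE -sumEFin; apply: eq_bigr => r _.
  by rewrite EFinM diracE indicE.
rewrite big_seq; under eq_eseriesr do rewrite big_seq.
rewrite nneseries_sum; last first.
  by move=> r i /val_gt0 r0; rewrite mule_ge0// ?lee_fin ?ltW// diracE lee_fin.
by apply: eq_bigr => r rv; rewrite nneseriesZl.
Qed.

Let integral_simple : (\int[mu]_x (1 - expR (- f x))%:E =
  \sum_(r <- vals) (1 - expR (- r))%:E * mu (level r))%E.
Proof.
have ge0 r : r \in vals -> 0 <= 1 - expR (- r).
  by move=> /val_gt0 r0; rewrite subr_ge0 expR_le1 oppr_le0 ltW.
transitivity (\int[mu]_x \sum_(r <- vals) ((1 - expR (- r)) * \1_(level r) x)%:E)%E.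
  apply: eq_integral => x _; rewrite sumEFin; congr EFin.
  have [fv|fv] := boolP (f x \in vals).
    rewrite (bigD1_seq (f x))//= indicE mem_set// mulr1 big1 ?addr0// => r rx.
    rewrite indicE memNset ?mulr0//= => fxr; by rewrite fxr eqxx in rx.
  have f0 : f x = 0.
    apply/eqP; apply: contraNT fv => fx; rewrite mem_filter fx/= in_fset_set//.
    by apply/mem_set; exists x.
  rewrite f0 oppr0 expR0 subrr big_seq big1// => r rv.
  rewrite indicE memNset ?mulr0// => fxr.
  by have := val_gt0 rv; rewrite -fxr f0 ltxx.
have vi (i : 'I_(size vals)) : vals`_i \in vals by rewrite mem_nth.
rewrite (big_nth 0) big_mkord; under eq_integral do rewrite (big_nth 0) big_mkord.
rewrite ge0_integral_sum//.
- apply: eq_bigr => i _; under eq_integral do rewrite EFinM.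
  rewrite ge0_integralZl_EFin ?ge0//; last first.
    by apply/measurable_EFinP; exact: measurable_indic.
  by rewrite integral_indic// setIT.
- move=> i; apply/measurable_EFinP/measurable_funM => //; exact: measurable_indic.
- by move=> i x _; rewrite lee_fin mulr_ge0 ?ge0.
Qed.

(** The level sets are disjoint, so their counts are independent Poisson variables and the transform
    is a product of one-dimensional ones. *)
Lemma simple_laplace :
  (\int[Pr]_om (exp_opp (\sum_(i <oo) (f (p om i))%:E))%:E =
   (expR (- fine (\int[mu]_x (1 - expR (- f x))%:E)))%:E)%E.
Proof.
have [_ pois _ indep] := ppp.
pose A (i : 'I_(size vals)) := level vals`_i.
(* The product formula asks for functions with values in [[0, 1]] on the whole extended line;
   truncating at 0 changes nothing here, as the counts and the values are nonnegative. *)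
pose g (i : 'I_(size vals)) (x : \bar R) := exp_opp ((Num.max 0 vals`_i)%:E * maxe 0%E x).
have vi (i : 'I_(size vals)) : vals`_i \in vals by rewrite mem_nth.
have mA i : measurable (A i) by exact: mlevel.
have tA : trivIset setT A.
  move=> i j _ _ [x [hi hj]]; apply/val_inj/eqP.
  rewrite -(nth_uniq 0 (ltn_ord i) (ltn_ord j) uniq_vals); apply/eqP.
  by rewrite -[LHS]hi; exact: hj.
have g01 i x : 0 <= g i x <= 1.
  by apply: exp_opp01; apply: mule_ge0; rewrite ?lee_fin le_max lexx.
have mg i : measurable_fun setT (g i).
  apply: measurable_funexp_opp; apply: measurable_funeM.
  exact: measurable_maxe.
have := @independent_integral_prod _ _ _ _ _ Pr _ (fun i => N (A i)) g
  (fun i => mN (mA i)) mg g01 (index_enum 'I_(size vals)) (indep _ A mA tA)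
  (index_enum_uniq _).
have -> : (\int[Pr]_om (\prod_(j <- index_enum 'I_(size vals)) g j (N (A j) om))%:E =
   \int[Pr]_om (exp_opp (\sum_(i <oo) (f (p om i))%:E))%:E)%E.
  apply: eq_integral => om _; congr EFin; rewrite sum_simple (big_nth 0) big_mkord.
  rewrite exp_opp_sum => [|i]; last by rewrite mule_ge0// lee_fin ltW// val_gt0.
  apply: eq_bigr => i _; rewrite /g; congr exp_opp.
  by rewrite !max_r ?lee_fin// ltW// val_gt0.
move=> ->.
rewrite integral_simple (big_nth 0) big_mkord.
have -> : (\sum_(i < size vals) (1 - expR (- vals`_i))%:E * mu (level vals`_i) =
    (\sum_(i < size vals) (1 - expR (- vals`_i)) * fine (mu (level vals`_i)))%:E)%E.
  rewrite -sumEFin; apply: eq_bigr => i _.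
  by rewrite EFinM fineK// ge0_fin_numE// mu_level.
rewrite /= -sumrN expR_sum -prodEFin; apply: eq_bigr => i _.
have v0 := val_gt0 (vi i).
under eq_integral => om _ do rewrite /g !max_r ?lee_fin ?(ltW v0)//.
have l0 : 0 <= fine (mu (A i)) by rewrite fine_ge0.
rewrite (poisson_count_laplace (mN (mA i)) l0 (ltW v0) (pois _ (mA i) (mu_level (vi i)))).
by rewrite mulrC.
Qed.

End simple.

(** Extension from simple functions by increasing limits; the finite measure of [D] makes
    [1 - exp_opp (f x)] integrable. The points need not depend measurably on [om], so even the
    measurability of the sum comes from its being a limit of combinations of counts. *)
Lemma poisson_process_laplace (f : T -> \bar R) (D : set T) :
    measurable D -> (mu D < +oo)%E -> measurable_fun setT f ->
    (forall x, (0 <= f x)%E) -> (forall x, ~ D x -> f x = 0%E) ->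
  measurable_fun setT (fun om => \sum_(i <oo) f (p om i))%E /\
  (\int[Pr]_om (exp_opp (\sum_(i <oo) f (p om i)))%:E =
   (expR (- fine (\int[mu]_x (1 - exp_opp (f x))%:E)))%:E)%E.
Proof.
move=> mD muD mf f0 fD; pose f_ := nnsfun_approx measurableT mf.
have cvf x : (f_ n x)%:E @[n --> \oo] --> f x by exact: cvg_nnsfun_approx.
have ndf x : {homo (fun n => f_ n x) : a b / (a <= b)%N >-> a <= b}.
  by move=> a b ab; exact/lefP/nd_nnsfun_approx.
have fD_ n x : ~ D x -> f_ n x = 0.
  move=> Dx; apply/eqP; rewrite eq_le fun_ge0 andbT -lee_fin.
  have := @le_approx _ _ _ setT f n x (fun x _ => f0 x) Logic.I.
  by rewrite fD// /f_ nnsfun_approxE.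
have cvS om : (\sum_(i <oo) (f_ n (p om i))%:E)%E @[n --> \oo] -->
    (\sum_(i <oo) f (p om i))%E.
  (* A series is an integral against the counting measure, so that monotone convergence exchanges it
     with the limit in [n]. *)
  have E (h : T -> \bar R) : (forall x, 0 <= h x)%E ->
      (\sum_(i <oo) h (p om i) = \int[counting]_i h (p om i))%E.
    by move=> h0; rewrite ge0_integral_count.
  rewrite (E f f0).
  have -> : (fun n => \sum_(i <oo) (f_ n (p om i))%:E)%E =
      (fun n => \int[counting]_i (f_ n (p om i))%:E)%E.
    by apply/funext => n; apply: (E (fun x => (f_ n x)%:E)) => x; rewrite lee_fin.
  have := @cvg_monotone_convergence _ _ R counting setT measurableT
    (fun n i => (f_ n (p om i))%:E).
  have -> : (fun i => limn (fun n => (f_ n (p om i))%:E)) = (fun i => f (p om i)).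
    by apply/funext => i; exact: cvg_lim (cvf _).
  apply => //.
  - by move=> n i _; rewrite lee_fin.
  - by move=> i _ a b ab; rewrite lee_fin; exact: ndf.
have mS n : measurable_fun setT (fun om => \sum_(i <oo) (f_ n (p om i))%:E)%E.
  have vals_ge0 r : r \in fset_set (range (f_ n)) -> 0 <= r.
    by rewrite in_fset_set// => /set_mem[x _ <-].
  have -> : (fun om => \sum_(i <oo) (f_ n (p om i))%:E)%E =
      (fun om => \sum_(r <- [seq r <- fset_set (range (f_ n)) | (0 <= r)%R])
         r%:E * N (f_ n @^-1` [set r]) om)%E.
    apply/funext => om; rewrite big_filter.
    transitivity (\sum_(i <oo) \sum_(r <- fset_set (range (f_ n)) | (0 <= r)%R)
        (r%:E * \d_(p om i) (f_ n @^-1` [set r])))%E.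
      apply: eq_eseriesr => i _; rewrite [in LHS]fimfunE fsbig_finite//= -sumEFin.
      rewrite big_seq [RHS]big_mkcond [RHS]big_seq; apply: eq_bigr => r rv.
      by rewrite vals_ge0// EFinM diracE indicE.
    rewrite nneseries_sum; last by move=> r i r0; rewrite mule_ge0// diracE lee_fin.
    by apply: eq_bigr => r r0; rewrite nneseriesZl.
  by apply: emeasurable_sum => r; apply: measurable_funeM; exact: mN.
have mSf : measurable_fun setT (fun om => \sum_(i <oo) f (p om i))%E.
  by apply: (emeasurable_fun_cvg _ _ mS) => om _; exact: cvS.
split=> //.
have S0 n om : (0 <= \sum_(i <oo) (f_ n (p om i))%:E)%E.
  by apply: nneseries_ge0 => i _ _; rewrite lee_fin.
have Sf0 om : (0 <= \sum_(i <oo) f (p om i))%E by exact: nneseries_ge0.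
have lhs : \int[Pr]_om exp_opp (\sum_(i <oo) (f_ n (p om i))%:E)%E @[n --> \oo] -->
    \int[Pr]_om exp_opp (\sum_(i <oo) f (p om i))%E.
  have [] // := @cvg_Rintegral_dominated _ _ _ Pr
     (fun n om => exp_opp (\sum_(i <oo) (f_ n (p om i))%:E)%E)
     (fun om => exp_opp (\sum_(i <oo) f (p om i))%E) (cst 1).
  - by move=> n; exact: measurable_funexp_opp.
  - exact: measurable_funexp_opp.
  - exact: finite_measure_integrable_cst.
  - by move=> om; apply: cvg_exp_opp.
  - by move=> n om; case/andP: (exp_opp01 (S0 n om)) => e0 e1; rewrite ger0_norm.
have intD (h : T -> \bar R) : (forall x, 0 <= h x)%E -> measurable_fun setT h ->
    (forall x, ~ D x -> h x = 0%E) ->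
    (\int[mu]_x (1 - exp_opp (h x))%:E \is a fin_num)%E.
  move=> h0 mh hD; have e01 x := exp_opp01 (h0 x).
  have me : measurable_fun setT (fun x => (1 - exp_opp (h x))%:E).
    apply/measurable_EFinP/measurable_funB => //.
    exact: measurable_funexp_opp.
  rewrite ge0_fin_numE; last first.
    by apply: integral_ge0 => x _; rewrite lee_fin subr_ge0; case/andP: (e01 x).
  apply: le_lt_trans muD; rewrite -[leRHS]mul1e -integral_cst// integral_mkcond.
  rewrite [leRHS]integral_mkcond; apply: ge0_le_integral => //.
  - by move=> x _; rewrite patchE in_setT lee_fin subr_ge0; case/andP: (e01 x).
  - by rewrite patch_setT.
  - by apply/(measurable_restrictT _ _).1 => //; exact: measurable_cst.
  - move=> x _; rewrite !patchE in_setT; case: ifPn => [_|/negP xD].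
      by rewrite lee_fin gerBl; case/andP: (e01 x).
    by rewrite hD ?exp_opp0 ?subrr// => /mem_set.
have rhs : fine (\int[mu]_x (1 - expR (- f_ n x))%:E)%E @[n --> \oo] -->
    fine (\int[mu]_x (1 - exp_opp (f x))%:E)%E.
  apply: fine_cvg; rewrite fineK; last exact: intD.
  have := @cvg_monotone_convergence _ _ R mu setT measurableT
    (fun n x => (1 - expR (- f_ n x))%:E).
  have -> : (fun x => limn (fun n => (1 - expR (- f_ n x))%:E)) =
      (fun x => (1 - exp_opp (f x))%:E).
    apply/funext => x; apply: cvg_lim => //; apply: cvg_EFin; first exact: nearW.
    apply: cvgB; first exact: cvg_cst.
    by apply: (@cvg_exp_opp _ (fun n => (f_ n x)%:E)) => // n; rewrite lee_fin.
  apply => //.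
  - move=> n; apply/measurable_EFinP/measurable_funB => //.
    by apply: measurableT_comp => //; exact: measurableT_comp.
  - by move=> n x _; rewrite lee_fin subr_ge0 expR_le1 oppr_le0.
  - by move=> x _ a b ab; rewrite lee_fin lerB// ler_expR lerN2; exact: ndf.
have e n : (\int[Pr]_om (exp_opp (\sum_(i <oo) (f_ n (p om i))%:E))%:E =
   (expR (- fine (\int[mu]_x (1 - expR (- f_ n x))%:E)))%:E)%E.
  exact: (simple_laplace mD muD (@fD_ n)).
have lim1 : expR (- fine (\int[mu]_x (1 - expR (- f_ n x))%:E)%E) @[n --> \oo] -->
    expR (- fine (\int[mu]_x (1 - exp_opp (f x))%:E)%E).
  apply: (cvg_comp _ _ (cvgN rhs)); exact: continuous_expR.
rewrite -(eq_cvg_lim _ lhs lim1); last by move=> n; rewrite /Rintegral e.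
rewrite /Rintegral fineK//; apply: integrable_fin_num => //.
apply: (@bounded_integrable _ _ _ _ _ 1).
  exact: measurable_funexp_opp.
by move=> om; case/andP: (exp_opp01 (Sf0 om)) => e0 e1; rewrite ger0_norm.
Qed.

End poisson_process_laplace.

(** * Moments and the Cameron-Martin formula *)

Section taylor_bounds.
Context (R : realType).
Implicit Types x y t : R.

Lemma exp_partial_le y n : 0 <= y -> \sum_(0 <= i < n) y ^+ i / i`!%:R <= expR y.
Proof.
move=> y0; rewrite -[leLHS]/(series (exp_coeff y) n).
apply: nondecreasing_cvgn_le; last exact: is_cvg_series_exp_coeff.
apply/nondecreasing_seqP => k; rewrite /series /= big_nat_recr//= lerDl.
exact: exp_coeff_ge0.
Qed.

Lemma exp_term_le y n : 0 <= y -> y ^+ n <= n`!%:R * expR y.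
Proof.
move=> y0; rewrite mulrC -ler_pdivrMr ?ltr0n ?fact_gt0//.
apply: le_trans (exp_partial_le n.+1 y0); rewrite big_nat_recr//= lerDr.
by apply: sumr_ge0 => i _; rewrite divr_ge0 ?exprn_ge0.
Qed.

(** Since [(k + i)! >= i!], the tail is at most [|x| ^ k] times the exponential series of [|x|];
    this serves both [expR] and [cos]. *)
Lemma series_tail_bound (a : nat -> R) x (L : R) :
    (forall j, `|a j| <= `|x| ^+ j / j`!%:R) -> series a n @[n --> \oo] --> L ->
  forall k, `|L - series a k| <= `|x| ^+ k * expR `|x|.
Proof.
move=> ax cvL k.
have cvd : `|series a n - series a k| @[n --> \oo] --> `|L - series a k|.
  by apply: cvg_norm; apply: cvgB => //; exact: cvg_cst.
apply: (ler_cvg_to cvd (cvg_cst (`|x| ^+ k * expR `|x|))).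
near=> n; have kn : (k <= n)%N by near: n; exists k.
rewrite sub_series_geq//; apply: le_trans (ler_norm_sum _ _ _) _.
apply: (@le_trans _ _ (\sum_(0 <= i < n - k) `|x| ^+ k * (`|x| ^+ i / i`!%:R))); last first.
  by rewrite -mulr_sumr ler_wpM2l ?exprn_ge0// exp_partial_le.
rewrite -[in leLHS](add0n k) big_addn; apply: ler_sum => i _.
apply: le_trans (ax _) _; rewrite addnC exprD -mulrA ler_wpM2l ?exprn_ge0//.
rewrite ler_wpM2l ?exprn_ge0// lef_pV2 ?posrE ?ltr0n ?fact_gt0// ler_nat.
by rewrite leq_fact// leq_addl.
Unshelve. all: by end_near. Qed.

Lemma exp_taylor_bound x k :
  `|expR x - \sum_(0 <= j < k) x ^+ j / j`!%:R| <= `|x| ^+ k * expR `|x|.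
Proof.
apply: (series_tail_bound (a := exp_coeff x)); last exact: is_cvg_series_exp_coeff.
by move=> j; rewrite /exp_coeff /= normrM normrX normfV normr_nat.
Qed.

Lemma cos_coeff_norm x j : `|cos_coeff x j| <= `|x| ^+ j / j`!%:R.
Proof.
rewrite /cos_coeff /= !normrM normrX normfV normr_nat normrX normrN1 expr1n mulr1.
rewrite normr_nat; case: (odd j) => /=.
  by rewrite !mul0r divr_ge0 ?exprn_ge0.
by rewrite mul1r.
Qed.

Lemma cvg_cos_coeff x : series (cos_coeff x) n @[n --> \oo] --> cos x.
Proof. by rewrite unlock; exact: is_cvg_series_cos_coeff. Qed.

Lemma cos_series_bound x n : `|series (cos_coeff x) n| <= expR `|x|.
Proof.
rewrite /series /=; apply: le_trans (ler_norm_sum _ _ _) _.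
apply: le_trans (exp_partial_le n (normr_ge0 x)).
by apply: ler_sum => j _; exact: cos_coeff_norm.
Qed.

Lemma cos_taylor_bound x : `|1 - cos x - x ^+ 2 / 2| <= `|x| ^+ 3 * expR `|x|.
Proof.
have := series_tail_bound (cos_coeff_norm x) (cvg_cos_coeff (x := x)) 3.
rewrite /series /= !big_nat_recr//= big_nil /cos_coeff /=.
apply: le_trans; rewrite -normrN le_eqVlt; apply/orP; left; apply/eqP; congr `| _ |.
rewrite (_ : (2`!)%N = 2%N)// (_ : (0`!)%N = 1%N)// expr1 expr0.
by field.
Qed.

(** If the coefficients agree below [k], subtracting the two expansions of order [k + 1] leaves
    [|a k - b k| <= t (C + C')] for every [t] in []0, 1]], hence equality. *)
Lemma taylor_unique (M : R -> R) (a b : nat -> R) (K : nat) :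
    (forall k, (k <= K.+1)%N -> exists C, forall t, 0 < t <= 1 ->
       `|M t - \sum_(0 <= j < k) t ^+ j * a j| <= t ^+ k * C) ->
    (forall k, (k <= K.+1)%N -> exists C, forall t, 0 < t <= 1 ->
       `|M t - \sum_(0 <= j < k) t ^+ j * b j| <= t ^+ k * C) ->
  forall j, (j <= K)%N -> a j = b j.
Proof.
move=> ha hb; elim/ltn_ind => k IH kK.
have [C hC] := ha k.+1 kK; have [C' hC'] := hb k.+1 kK.
have D t : 0 < t <= 1 -> `|a k - b k| <= t * (C + C').
  move=> t01; have t0 : 0 < t by case/andP: t01.
  have tk : 0 < t ^+ k by rewrite exprn_gt0.
  rewrite -(ler_pM2l tk) -[X in X * `| _ |]gtr0_norm// -normrM.
  have -> : t ^+ k * (t * (C + C')) = t ^+ k.+1 * C + t ^+ k.+1 * C'.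
    by rewrite exprSr; ring.
  apply: le_trans (lerD (hC t t01) (hC' t t01)).
  rewrite !big_nat_recr//= (eq_big_nat _ _ (F2 := fun j => t ^+ j * b j)); last first.
    by move=> j jk; rewrite (IH j)// ltnW// (leq_trans _ kK).
  set S := \sum_(0 <= j < k) _.
  have -> : t ^+ k * (a k - b k) =
      (M t - (S + t ^+ k * b k)) - (M t - (S + t ^+ k * a k)) by ring.
  by rewrite [leRHS]addrC; exact: ler_normB.
apply/eqP; rewrite -subr_eq0 -normr_le0; apply/ler_addgt0Pl => e e0; rewrite addr0.
have CC0 : 0 <= C + C'.
  have := D 1; rewrite ltr01 lexx mul1r => /(_ isT); exact: le_trans.
(* The [+ 1] keeps the denominator positive when [C + C'] vanishes. *)
pose t := Num.min 1 (e / (C + C' + 1)).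
have t0 : 0 < t by rewrite lt_min ltr01 divr_gt0// ltr_wpDl.
have t1 : t <= 1 by rewrite ge_min lexx.
apply: (le_trans (D t _)); first by rewrite t0.
apply: (@le_trans _ _ (e / (C + C' + 1) * (C + C'))).
  by rewrite ler_wpM2r// ge_min lexx orbT.
rewrite mulrAC ler_pdivrMr ?ltr_wpDl//.
by apply: ler_wpM2l; [exact: ltW|rewrite lerDl].
Qed.

End taylor_bounds.

(** * Moments of weighted laws with finite exponential moments *)

Section moment_generating_function.
Context d (T : measurableType d) (R : realType).
Variables (m : {measure set T -> \bar R}) (H X : T -> R).
Hypotheses (H0 : forall w, 0 <= H w) (mH : measurable_fun setT H)
  (mX : measurable_fun setT X).
Hypothesis iE : forall t : R,
  m.-integrable setT (EFin \o (fun w => expR (t * X w) * H w)).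

Let i_absexp (t : R) : 0 <= t ->
  m.-integrable setT (EFin \o (fun w => expR (t * `|X w|) * H w)).
Proof.
move=> t0; apply: (le_integrable _ _ _ (integrableD measurableT (iE t) (iE (- t)))) => //.
  apply/measurable_EFinP/measurable_funM => //; apply: measurableT_comp => //.
  by apply: measurable_funM => //; exact: measurableT_comp.
move=> w _ /=; rewrite lee_fin [leLHS]ger0_norm ?mulr_ge0 ?expR_ge0//.
rewrite [leRHS]ger0_norm ?addr_ge0 ?mulr_ge0 ?expR_ge0//.
rewrite -mulrDl ler_wpM2r//; have [x0|x0] := ler0P (X w).
  by rewrite mulrN -mulNr lerDr expR_ge0.
by rewrite lerDl expR_ge0.
Qed.

Let i_absmoment k : m.-integrable setT
  (EFin \o (fun w => `|X w| ^+ k * expR `|X w| * H w)).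
Proof.
have := integrableZl measurableT (k`!%:R) (i_absexp (ler0n R 2)).
apply: le_integrable => //.
  apply/measurable_EFinP/measurable_funM => //; apply: measurable_funM.
    by apply: measurable_funX; exact: measurableT_comp.
  by apply: measurableT_comp => //; exact: measurableT_comp.
move=> w _ /=; rewrite lee_fin [leLHS]ger0_norm ?mulr_ge0 ?expR_ge0 ?exprn_ge0//.
rewrite [leRHS]ger0_norm ?mulr_ge0 ?expR_ge0//.
rewrite mulrA ler_wpM2r// -[2]/(1 + 1) mulrDl mul1r expRD mulrA ler_wpM2r ?expR_ge0//.
exact: exp_term_le.
Qed.

Let i_moment k : m.-integrable setT (EFin \o (fun w => X w ^+ k * H w)).
Proof.
apply: (le_integrable _ _ _ (i_absmoment k)) => //.
  by apply/measurable_EFinP/measurable_funM => //; exact: measurable_funX.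
move=> w _ /=; rewrite lee_fin !normrM normrX !(ger0_norm (expR_ge0 _)) normrX normr_id.
by rewrite -mulrA ler_wpM2l ?exprn_ge0// ler_peMl// -[leLHS]expR0 ler_expR.
Qed.

Let integral_poly (a : nat -> R) n :
  m.-integrable setT (EFin \o (fun w => (\sum_(0 <= j < n) a j * X w ^+ j) * H w)) /\
  \int[m]_w ((\sum_(0 <= j < n) a j * X w ^+ j) * H w) =
  \sum_(0 <= j < n) a j * \int[m]_w (X w ^+ j * H w).
Proof.
elim: n => [|n [iI eI]].
  rewrite big_geq//; split.
    apply: (eq_integrable _ (cst 0%E)) => //; last exact: integrable0.
    by move=> w _; rewrite /= big_geq// mul0r.
  by under eq_Rintegral do rewrite big_geq// mul0r; rewrite Rintegral_cst// mul0r.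
have iZ : m.-integrable setT (EFin \o (fun w => a n * (X w ^+ n * H w))).
  exact: integrableZl (i_moment n).
have E w : (\sum_(0 <= j < n.+1) a j * X w ^+ j) * H w =
    (\sum_(0 <= j < n) a j * X w ^+ j) * H w + a n * (X w ^+ n * H w).
  by rewrite big_nat_recr//= mulrDl mulrA.
split.
  by apply: eq_integrable (integrableD measurableT iI iZ) => // w _; rewrite /= E.
under eq_Rintegral do rewrite E.
by rewrite RintegralD// eI big_nat_recr//= RintegralZl.
Qed.

(** For [t <= 1] the Taylor remainder of [expR (t X)] is at most [t ^ k |X| ^ k expR |X|], so [C] is
    the integral of [|X| ^ k expR |X|] against the weight. *)
Lemma mgf_taylor k : exists C, forall t, 0 < t <= 1 ->
  `|\int[m]_w (expR (t * X w) * H w) -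
    \sum_(0 <= j < k) t ^+ j * (\int[m]_w (X w ^+ j * H w) / j`!%:R)| <= t ^+ k * C.
Proof.
exists (\int[m]_w (`|X w| ^+ k * expR `|X w| * H w)) => t /andP[t0 t1].
have [iI eI] := integral_poly (fun j => t ^+ j / j`!%:R) k.
have -> : \sum_(0 <= j < k) t ^+ j * (\int[m]_w (X w ^+ j * H w) / j`!%:R) =
    \sum_(0 <= j < k) t ^+ j / j`!%:R * \int[m]_w (X w ^+ j * H w).
  by apply: eq_bigr => j _; rewrite mulrA mulrAC.
rewrite -eI.
rewrite -(RintegralB measurableT (iE t) iI).
have iB := integrableB measurableT (iE t) iI.
apply: le_trans (le_normr_Rintegral measurableT iB) _.
rewrite -(RintegralZl _ measurableT (i_absmoment k)).
apply: le_Rintegral => //.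
- exact: integrable_norm.
- exact: integrableZl (i_absmoment k).
- move=> w _; rewrite -mulrBl normrM (ger0_norm (H0 w)) !mulrA ler_wpM2r//.
  under eq_bigr do rewrite mulrAC -exprMn.
  apply: le_trans (exp_taylor_bound _ _) _.
  rewrite normrM (gtr0_norm t0) exprMn; apply: ler_wpM2l.
    by rewrite mulr_ge0// exprn_ge0// ltW.
  by rewrite ler_expR ler_piMl// ltW.
Qed.

Lemma cvg_integral_cos_series :
  \int[m]_w (series (cos_coeff (X w)) n * H w) @[n --> \oo] -->
  \int[m]_w (cos (X w) * H w).
Proof.
have mXj j : measurable_fun setT (fun w => cos_coeff (X w) j).
  rewrite (_ : (fun w => _) = fun w => ((~~ odd j)%:R * (-1) ^+ j./2) * (X w ^+ j) * (j`!%:R)^-1).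
    by apply: measurable_funM => //; apply: measurable_funM => //; exact: measurable_funX.
  by apply/funext => w.
have mcos : measurable_fun setT (@cos R).
  exact: (continuous_measurable_fun (@continuous_cos R)).
have [] // := @cvg_Rintegral_dominated _ _ _ m
  (fun n w => series (cos_coeff (X w)) n * H w) (fun w => cos (X w) * H w)
  (fun w => expR (1 * `|X w|) * H w).
- by move=> n; apply: measurable_funM => //; exact: measurable_sum.
- by apply: measurable_funM => //; exact: measurableT_comp.
- exact: i_absexp.
- by move=> w; apply: cvgMl; exact: cvg_cos_coeff.
- move=> n w; rewrite normrM (ger0_norm (H0 w)) mul1r ler_wpM2r//.
  exact: cos_series_bound.
Qed.

Lemma integral_cos_series n : \int[m]_w (series (cos_coeff (X w)) n * H w) =
  \sum_(0 <= j < n) (~~ odd j)%:R * (-1) ^+ j./2 * (\int[m]_w (X w ^+ j * H w) / j`!%:R).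
Proof.
have [_] := integral_poly (fun j => (~~ odd j)%:R * (-1) ^+ j./2 / j`!%:R) n.
under [in X in _ = X -> _]eq_bigr do rewrite mulrAC -mulrA.
move=> <-; apply: eq_Rintegral => w _; congr (_ * _).
by apply: eq_bigr => j _; rewrite /cos_coeff /= -exprnP; ring.
Qed.

End moment_generating_function.

Section mgf_unique.
Context d1 d2 (T1 : measurableType d1) (T2 : measurableType d2) (R : realType).
Variables (m1 : {measure set T1 -> \bar R}) (m2 : {measure set T2 -> \bar R}).
Variables (H1 X1 : T1 -> R) (H2 X2 : T2 -> R).
Hypotheses (H10 : forall w, 0 <= H1 w) (H20 : forall w, 0 <= H2 w).
Hypotheses (mH1 : measurable_fun setT H1) (mH2 : measurable_fun setT H2).
Hypotheses (mX1 : measurable_fun setT X1) (mX2 : measurable_fun setT X2).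
Hypotheses (iE1 : forall t : R,
  m1.-integrable setT (EFin \o (fun w => expR (t * X1 w) * H1 w)))
  (iE2 : forall t : R,
  m2.-integrable setT (EFin \o (fun w => expR (t * X2 w) * H2 w))).
Hypothesis mgf12 : forall t : R,
  \int[m1]_w (expR (t * X1 w) * H1 w) = \int[m2]_w (expR (t * X2 w) * H2 w).

(** The moment generating functions agree, so by [taylor_unique] all moments agree, and these
    determine the integral of the cosine series, whose partial sums are dominated by [expR |X|].
    Cosines take the part of characteristic functions in what follows. *)
Lemma eq_integral_cos : \int[m1]_w (cos (X1 w) * H1 w) = \int[m2]_w (cos (X2 w) * H2 w).
Proof.
apply: (eq_cvg_lim _ (cvg_integral_cos_series H10 mH1 mX1 iE1)
  (cvg_integral_cos_series H20 mH2 mX2 iE2)) => n.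
rewrite (integral_cos_series H10 mH1 mX1 iE1) (integral_cos_series H20 mH2 mX2 iE2).
apply: eq_bigr => j _; congr (_ * _).
apply: (@taylor_unique _ (fun t => \int[m1]_w (expR (t * X1 w) * H1 w))
  (fun j => \int[m1]_w (X1 w ^+ j * H1 w) / j`!%:R)
  (fun j => \int[m2]_w (X2 w ^+ j * H2 w) / j`!%:R) j) => // k _.
- exact: mgf_taylor.
- have [C hC] := mgf_taylor H20 mH2 mX2 iE2 k.
  by exists C => t t01; rewrite mgf12; exact: hC.
Qed.

End mgf_unique.

Section normal_law.
Context d (T : measurableType d) (R : realType) (m : probability T R).
Variables (X : T -> R) (sd : R).
Hypothesis mX : measurable_fun setT X.
Hypothesis lawX : forall B : set R, measurable B ->
  m [set w | B (X w)] = centered_normal sd B.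

(** Multiplying the density by [expR (t x)] recenters it at [t sd ^ 2]; for [sd = 0] the law is the
    Dirac mass at 0. *)
Lemma normal_law_mgf (t : R) :
  (\int[m]_w (expR (t * X w))%:E = (expR (t ^+ 2 * sd ^+ 2 / 2))%:E)%E.
Proof.
have mexp : measurable_fun setT (fun x : R => (expR (t * x))%:E).
  by apply/measurable_EFinP; apply: measurableT_comp => //; exact: measurable_funM.
have e0 x : (0 <= (expR (t * x))%:E)%E by rewrite lee_fin expR_ge0.
have cstE (B : set R) : measurable B ->
    (\int[m]_(w in X @^-1` B) (cst 1 w)%:E = m (X @^-1` B))%E.
  move=> mB; rewrite -[RHS]mul1e -integral_cst//.
  exact: measurable_preimage.
transitivity (\int[m]_w ((expR (t * X w))%:E * (cst 1 w)%:E))%E.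
  by apply: eq_integral => w _; rewrite mule1.
have [sd0|sd0] := eqVneq sd 0.
  rewrite (@eq_weighted_integral _ _ _ T R R R m (\d_(0 : R)) (cst 1) (cst 1) X id _ _ _ _ _ _ _
    (fun x => (expR (t * x))%:E))//.
    under eq_integral do rewrite mule1.
    rewrite integral_dirac// diracE in_setT mul1e sd0 mulr0.
    by rewrite expr0n /= mulr0 mul0r.
  move=> B mB; rewrite cstE// preimage_id -[X @^-1` B]/[set w | B (X w)] lawX//.
  rewrite /centered_normal sd0 eqxx -[LHS]mul1e.
  by rewrite -(integral_cst (\d_(0 : R) : {measure set R -> \bar R})).
rewrite (@eq_weighted_integral _ _ _ T _ R R m (@lebesgue_measure R) (cst 1)
    (normal_pdf 0 sd) X id _ _ _ _ _ _ _ (fun x => (expR (t * x))%:E))//.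
- transitivity (\int[lebesgue_measure]_x ((expR (t ^+ 2 * sd ^+ 2 / 2))%:E *
     (normal_pdf (t * sd ^+ 2) sd x)%:E))%E.
    apply: eq_integral => x _; rewrite -!EFinM; congr EFin.
    rewrite !normal_pdfE// mulrCA [RHS]mulrCA /normal_fun; congr (_ * _).
    rewrite -!expRD; congr expR; field.
    by rewrite sd0.
  rewrite ge0_integralZl_EFin//.
  + by rewrite integral_normal_pdf mule1.
  + by move=> x _; rewrite lee_fin normal_pdf_ge0.
  + by apply/measurable_EFinP; exact: measurable_normal_pdf.
- by move=> x; exact: normal_pdf_ge0.
- exact: measurable_normal_pdf.
- move=> B mB; rewrite cstE// preimage_id -[X @^-1` B]/[set w | B (X w)] lawX//.
  by rewrite /centered_normal (negbTE sd0).
Qed.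

Let iE (t : R) : m.-integrable setT (EFin \o (fun w => expR (t * X w) * (cst 1) w)).
Proof.
apply/integrableP; split.
  apply/measurable_EFinP/measurable_funM => //; apply: measurableT_comp => //.
  exact: measurable_funM.
under eq_integral do rewrite /= mulr1 ger0_norm ?expR_ge0//.
by rewrite normal_law_mgf ltry.
Qed.

(** The second moment is read off from the second-order coefficient of the moment generating
    function [expR (t ^ 2 sd ^ 2 / 2)]. *)
Lemma normal_law_variance : \int[m]_w (X w ^+ 2) = sd ^+ 2.
Proof.
pose M t := expR (t ^+ 2 * sd ^+ 2 / 2).
have ME t : \int[m]_w (expR (t * X w) * cst 1 w) = M t.
  under eq_Rintegral do rewrite mulr1.
  by rewrite /Rintegral normal_law_mgf.
pose b (j : nat) : R := if j == 0%N then 1 else if j == 2%N then sd ^+ 2 / 2 else 0.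
have bM k : (k <= 3)%N -> exists C, forall t, 0 < t <= 1 ->
    `|M t - \sum_(0 <= j < k) t ^+ j * b j| <= t ^+ k * C.
  pose v := sd ^+ 2 / 2; have v0 : 0 <= v by rewrite divr_ge0// sqr_ge0.
  have Mv t : M t = expR (t ^+ 2 * v) by rewrite /M /v mulrA.
  have main k' t : 0 < t <= 1 ->
      `|M t - \sum_(0 <= j < k') (t ^+ 2 * v) ^+ j / j`!%:R| <=
      (t ^+ 2) ^+ k' * (v ^+ k' * expR v).
    move=> /andP[t0 t1]; rewrite Mv; apply: le_trans (exp_taylor_bound _ _) _.
    have tv0 : 0 <= t ^+ 2 * v by rewrite mulr_ge0// sqr_ge0.
    rewrite ger0_norm// exprMn -mulrA; apply: ler_wpM2l.
      by rewrite exprn_ge0// sqr_ge0.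
    apply: ler_wpM2l; first by rewrite exprn_ge0.
    by rewrite ler_expR ler_piMl// exprn_ile1// ltW.
  (* The expansion is in powers of [t ^ 2 v], with an error of order [t ^ (2 k')]; the orders 0, 1,
     2, 3 in [t] are obtained from [k'] equal to 0, 1, 1, 2. *)
  case: k => [|[|[|[|//]]]] _.
  - exists (expR v) => t t01; rewrite big_geq// subr0 expr0.
    by have := main 0%N t t01; rewrite big_geq// subr0 !expr0 mul1r.
  - exists (v * expR v) => t t01; have /andP[t0 t1] := t01.
    have := main 1%N t t01; rewrite !big_nat1 !expr0 !expr1 /b /= divr1 mul1r => h.
    apply: le_trans h _; apply: ler_wpM2r; first by rewrite mulr_ge0 ?expR_ge0.
    by rewrite expr2 ler_piMl// ltW.
  - exists (v * expR v) => t t01.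
    have := main 1%N t t01; rewrite big_nat1 !expr0 divr1 !expr1.
    by rewrite !big_nat_recr//= big_geq// /b /= add0r mulr0 addr0 expr0 mul1r.
  - exists (v ^+ 2 * expR v) => t t01; have /andP[t0 t1] := t01.
    have := main 2%N t t01.
    rewrite !big_nat_recr//= !big_geq// /b /= !add0r mulr0 addr0 expr0 mul1r divr1.
    rewrite ?expr0 ?expr1 ?divr1 -/v fact0 invr1 mulr1 => h; apply: le_trans h _.
    apply: ler_wpM2r; first by rewrite mulr_ge0 ?exprn_ge0 ?expR_ge0.
    by rewrite -exprM; apply: ler_wiXn2l => //; exact: ltW.
have := @taylor_unique R M (fun j => \int[m]_w (X w ^+ j * cst 1 w) / j`!%:R) b 2 _ bM 2.
under eq_Rintegral do rewrite mulr1.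
rewrite /b /= (_ : (2`!)%N = 2%N)// => h.
have /mulIf : (2^-1 : R) != 0 by rewrite invr_eq0 pnatr_eq0.
apply; apply: h => // k _.
have mc : measurable_fun setT (cst 1 : T -> R) by exact: measurable_cst.
have [C hC] := mgf_taylor (m := m) (H := cst 1) (X := X) (fun _ => ler01) mc mX iE k.
by exists C => t t01; rewrite -ME; exact: hC.
Qed.

End normal_law.

Lemma exp_le_1B (R : realType) (u : R) : 0 <= u < 1 -> expR (- (u / (1 - u))) <= 1 - u.
Proof.
move=> /andP[u0 u1]; have v0 : 0 < 1 - u by rewrite subr_gt0.
rewrite expRN -[leRHS]invrK lef_pV2 ?posrE ?invr_gt0 ?expR_gt0//.
apply: le_trans (expR_ge1Dx _); rewrite le_eqVlt; apply/orP; left; apply/eqP.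
by field; rewrite gt_eqF.
Qed.

(** With [u = w_ n / N_ n], which tends to 0, the sandwich [expR (- (u / (1 - u))) <= 1 - u <= expR
    (- u)] is raised to the power [N_ n]. *)
Lemma cvg_one_sub_pow (R : realType) (w_ : nat -> R) (w : R) (N_ : nat -> nat) :
    (forall n, 0 <= w_ n) -> w_ n @[n --> \oo] --> w ->
    (N_ n)%:R^-1 @[n --> \oo] --> (0 : R) -> (forall n, (0 < N_ n)%N) ->
  (1 - w_ n / (N_ n)%:R) ^+ N_ n @[n --> \oo] --> expR (- w).
Proof.
move=> w0 cvw cvN N0.
have cvu : w_ n / (N_ n)%:R @[n --> \oo] --> (0 : R).
  by rewrite -[X in _ --> X](mulr0 w); exact: cvgM.
apply: (@squeeze_cvgr _ _ _ _ (fun n => expR (- (w_ n / (1 - w_ n / (N_ n)%:R))))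
  (fun n => expR (- w_ n))).
- near=> n.
  have Nn : 0 < (N_ n)%:R :> R by rewrite ltr0n.
  have u1 : w_ n / (N_ n)%:R < 1 by near: n; apply: (cvgr_lt _ cvu).
  have u0 : 0 <= w_ n / (N_ n)%:R by rewrite divr_ge0// ltW.
  have h1 : expR (- (w_ n / (N_ n)%:R / (1 - w_ n / (N_ n)%:R))) <= 1 - w_ n / (N_ n)%:R.
    by apply: exp_le_1B; rewrite u0.
  have h2 : 1 - w_ n / (N_ n)%:R <= expR (- (w_ n / (N_ n)%:R)) by exact: expR_ge1Dx.
  have wE : w_ n = (N_ n)%:R * (w_ n / (N_ n)%:R) by rewrite mulrCA divff ?mulr1// gt_eqF.
  have p1 : expR (- (w_ n / (1 - w_ n / (N_ n)%:R))) =
      expR (- (w_ n / (N_ n)%:R / (1 - w_ n / (N_ n)%:R))) ^+ N_ n.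
    by rewrite -expRM_natl mulrN mulrA -wE.
  have p2 : expR (- w_ n) = expR (- (w_ n / (N_ n)%:R)) ^+ N_ n.
    by rewrite -expRM_natl mulrN -wE.
  have v0 : 0 <= 1 - w_ n / (N_ n)%:R by rewrite subr_ge0 ltW.
  apply/andP; split; [rewrite p1|rewrite p2]; apply: lerXn2r;
    by rewrite ?nnegrE ?expR_ge0.
- rewrite (_ : - w = - (w / (1 - 0))); last by rewrite subr0 divr1.
  apply: (cvg_comp _ expR); last exact: continuous_expR.
  apply: cvgN; apply: cvgM => //; apply: cvgV; first by rewrite subr0 oner_neq0.
  by apply: cvgB => //; exact: cvg_cst.
- by apply: (cvg_comp _ expR (cvgN cvw)); exact: continuous_expR.
Unshelve. all: by end_near. Qed.

(** The left side is the characteristic function of a sum of [(n + 1) ^ 2] independent random signs,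
    scaled by [1 / (n + 1)]. Analytically, [m ^ 2 (1 - cos (x / m))] tends to [x ^ 2 / 2], with an
    error of order [1 / m]. The limit turns Gaussian factors into limits of products of cosines. *)
Lemma cvg_cos_pow (R : realType) (x : R) :
  cos (x / n.+1%:R) ^+ (n.+1 ^ 2) @[n --> \oo] --> expR (- (x ^+ 2 / 2)).
Proof.
pose w_ n : R := (n.+1 ^ 2)%:R * (1 - cos (x / n.+1%:R)).
have E n : cos (x / n.+1%:R) = 1 - w_ n / (n.+1 ^ 2)%:R.
  by rewrite /w_ mulrAC divff ?pnatr_eq0// mul1r opprB addrC subrK.
rewrite (_ : (fun n => _) = fun n => (1 - w_ n / (n.+1 ^ 2)%:R) ^+ (n.+1 ^ 2)); last first.
  by apply/funext => n; rewrite E.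
apply: cvg_one_sub_pow.
- by move=> n; rewrite mulr_ge0// subr_ge0 cos_le1.
- apply/cvgrPdist_le => e e0.
  have : `|x| ^+ 3 * expR `|x| * n.+1%:R^-1 @[n --> \oo] --> (0 : R).
    by rewrite -[X in _ --> X](mulr0 (`|x| ^+ 3 * expR `|x|)); apply: cvgMr; exact: cvg_harmonic.
  move=> /cvgr_le /(_ _ e0); apply: filterS => n; apply: le_trans.
  have n0 : 0 < n.+1%:R :> R by rewrite ltr0n.
  rewrite distrC /w_ natrX.
  have -> : n.+1%:R ^+ 2 * (1 - cos (x / n.+1%:R)) - x ^+ 2 / 2 =
     n.+1%:R ^+ 2 * (1 - cos (x / n.+1%:R) - (x / n.+1%:R) ^+ 2 / 2).
    by field; rewrite gt_eqF.
  rewrite normrM ger0_norm ?sqr_ge0//.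
  have h := cos_taylor_bound (x / n.+1%:R).
  have xn : `|x / n.+1%:R| = `|x| / n.+1%:R by rewrite normrM normfV normr_nat.
  rewrite xn in h.
  apply: (@le_trans _ _ (n.+1%:R ^+ 2 * ((`|x| / n.+1%:R) ^+ 3 * expR `|x|))).
    apply: ler_wpM2l; first exact: sqr_ge0.
    apply: le_trans h _; apply: ler_wpM2l; first by rewrite exprn_ge0// divr_ge0.
    by rewrite ler_expR ler_pdivrMr// ler_peMr// ler1n.
  rewrite le_eqVlt; apply/orP; left; apply/eqP.
  by field; rewrite gt_eqF.
- apply: (@squeeze_cvgr _ _ _ _ (fun=> 0) (fun n => n.+1%:R^-1)).
  + near=> n; rewrite invr_ge0 ler0n /= lef_pV2 ?posrE ?ltr0n// ler_nat.
    by rewrite expnS leq_pmulr.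
  + exact: cvg_cst.
  + exact: cvg_harmonic.
- by move=> n; rewrite expn_gt0.
Unshelve. all: by end_near. Qed.

(** * Exponential moments and shifts of the Gaussian field *)

Section gaussian_field.
Context (R : realType) (E : pointedType) (PG : probability (prod_space E R) R).
Variables (g : E -> E -> R) (K : seq E).
Hypothesis cg : centered_gaussian_field PG.
Hypothesis covg : forall x y, (\int[PG]_phi (phi x * phi y)%:E = (g x y)%:E)%E.
Hypothesis uK : uniq K.

Let mphi x : measurable_fun setT (fun phi : prod_space E R => phi x).
Proof. exact: measurable_prod_coordinate. Qed.

Let i_sqr x : PG.-integrable setT (EFin \o (fun phi => phi x ^+ 2)).
Proof.
apply/integrableP; split; first by apply/measurable_EFinP; exact: measurable_funX.
under eq_integral do rewrite /= ger0_norm ?sqr_ge0// expr2.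
by rewrite covg ltry.
Qed.

Let i_prod x y : PG.-integrable setT (EFin \o (fun phi => phi x * phi y)).
Proof. exact: (integrable_mul_sqr (mphi x) (mphi y) (i_sqr x) (i_sqr y)). Qed.

Definition gfield_lin (a : E -> R) (phi : E -> R) : R := \sum_(x <- K) a x * phi x.

Definition gfield_cov (a b : E -> R) : R :=
  \sum_(x <- K) \sum_(y <- K) a x * b y * g x y.

Local Notation lin := gfield_lin.
Local Notation cov := gfield_cov.

Let gC x y : g x y = g y x.
Proof.
apply: EFin_inj; rewrite -!covg; apply: eq_integral => phi _.
by rewrite mulrC.
Qed.

Let mlin a : measurable_fun setT (fun phi : prod_space E R => lin a phi).
Proof. by apply: measurable_sum => x; exact: measurable_funM. Qed.

Let lin_sqr a : \int[PG]_phi (lin a phi ^+ 2) = cov a a.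
Proof.
rewrite /Rintegral.
have -> : (\int[PG]_phi (lin a phi ^+ 2)%:E =
    \int[PG]_phi (\sum_(x <- K) \sum_(y <- K) (a x * a y * (phi x * phi y))%:E))%E.
  apply: eq_integral => phi _; rewrite expr2 /lin mulr_suml -sumEFin.
  apply: eq_bigr => x _; rewrite mulr_sumr -sumEFin.
  by apply: eq_bigr => y _; congr EFin; ring.
have i2 x y : PG.-integrable setT (fun phi => (a x * a y * (phi x * phi y))%:E).
  apply: (eq_integrable _ (fun phi : prod_space E R => (a x * a y)%:E * (phi x * phi y)%:E)%E) => //.
  exact: integrableZl (i_prod x y).
rewrite integral_sum//; last first.
  by move=> x; apply: integrable_sum => // y; exact: i2.
rewrite /cov -[RHS]/(fine (_)%:E) -sumEFin; congr fine; apply: eq_bigr => x _.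
rewrite integral_sum// -sumEFin; apply: eq_bigr => y _.
under eq_integral do rewrite EFinM.
rewrite integralZl//; last exact: i_prod.
by rewrite covg -EFinM.
Qed.

(** The law of [<a, phi>] is centered normal with an unspecified [sd]; computing the second moment
    in two ways identifies [sd ^ 2] with [cov a a]. *)
Lemma gfield_mgf a :
  (\int[PG]_phi (expR (lin a phi))%:E = (expR (cov a a / 2))%:E)%E.
Proof.
have [sd lawa] := cg K a.
have := normal_law_mgf (mlin a) lawa 1.
under eq_integral do rewrite mul1r.
move=> ->; rewrite expr1n mul1r -(lin_sqr a).
by rewrite (normal_law_variance (mlin a) lawa).
Qed.

Let covD a b t : cov (fun x => t * b x + a x) (fun x => t * b x + a x) =
  t ^+ 2 * cov b b + 2 * t * cov b a + cov a a.
Proof.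
have covC : cov b a = \sum_(x <- K) \sum_(y <- K) a x * b y * g x y.
  rewrite /cov exchange_big; apply: eq_bigr => x _; apply: eq_bigr => y _.
  by rewrite gC; ring.
have -> : 2 * t * cov b a = t * cov b a + t * cov b a by ring.
rewrite {2}covC /cov !mulr_sumr -!big_split; apply: eq_bigr => x _ /=.
rewrite !mulr_sumr -!big_split; apply: eq_bigr => y _ /=.
by ring.
Qed.

Section cameron_martin.
Variable a : E -> R.

Definition gfield_density (phi : E -> R) : R := expR (lin a phi - cov a a / 2).

Definition gfield_shift (phi : E -> R) : prod_space E R :=
  fun x => phi x + \sum_(y <- K) g x y * a y.

Local Notation H := gfield_density.
Local Notation tau := gfield_shift.

Let mH : measurable_fun setT (fun phi : prod_space E R => H phi).
Proof.
rewrite /gfield_density; apply: measurableT_comp => //.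
by apply: measurable_funB => //; exact: mlin.
Qed.

Let mtau : measurable_fun setT (fun phi : prod_space E R => tau phi).
Proof. by apply: measurable_prod_space => x; exact: measurable_funD. Qed.

Lemma lin_shift b phi : lin b (tau phi) = lin b phi + cov b a.
Proof.
rewrite /lin /cov -big_split; apply: eq_bigr => x _ /=.
rewrite /tau mulrDr; congr (_ + _); rewrite mulr_sumr; apply: eq_bigr => y _.
by ring.
Qed.

Let exp_lin_integral b (r : R) :
  (\int[PG]_phi (expR (lin b phi) * expR r)%:E = (expR (cov b b / 2 + r))%:E)%E.
Proof.
under eq_integral do rewrite EFinM.
have me : measurable_fun setT (fun phi : prod_space E R => (expR (lin b phi))%:E).
  by apply/measurable_EFinP; apply: measurableT_comp => //; exact: mlin.
rewrite ge0_integralZr//=.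
by rewrite gfield_mgf -EFinM -expRD.
Qed.

Let exp_lin_integrable b (r : R) :
  PG.-integrable setT (EFin \o (fun phi => expR (lin b phi) * expR r)).
Proof.
apply/integrableP; split.
  apply/measurable_EFinP; apply: measurable_funM => //.
  by apply: measurableT_comp => //; exact: mlin.
under eq_integral do rewrite /= ger0_norm ?mulr_ge0 ?expR_ge0//.
by rewrite exp_lin_integral ltry.
Qed.

(** The law of [<b, phi> + th] under the density and its law after the shift have the same moment
    generating function. The density gives [cov (t b + a) (t b + a) / 2 - cov a a / 2], which is
    [t ^ 2 cov b b / 2 + t cov b a], and the last term is the effect of the shift. *)
Lemma cameron_martin_cos b th :
  \int[PG]_phi (cos (lin b phi + th) * H phi) =
  \int[PG]_phi (cos (lin b (tau phi) + th)).
Proof.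
have e1 t phi : expR (t * (lin b phi + th)) * H phi =
    expR (lin (fun x => t * b x + a x) phi) * expR (t * th - cov a a / 2).
  have -> : lin (fun x => t * b x + a x) phi = t * lin b phi + lin a phi.
    by rewrite /lin mulr_sumr -big_split; apply: eq_bigr => x _ /=; ring.
  by rewrite /H -!expRD; congr expR; ring.
have e2 t phi : expR (t * (lin b (tau phi) + th)) * (cst 1 phi) =
    expR (lin (fun x => t * b x) phi) * expR (t * (cov b a + th)).
  rewrite mulr1 lin_shift.
  have -> : lin (fun x => t * b x) phi = t * lin b phi.
    by rewrite /lin mulr_sumr; apply: eq_bigr => x _; ring.
  by rewrite -!expRD; congr expR; ring.
have mb th' : measurable_fun setT (fun phi : prod_space E R => lin b phi + th').
  by apply: measurable_funD => //; exact: mlin.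
transitivity (\int[PG]_phi (cos (lin b (tau phi) + th) * cst 1 phi)); last first.
  by apply: eq_Rintegral => phi _; rewrite mulr1.
apply: (@eq_integral_cos _ _ _ _ R PG PG (fun phi => H phi) (fun phi => lin b phi + th)
  (cst 1) (fun phi => lin b (tau phi) + th)) => //.
- by move=> phi; exact: expR_ge0.
- have -> : (fun phi : prod_space E R => lin b (tau phi) + th) =
      (fun phi => lin b phi + (cov b a + th)).
    by apply/funext => phi; rewrite lin_shift addrA.
  exact: mb.
- move=> t; apply: eq_integrable (exp_lin_integrable (fun x => t * b x + a x)
    (t * th - cov a a / 2)) => // phi _.
  by rewrite /= e1.
- move=> t; apply: eq_integrable (exp_lin_integrable (fun x => t * b x)
    (t * (cov b a + th))) => // phi _.
  by rewrite /= -e2.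
- move=> t; under eq_Rintegral do rewrite e1.
  under [RHS]eq_Rintegral do rewrite e2.
  rewrite /Rintegral !exp_lin_integral /=; congr expR; rewrite covD.
  have -> : cov (fun x => t * b x) (fun x => t * b x) = t ^+ 2 * cov b b.
    rewrite /cov mulr_sumr; apply: eq_bigr => x _; rewrite mulr_sumr.
    by apply: eq_bigr => y _; ring.
  by field.
Qed.

Let i_H : PG.-integrable setT (EFin \o (fun phi => H phi)).
Proof.
apply: eq_integrable (exp_lin_integrable a (- (cov a a / 2))) => // phi _.
by rewrite /= -expRD.
Qed.

Let mcos : measurable_fun setT (@cos R).
Proof. exact: (continuous_measurable_fun (@continuous_cos R)). Qed.

(* The functions [F] satisfying the Cameron-Martin formula jointly with every
   [cos (<b, phi> + th)]. *)
Let good (F : prod_space E R -> R) := [/\ measurable_fun setT F,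
  forall phi, `|F phi| <= 1 &
  forall b th, \int[PG]_phi (cos (lin b phi + th) * (F phi * H phi)) =
               \int[PG]_phi (cos (lin b (tau phi) + th) * F (tau phi))].

Let good1 : good (fun=> 1).
Proof.
split=> // [phi|b th]; first by rewrite normr1.
under eq_Rintegral do rewrite mul1r.
by under [RHS]eq_Rintegral do rewrite mulr1; exact: cameron_martin_cos.
Qed.

Let mcoslin b th : measurable_fun setT (fun phi : prod_space E R => cos (lin b phi + th)).
Proof.
by apply: measurableT_comp => //; apply: measurable_funD => //; exact: mlin.
Qed.

Let i1 F b th : good F ->
  PG.-integrable setT (EFin \o (fun phi => cos (lin b phi + th) * (F phi * H phi))).
Proof.
move=> [mF F1 _]; apply: (le_integrable _ _ _ i_H) => //.
  by apply/measurable_EFinP/measurable_funM => //; exact: measurable_funM.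
move=> phi _ /=; rewrite lee_fin !normrM mulrA ler_piMl//.
by rewrite mulr_ile1// ?cos_max.
Qed.

Let i2 F b th : good F ->
  PG.-integrable setT (EFin \o (fun phi => cos (lin b (tau phi) + th) * F (tau phi))).
Proof.
move=> [mF F1 _]; apply: (@bounded_integrable _ _ _ _ _ 1).
  apply: measurable_funM; first exact: (measurableT_comp (mcoslin b th) mtau).
  exact: (measurableT_comp mF mtau).
by move=> phi; rewrite normrM mulr_ile1// ?cos_max.
Qed.

Let cosM (x y : R) : cos x * cos y = 2^-1 * (cos (x + y) + cos (x - y)).
Proof. by rewrite cosD cosB; field. Qed.

(** The identity [cos x cos y = (cos (x + y) + cos (x - y)) / 2] reduces the claim to two instances
    of the formula for [F]; this is why [good] quantifies over all [b] and [th]. *)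
Let good_mul F b th : good F -> good (fun phi => cos (lin b phi + th) * F phi).
Proof.
move=> gF; have [mF F1 eF] := gF; split.
- by apply: measurable_funM => //; exact: mcoslin.
- by move=> phi; rewrite normrM mulr_ile1// ?cos_max.
- move=> b' th'.
  have linD (r : R) phi : lin (fun x => b' x + r * b x) phi = lin b' phi + r * lin b phi.
    by rewrite /lin mulr_sumr -big_split; apply: eq_bigr => x _ /=; ring.
  have ec phi : cos (lin b' phi + th') * cos (lin b phi + th) =
     2^-1 * (cos (lin (fun x => b' x + 1 * b x) phi + (th' + th)) +
             cos (lin (fun x => b' x + (-1) * b x) phi + (th' - th))).
    rewrite cosM !linD; congr (_ * (cos _ + cos _)); ring.
  transitivity (\int[PG]_phi (2^-1 *
     (cos (lin (fun x => b' x + 1 * b x) phi + (th' + th)) * (F phi * H phi) +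
      cos (lin (fun x => b' x + (-1) * b x) phi + (th' - th)) * (F phi * H phi)))).
    by apply: eq_Rintegral => phi _; rewrite !mulrA ec; ring.
  transitivity (\int[PG]_phi (2^-1 *
     (cos (lin (fun x => b' x + 1 * b x) (tau phi) + (th' + th)) * F (tau phi) +
      cos (lin (fun x => b' x + (-1) * b x) (tau phi) + (th' - th)) * F (tau phi)))).
    have j1 := i1 (fun x => b' x + 1 * b x) (th' + th) gF.
    have j2 := i1 (fun x => b' x + (-1) * b x) (th' - th) gF.
    have k1 := i2 (fun x => b' x + 1 * b x) (th' + th) gF.
    have k2 := i2 (fun x => b' x + (-1) * b x) (th' - th) gF.
    rewrite RintegralZl//; last exact: (integrableD measurableT j1 j2).
    rewrite RintegralZl//; last exact: (integrableD measurableT k1 k2).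
    by rewrite !RintegralD// !eF.
  by apply: eq_Rintegral => phi _; rewrite !mulrA ec; ring.
Qed.

Let good_mul_pow F b th n : good F ->
  good (fun phi => cos (lin b phi + th) ^+ n * F phi).
Proof.
move=> gF; elim: n => [|n IH].
  rewrite (_ : (fun phi => _) = F)//; apply/funext => phi.
  by rewrite expr0 mul1r.
rewrite (_ : (fun phi => _) =
  fun phi => cos (lin b phi + th) * (cos (lin b phi + th) ^+ n * F phi)).
  exact: good_mul.
by apply/funext => phi; rewrite exprS mulrA.
Qed.

Let good_prod (l : seq E) (b : E -> E -> R) (th : E -> R) n :
  good (fun phi => \prod_(x <- l) cos (lin (b x) phi + th x) ^+ n).
Proof.
elim: l => [|x l IH].
  rewrite (_ : (fun phi => _) = (fun=> 1)) //.
  by apply/funext => phi; rewrite big_nil.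
rewrite (_ : (fun phi => _) = fun phi =>
   cos (lin (b x) phi + th x) ^+ n * \prod_(x <- l) cos (lin (b x) phi + th x) ^+ n).
  exact: good_mul_pow.
by apply/funext => phi; rewrite big_cons.
Qed.

Variables (V s : E -> R).
Hypothesis V0 : forall x, 0 <= V x.

Let F_ n (phi : prod_space E R) : R := \prod_(x <- K)
  cos (Num.sqrt (V x) * (phi x + s x) / n.+1%:R) ^+ (n.+1 ^ 2).

Let F (phi : prod_space E R) : R := \prod_(x <- K) expR (- (V x * (phi x + s x) ^+ 2 / 2)).

Let goodF n : good (F_ n).
Proof.
(* The form [b x] selects the coordinate [x], scaled by [Num.sqrt (V x) / (n + 1)]; the phase
   carries [s x]. *)
pose b x y : R := if y == x then Num.sqrt (V x) / n.+1%:R else 0.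
rewrite (_ : F_ n = fun phi => \prod_(x <- K)
   cos (lin (b x) phi + Num.sqrt (V x) * s x / n.+1%:R) ^+ (n.+1 ^ 2)).
  exact: good_prod.
apply/funext => phi; rewrite /F_ big_seq [RHS]big_seq; apply: eq_bigr => x xK.
congr (cos _ ^+ _); rewrite /lin (bigD1_seq x)//= /b eqxx big1 ?addr0.
  by ring.
by move=> y /negbTE ->; rewrite mul0r.
Qed.

Let cvF phi : F_ n phi @[n --> \oo] --> F phi.
Proof.
rewrite /F_ /F; elim: (K) => [|x l IH].
  by rewrite big_nil; under eq_fun do rewrite big_nil; exact: cvg_cst.
rewrite big_cons; under eq_fun do rewrite big_cons.
apply: cvgM => //.
have -> : V x * (phi x + s x) ^+ 2 / 2 = (Num.sqrt (V x) * (phi x + s x)) ^+ 2 / 2.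
  by rewrite exprMn sqr_sqrtr.
exact: cvg_cos_pow.
Qed.

(** The products of cosines [F_ n] satisfy the formula and tend to [F]. They are bounded by 1, so
    the two limits are dominated by the density and by 1. *)
Lemma cameron_martin_square :
  \int[PG]_phi ((\prod_(x <- K) expR (- (V x * (phi x + s x) ^+ 2 / 2))) * H phi) =
  \int[PG]_phi (\prod_(x <- K) expR (- (V x * (tau phi x + s x) ^+ 2 / 2))).
Proof.
have mF : measurable_fun setT F.
  apply: measurable_prod => x _; apply: measurableT_comp => //.
  apply: measurableT_comp => //; apply: measurable_funM => //.
  apply: measurable_funM => //; apply: measurable_funX.
  by apply: measurable_funD => //; exact: mphi.
have l1 : \int[PG]_phi (F_ n phi * H phi) @[n --> \oo] --> \int[PG]_phi (F phi * H phi).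
  have [] // := @cvg_Rintegral_dominated _ _ _ PG (fun n phi => F_ n phi * H phi)
    (fun phi => F phi * H phi) (fun phi => H phi).
  - by move=> n; have [mFn _ _] := goodF n; exact: measurable_funM.
  - exact: measurable_funM.
  - by move=> phi; apply: cvgMl; exact: cvF.
  - move=> n phi; have [_ Fn1 _] := goodF n.
    by rewrite normrM (ger0_norm (expR_ge0 _)) ler_piMl ?expR_ge0.
have l2 : \int[PG]_phi (F_ n (tau phi)) @[n --> \oo] --> \int[PG]_phi (F (tau phi)).
  have [] // := @cvg_Rintegral_dominated _ _ _ PG (fun n phi => F_ n (tau phi))
    (fun phi => F (tau phi)) (cst 1).
  - by move=> n; have [mFn _ _] := goodF n; exact: (measurableT_comp mFn mtau).
  - exact: (measurableT_comp mF mtau).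
  - exact: finite_measure_integrable_cst.
  - by move=> n phi; have [_ Fn1 _] := goodF n; exact: Fn1.
apply: (eq_cvg_lim _ l1 l2) => n; have [_ _ e] := goodF n.
(* The zero form with phase 0 makes the auxiliary cosine equal to 1. *)
have := e (fun=> 0) 0.
have lin0 phi : lin (fun=> 0) phi = 0 by rewrite /lin big1// => x _; rewrite mul0r.
under eq_Rintegral do rewrite lin0 addr0 cos0 mul1r.
by under [RHS]eq_Rintegral do rewrite lin0 addr0 cos0 mul1r.
Qed.

End cameron_martin.

(** The equation for [s] says that shifting by the potential of [V s] and then adding [s] amounts on
    [K] to adding the constant [b]. In the exponent, the linear term of the density cancels the
    cross term of [V (phi + s) ^ 2 / 2], and the terms in [s ^ 2] cancel, leaving [b V s / 2]. *)
Lemma gaussian_square_shift (V s : E -> R) (b : R) : (forall x, 0 <= V x) ->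
    (forall x, x \in K -> s x + \sum_(y <- K) g x y * (V y * s y) = b) ->
  \int[PG]_phi expR (- \sum_(x <- K) V x * ((phi x + b) ^+ 2 / 2)) =
  expR (- (b / 2 * \sum_(x <- K) V x * s x)) *
  \int[PG]_phi expR (- \sum_(x <- K) V x * (phi x ^+ 2 / 2)).
Proof.
move=> V0 sb; have := cameron_martin_square (fun x => V x * s x) s V0.
have -> : \int[PG]_phi (\prod_(x <- K)
     expR (- (V x * (gfield_shift (fun x => V x * s x) phi x + s x) ^+ 2 / 2))) =
   \int[PG]_phi expR (- \sum_(x <- K) V x * ((phi x + b) ^+ 2 / 2)).
  apply: eq_Rintegral => phi _; rewrite -sumrN expR_sum big_seq [RHS]big_seq.
  apply: eq_bigr => x xK.
  have -> : phi x + b = gfield_shift (fun x => V x * s x) phi x + s x.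
    by rewrite -(sb x xK) /gfield_shift -addrA [s x + _]addrC.
  by rewrite mulrA.
move=> <-.
rewrite -RintegralZl//; last first.
  apply: (@bounded_integrable _ _ _ _ _ 1).
    apply: measurableT_comp => //; apply: measurableT_comp => //.
    apply: measurable_sum => x; apply: measurable_funM => //.
    by apply: measurable_funM => //; apply: measurable_funX; exact: mphi.
  move=> phi; rewrite ger0_norm ?expR_ge0// expR_le1 oppr_le0 sumr_ge0// => x _.
  by rewrite mulr_ge0// divr_ge0// sqr_ge0.
apply: eq_Rintegral => phi _; rewrite /gfield_density.
have -> : gfield_cov (fun x => V x * s x) (fun x => V x * s x) =
    \sum_(x <- K) V x * s x * (b - s x).
  rewrite /gfield_cov big_seq [RHS]big_seq; apply: eq_bigr => x xK.
  rewrite -(sb x xK) addrAC subrr add0r mulr_sumr; apply: eq_bigr => y _.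
  by ring.
rewrite -expR_sum -!expRD; congr expR.
rewrite /gfield_lin sumrN -!sumrN !mulr_sumr !mulr_suml -!sumrN -!big_split /=.
by apply: eq_bigr => x _; field.
Qed.

End gaussian_field.

(** * Occupation times of random interlacements *)

Lemma measurable_forall d (T : measurableType d) (I : Type) (e : nat -> I)
    (A : I -> set T) : (forall i, exists n, e n = i) ->
  (forall i, measurable (A i)) -> measurable [set w | forall i, A i w].
Proof.
move=> es mA; rewrite (_ : [set w | _] = \bigcap_n A (e n)).
  exact: bigcapT_measurable.
by apply/seteqP; split => w /= h => [n _|i]; [|have [n <-] := es i; exact: h].
Qed.

Definition int_enum (n : nat) : int := if odd n then Negz n./2 else Posz n./2.

Lemma int_enum_surj k : exists n, int_enum n = k.
Proof.
case: k => k; first by exists k.*2; rewrite /int_enum odd_double doubleK.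
by exists k.*2.+1; rewrite /int_enum /= odd_double /= uphalf_double.
Qed.

Lemma esum_int (R : realType) (a : int -> \bar R) : (forall n, (0 <= a n)%E) ->
  (\esum_(n in [set: int]) a n =
   \sum_(n <oo) a (Posz n) + \sum_(n <oo) a (Negz n))%E.
Proof.
move=> a0; rewrite (esumID [set n : int | 0 <= n])// !setTI; congr (_ + _)%E.
  rewrite nneseries_esumT//; apply: reindex_esum; split => //.
    by move=> i j _ _ [].
  by move=> [n|n] //= _; exists n.
rewrite nneseries_esumT//; apply: reindex_esum; split => //.
  by move=> i j _ _ [].
by move=> [n|n] //= n0; exists n.
Qed.

Section trajectories.
Context (R : realType) (E : pointedType).

Definition shift (k : int) (w : bipath_space R E) : bipath_space R E :=
  fun n => w (n + k).

Lemma traj_shift k w : traj (shift k w) = traj w.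
Proof. by apply/eqquotP; apply/asboolP; exists k. Qed.

Lemma traj_eq w w' : traj w = traj w' -> exists k, w = shift k w'.
Proof. by move=> /eqquotP /asboolP[k h]; exists k; exact/funext. Qed.

Lemma measurable_shift k : measurable_fun setT (shift k).
Proof.
by apply: measurable_prod_space => n; exact: measurable_prod_coordinate.
Qed.

Lemma measurable_traj : measurable_fun setT (@traj R E).
Proof. by move=> _ B mB; rewrite setTI; exact: mB. Qed.

Lemma measurable_bipathZ n :
  measurable_fun setT (fun w : bipath_space R E => bipathZ w n : vertex E).
Proof.
apply: (measurableT_comp measurable_fst); exact: measurable_prod_coordinate.
Qed.

Lemma measurable_bipathsigma_at n :
  measurable_fun setT (fun w : bipath_space R E => bipathsigma w n).
Proof.
apply: (measurableT_comp measurable_snd); exact: measurable_prod_coordinate.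
Qed.

Lemma measurable_bipathsigma : measurable_fun setT (@bipathsigma R E).
Proof.
by apply: measurable_prod_space => n; exact: measurable_bipathsigma_at.
Qed.

Lemma measurable_forwardZ : measurable_fun setT (@forwardZ R E).
Proof. by apply: measurable_prod_space => n; exact: measurable_bipathZ. Qed.

Lemma measurable_backwardZ : measurable_fun setT (@backwardZ R E).
Proof. by apply: measurable_prod_space => n; exact: measurable_bipathZ. Qed.

Lemma measurable_bipathZ_fun n (f : E -> R) :
  measurable_fun setT (fun w : bipath_space R E => f (bipathZ w n)).
Proof.
exact: (measurableT_comp (@measurable_vertex_fun E _ _ f) (measurable_bipathZ n)).
Qed.

(** The absolute value makes the terms nonnegative on the whole coordinate space, not only on
    admissible trajectories. For [v = V / lambda] this is the contribution of one trajectory to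
    [<V, L>]. *)
Definition bipath_occ (v : E -> R) (w : bipath_space R E) : \bar R :=
  (\esum_(n in [set: int]) (v (bipathZ w n) * `|bipathsigma w n|)%:E)%E.

Section occupation.
Variables (v : E -> R) (v0 : forall x, 0 <= v x).

Let term_ge0 (w : bipath_space R E) n :
  (0 <= (v (bipathZ w n) * `|bipathsigma w n|)%:E)%E.
Proof. by rewrite lee_fin mulr_ge0. Qed.

Lemma bipath_occ_ge0 w : (0 <= bipath_occ v w)%E.
Proof. by apply: esum_ge0 => n _; exact: term_ge0. Qed.

Lemma bipath_occ_shift k w : bipath_occ v (shift k w) = bipath_occ v w.
Proof.
rewrite /bipath_occ [RHS](reindex_esum [set: int] _ (fun n => n + k))//.
split => // [i j _ _ /addIr//|n _].
by exists (n - k) => //; rewrite subrK.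
Qed.

Lemma bipath_occE w : (bipath_occ v w =
  \sum_(n <oo) (v (bipathZ w (Posz n)) * `|bipathsigma w (Posz n)|)%:E +
  \sum_(n <oo) (v (bipathZ w (Negz n)) * `|bipathsigma w (Negz n)|)%:E)%E.
Proof. by rewrite /bipath_occ esum_int. Qed.

Lemma measurable_bipath_occ : measurable_fun setT (bipath_occ v).
Proof.
rewrite (funext bipath_occE).
have mt n : measurable_fun setT (fun w : bipath_space R E =>
    (v (bipathZ w n) * `|bipathsigma w n|)%:E).
  apply/measurable_EFinP/measurable_funM; first exact: measurable_bipathZ_fun.
  apply: measurableT_comp => //; exact: measurable_bipathsigma_at.
by apply: emeasurable_funD; apply: ge0_emeasurable_sum => // k w *; exact: term_ge0.
Qed.

(** The choice of representative is immaterial, since [bipath_occ] is invariant under [shift]. *)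
Definition traj_occ (t : traj_space R E) : \bar R := bipath_occ v (repr t).

Lemma traj_occ_traj w : traj_occ (traj w) = bipath_occ v w.
Proof.
have [k h] : exists k, repr (traj w) = shift k w by apply: traj_eq; exact: reprK.
by rewrite /traj_occ h bipath_occ_shift.
Qed.

Lemma traj_occ_ge0 t : (0 <= traj_occ t)%E.
Proof. exact: bipath_occ_ge0. Qed.

Lemma measurable_traj_occ : measurable_fun setT traj_occ.
Proof.
move=> _ B mB; rewrite setTI.
have -> : traj_occ @^-1` B = [set t | B (traj_occ t)] by [].
rewrite /measurable /= /traj_measurable /=.
rewrite (_ : _ @^-1` _ = bipath_occ v @^-1` B).
  by apply: measurable_preimage mB; exact: measurable_bipath_occ.
by apply/seteqP; split => w; rewrite /preimage /= traj_occ_traj.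
Qed.

End occupation.

Lemma bipath_occ_sum (l : seq E) (f : E -> E -> R) w : (forall i x, 0 <= f i x) ->
  bipath_occ (fun x => \sum_(i <- l) f i x) w = (\sum_(i <- l) bipath_occ (f i) w)%E.
Proof.
move=> f0; rewrite /bipath_occ -esum_sum; last first.
  by move=> n i _ _; rewrite lee_fin mulr_ge0.
by apply: eq_esum => n _; rewrite sumEFin mulr_suml.
Qed.

Section admissible.
Variable c : E -> E -> R.
Hypothesis gc : weighted_graph c.

(** Finiteness of the visits to finite sets, restated vertex by vertex with a bound on the times, so
    that measurability needs only countable operations. *)
Let visits_finite : set (bipath_space R E) :=
  [set w | forall y, exists N : nat, forall n : int, bipathZ w n = y -> (`|n| <= N)%N].

Lemma vertex_enum : exists e : nat -> E, forall y, exists n, e n = y.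
Proof.
have /countable_injP[f injf] := graph_countable gc.
exists (fun n => xget point [set y | f y = n]) => y; exists (f y).
case: xgetP => [z _ /= fz|/(_ y)]; last by move=> /(_ erefl).
by apply: injf => //; rewrite in_setT.
Qed.

Let visits_finiteE w :
  (forall K : set E, finite_set K -> finite_set (bipathZ w @^-1` K)) <-> visits_finite w.
Proof.
split=> [h y|h K fK].
  have /= fy := h [set y] (finite_set1 y).
  exists (\max_(n <- fset_set (bipathZ w @^-1` [set y])) `|n|%N)%N => n Zn.
  by apply: (@leq_bigmax_seq _ _ _ (fun n : int => `|n|%N)) => //; rewrite in_fset_set//; exact/mem_set.
rewrite (_ : _ @^-1` _ = \bigcup_(y in K) (bipathZ w @^-1` [set y])); last first.
  apply/seteqP; split => n /=; first by move=> Kn; exists (bipathZ w n).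
  by move=> [y Ky /= ->].
apply: bigcup_finite => // y _; have [N hN] := h y.
apply: (@sub_finite_set _ _ ((Posz @` `I_N.+1) `|` (Negz @` `I_N.+1))).
  move=> [n|n] /hN /= nN; [left|right]; exists n => //=.
  by rewrite ltnW.
by rewrite finite_setU; split; exact: finite_image.
Qed.

Let mvertex (A : set E) n : measurable [set w : bipath_space R E | A (bipathZ w n)].
Proof.
rewrite -[X in measurable X]setTI; exact: (measurable_bipathZ n measurableT (Y := A) Logic.I).
Qed.

Lemma measurable_admissible : measurable (admissible c).
Proof.
pose pos := [set w : bipath_space R E | forall n, bipathsigma w n \in `]0, +oo[].
pose nn := [set w : bipath_space R E | forall n, 0 < c (bipathZ w n) (bipathZ w (n + 1))].
pose div (f : nat -> int) :=
  (fun w : bipath_space R E => \sum_(n <oo) `|bipathsigma w (f n)|%:E)%E @^-1` [set +oo%E].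
have -> : admissible c = pos `&` nn `&` visits_finite `&` div Posz `&` div Negz.
  have ePos w : pos w -> (\esum_(n in [set n : int | (0 <= n)%R]) (bipathsigma w n)%:E =
      \sum_(n <oo) `|bipathsigma w (Posz n)|%:E)%E.
    move=> pw; rewrite nneseries_esumT//.
    rewrite (reindex_esum [set: nat] _ Posz); last first.
      by split => //; [move=> i j _ _ []|move=> [n|n] //= _; exists n].
    apply: eq_esum => n _; have := pw n; rewrite in_itv /= andbT => s0.
    by rewrite gtr0_norm.
  have eNeg w : pos w -> (\esum_(n in [set n : int | (n < 0)%R]) (bipathsigma w n)%:E =
      \sum_(n <oo) `|bipathsigma w (Negz n)|%:E)%E.
    move=> pw; rewrite nneseries_esumT//.
    rewrite (reindex_esum [set: nat] _ Negz); last first.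
      by split => //; [move=> i j _ _ []|move=> [n|n] //= _; exists n].
    apply: eq_esum => n _; have := pw (Negz n); rewrite in_itv /= andbT => s0.
    by rewrite gtr0_norm.
  apply/seteqP; split => w.
    move=> [s0 cw /visits_finiteE fw e1 e2].
    have pw : pos w by move=> n; rewrite in_itv /= andbT.
    split; last by rewrite /div /= -eNeg.
    by split; last by rewrite /div /= -ePos.
  move=> [[[[pw cw] fw] e1] e2]; split => //.
  - by move=> n; have := pw n; rewrite in_itv /= andbT.
  - exact/visits_finiteE.
  - by rewrite ePos.
  - by rewrite eNeg.
have [e es] := vertex_enum.
have mdiv f : measurable (div f).
  rewrite /div -[X in measurable X]setTI.
  apply: (_ : measurable_fun setT _) => //.
  apply: ge0_emeasurable_sum => // n _.
  apply/measurable_EFinP/measurableT_comp => //; exact: measurable_bipathsigma_at.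
apply: measurableI => //; apply: measurableI => //; apply: measurableI; last first.
  apply: (measurable_forall (A := fun y => [set w | exists N : nat, forall n : int,
    bipathZ w n = y -> (`|n| <= N)%N]) es) => y.
  rewrite (_ : [set w | _] = \bigcup_N [set w | forall n : int,
     (bipathZ w n = y -> (`|n| <= N)%N)]); last first.
    by apply/seteqP; split => w /= => [[N h]|[N _ h]]; exists N.
  apply: bigcupT_measurable => N.
  by apply: (measurable_forall (A := fun n : int => [set w : bipath_space R E |
    bipathZ w n = y -> (`|n| <= N)%N]) int_enum_surj) => n; exact: (mvertex (fun z => z = y -> (`|n| <= N)%N)).
apply: measurableI.
  apply: (measurable_forall (A := fun n : int => [set w : bipath_space R E |
    bipathsigma w n \in `]0, +oo[]) int_enum_surj) => n.
  rewrite -[X in measurable X]setTI.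
  by apply: (measurable_bipathsigma_at n measurableT (Y := `]0, +oo[%classic)).
apply: (measurable_forall (A := fun n : int => [set w : bipath_space R E |
    0 < c (bipathZ w n) (bipathZ w (n + 1))]) int_enum_surj) => n.
(* Splitting over the value [y] of the vertex at time [n] leaves conditions on single
   coordinates. *)
rewrite (_ : [set w | _] = [set w : bipath_space R E | forall y, bipathZ w n = y -> 0 < c y (bipathZ w (n + 1))]); last first.
  by apply/seteqP; split => w /= => [h y <-//|]; exact.
apply: (measurable_forall (A := fun y => [set w : bipath_space R E |
    bipathZ w n = y -> 0 < c y (bipathZ w (n + 1))]) es) => y.
rewrite (_ : [set w | _] = [set w | bipathZ w n <> y] `|` [set w | 0 < c y (bipathZ w (n + 1))]).
  apply: measurableU; first exact: (mvertex [set z | z <> y]).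
  exact: (mvertex [set z | 0 < c y z]).
apply/seteqP; split => w /=; last by move=> [].
by move=> h; have [/h|] := pselect (bipathZ w n = y); [right|left].
Qed.

Let preimage_traj_image (A : set (bipath_space R E)) :
  @traj R E @^-1` (@traj R E @` A) = [set w | exists n, A (shift (int_enum n) w)].
Proof.
apply/seteqP; split => w /=.
  move=> [w' Aw' /traj_eq[k e]]; have [n nk] := int_enum_surj k.
  by exists n; rewrite nk -e.
by move=> [n An]; exists (shift (int_enum n) w) => //; exact: traj_shift.
Qed.

(** Measurability in the quotient is tested on preimages, and the preimage of the image of [A] is
    the union of the countably many shifts of [A]. *)
Let measurable_traj_image (A : set (bipath_space R E)) :
  measurable A -> measurable (@traj R E @` A).
Proof.
move=> mA; rewrite /measurable /= /traj_measurable /= preimage_traj_image.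
rewrite (_ : [set w | _] = \bigcup_n (shift (int_enum n) @^-1` A)); last first.
  by apply/seteqP; split => w /= => [[N h]|[N _ h]]; exists N.
by apply: bigcupT_measurable => n; apply: measurable_preimage mA; exact: measurable_shift.
Qed.

Lemma measurable_traj_admissible : measurable (traj_admissible c).
Proof. exact: measurable_traj_image measurable_admissible. Qed.

End admissible.

End trajectories.

(** * Occupation of a single trajectory under [Q_K] *)

Section interlacement_marginal.
Context (R : realType) (E : pointedType) (c : E -> E -> R)
  (P : E -> probability (path_space R E) R).
Hypotheses (gc : weighted_graph c) (walkP : forall x, walk_law c x (P x)).
Variables (K : seq E) (V : E -> R).
Hypotheses (uK : uniq K) (V0 : forall y, 0 <= V y) (VK : forall y, y \notin K -> V y = 0).

Let lam0 := total_weight_gt0 gc walkP.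

Let v (y : E) : R := V y / total_weight c y.

Let v0 y : 0 <= v y.
Proof. by rewrite divr_ge0// ltW. Qed.

Let killing y : R := (1 + v y)^-1.

Let killing01 y : 0 <= killing y <= 1.
Proof.
have h : 1 <= 1 + v y by rewrite lerDl.
by rewrite invr_ge0 (le_trans ler01 h)/= invf_le1 ?(lt_le_trans ltr01 h).
Qed.

Section conditioned.
Variables (m : probability (bipath_space R E) R) (x : E).
Hypothesis forward_law : forall A : set (prod_space nat (vertex E)), measurable A ->
  m (@forwardZ R E @^-1` A) = P x (@pathZ R E @^-1` A).
Hypothesis backward_law : forall B : set (prod_space nat (vertex E)), measurable B ->
  m (@backwardZ R E @^-1` B) =
    conditional (P x) (no_return [set` K]) (@pathZ R E @^-1` B).
Hypothesis indep : forall (A B : set (prod_space nat (vertex E)))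
    (C : set (prod_space int R)), measurable A -> measurable B -> measurable C ->
  m (@forwardZ R E @^-1` A `&` @backwardZ R E @^-1` B `&` @bipathsigma R E @^-1` C) =
  (m (@forwardZ R E @^-1` A) * m (@backwardZ R E @^-1` B)
     * m (@bipathsigma R E @^-1` C))%E.
Hypothesis iid : iid_exp1 m (@bipathsigma R E).

Let fsigma (w : bipath_space R E) : prod_space nat R := fun n => bipathsigma w (Posz n).

Let mfsigma : measurable_fun setT fsigma.
Proof. by apply: measurable_prod_space => n; exact: measurable_bipathsigma_at. Qed.

Let forward_walk : simple_random_walk c m (@forwardZ R E : _ -> nat -> E) x.
Proof.
move=> n z; have [srw _ _] := walkP x; rewrite -srw.
exact: (forward_law (measurable_cylinder n z)).
Qed.

Let forward_iid : iid_exp1 m (fsigma : _ -> nat -> R).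
Proof.
split=> [J B uJ mB|i B mB]; last exact: iid.2.
have := iid.1 (map Posz J) (fun k => B `|k|%N).
rewrite map_inj_uniq//; last by move=> i j [].
move=> /(_ uJ (fun=> mB _)); rewrite big_map /= => <-; congr (m _).
apply/seteqP; split => w h k /=.
  by move=> /mapP[j jJ ->] /=; exact: h.
by move=> kJ; have := h (Posz k); apply; exact: map_f.
Qed.

Let forward_indep (A : set (prod_space nat (vertex E))) (B : set (prod_space nat R)) :
    measurable A -> measurable B ->
  m (@forwardZ R E @^-1` A `&` fsigma @^-1` B) =
    (m (@forwardZ R E @^-1` A) * m (fsigma @^-1` B))%E.
Proof.
move=> mA mB; pose C : set (prod_space int R) := [set s | B (fun n => s (Posz n))].
have mC : measurable C.
  rewrite -[X in measurable X]setTI.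
  apply: (@measurable_prod_space nat _ _ _ R (fun s : prod_space int R => fun n => s (Posz n))) => //.
  by move=> n; exact: measurable_prod_coordinate.
have := indep mA (@measurableT _ (prod_space nat (vertex E))) mC.
by rewrite preimage_setT setIT probability_setT mule1.
Qed.

Let forward_occ (w : bipath_space R E) : \bar R :=
  (\sum_(n <oo) (v (bipathZ w (Posz n)) * `|bipathsigma w (Posz n)|)%:E)%E.

Let forward_occ_partial N (w : bipath_space R E) : \bar R :=
  (\sum_(n < N.+1) (v (bipathZ w (Posz n)) * `|bipathsigma w (Posz n)|)%:E)%E.

Let term_ge0 (w : bipath_space R E) n :
  (0 <= (v (bipathZ w n) * `|bipathsigma w n|)%:E)%E.
Proof. by rewrite lee_fin mulr_ge0. Qed.

Let mterm n : measurable_fun setT (fun w : bipath_space R E =>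
  (v (bipathZ w n) * `|bipathsigma w n|)%:E).
Proof.
apply/measurable_EFinP/measurable_funM; first exact: measurable_bipathZ_fun.
apply: measurableT_comp => //; exact: measurable_bipathsigma_at.
Qed.

Let mforward_occ : measurable_fun setT forward_occ.
Proof. by apply: ge0_emeasurable_sum => // k w *; exact: term_ge0. Qed.

Let mforward_occ_partial N : measurable_fun setT (forward_occ_partial N).
Proof. by apply: emeasurable_sum => k; exact: mterm. Qed.

Let integral_partial N :
  (\int[m]_w (exp_opp (forward_occ_partial N w))%:E = (killed_partial c killing N x)%:E)%E.
Proof.
have := integral_walk (measurable_forwardZ (E := E)) mfsigma forward_walk gc lam0 forward_iid forward_indep N
  (phi := fun _ _ => 1) (fun _ _ => ler01) (v := fun _ => v) (fun _ => v0).
rewrite (@eq_path_functional _ _ _ _ (fun=> killing)); last by move=> *; rewrite mul1r.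
move=> <-; apply: eq_integral => w _; rewrite /forward_occ_partial exp_opp_sum//.
by congr EFin; apply: eq_bigr => j _; rewrite mul1r.
Qed.

Let no_return_backward : m [set w | exists n, bipathZ w (Negz n) \in K] = 0%E.
Proof.
pose B := [set f : prod_space nat (vertex E) | exists n, (f n.+1 : E) \in K].
have mB : measurable B.
  rewrite (_ : B = \bigcup_n (fun f : prod_space nat (vertex E) => f n.+1) @^-1` [set` K]).
    apply: bigcupT_measurable => n; rewrite -[X in measurable X]setTI.
    exact: measurable_prod_coordinate.
  by apply/seteqP; split => f /= => [[n h]|[n _ h]]; exists n.
have -> : [set w : bipath_space R E | exists n, bipathZ w (Negz n) \in K] =
   @backwardZ R E @^-1` B.
  by apply/seteqP; split => w [n]; exists n; rewrite /backwardZ /= -?NegzE// NegzE.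
rewrite backward_law// /conditional (_ : _ `&` _ = set0) ?measure0 ?mul0e//.
apply/seteqP; split => // w [[n h] /(_ n.+1 isT)]; apply; exact: h.
Qed.

(** The backward part, conditioned not to return to [K], contributes 0 almost surely. The forward
    part is a walk with exponential holding times, and its partial sums give the killed walk with
    factor [(1 + v)^-1]. *)
Lemma integral_exp_opp_bipath_occ :
  (\int[m]_w (exp_opp (bipath_occ v w))%:E = (survival c V x)%:E)%E.
Proof.
transitivity (\int[m]_w (exp_opp (forward_occ w))%:E)%E.
  apply: ge0_ae_eq_integral => //.
  - by apply/measurable_EFinP; apply: measurable_funexp_opp; exact: measurable_bipath_occ.
  - by apply/measurable_EFinP; exact: measurable_funexp_opp.
  - by move=> w _; rewrite lee_fin exp_opp_ge0.
  - by move=> w _; rewrite lee_fin exp_opp_ge0.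
  exists [set w | exists n, bipathZ w (Negz n) \in K]; split.
  - rewrite (_ : [set w | _] = \bigcup_n (fun w : bipath_space R E =>
      bipathZ w (Negz n) : vertex E) @^-1` [set` K]).
      apply: bigcupT_measurable => n; rewrite -[X in measurable X]setTI.
      exact: measurable_bipathZ.
    by apply/seteqP; split => f /= => [[n h]|[n _ h]]; exists n.
  - exact: no_return_backward.
  move=> w /= h; apply: contrapT => nK; apply: h => _; congr (exp_opp _)%:E.
  rewrite bipath_occE// [X in (_ + X)%E]eseries0 ?adde0// => n _ _.
  rewrite /v VK ?mul0r//; apply/negP => nn; apply: nK; by exists n.
have mf : measurable_fun setT (fun w => exp_opp (forward_occ w)).
  exact: measurable_funexp_opp.
have norm1 y : (0 <= y)%E -> `|exp_opp y : R| <= 1.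
  by move=> /exp_opp01 /andP[h1 h2]; rewrite ger0_norm.
have fo0 w : (0 <= forward_occ w)%E by apply: nneseries_ge0 => n _ _; exact: term_ge0.
have fp0 N w : (0 <= forward_occ_partial N w)%E by exact: sume_ge0.
have [] // := @cvg_Rintegral_dominated _ _ _ m
    (fun N w => exp_opp (forward_occ_partial N w)) (fun w => exp_opp (forward_occ w)) (cst 1).
- by move=> N; exact: measurable_funexp_opp.
- exact: finite_measure_integrable_cst.
- move=> w; apply: cvg_exp_opp => //.
  have h : (fun N => \sum_(0 <= n < N) (v (bipathZ w (Posz n)) *
     `|bipathsigma w (Posz n)|)%:E)%E @ \oo --> forward_occ w.
    by apply: is_cvg_nneseries => n _ _; exact: term_ge0.
  rewrite -(cvg_shiftS _) in h.
  have -> // : (fun N => forward_occ_partial N w) = (fun N => \sum_(0 <= n < N.+1)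
    (v (bipathZ w (Posz n)) * `|bipathsigma w (Posz n)|)%:E)%E.
  by apply/funext => N; rewrite big_mkord.
- by move=> N w; exact: norm1.
move=> intf cv.
have cv2 : \int[m]_w exp_opp (forward_occ_partial N w) @[N --> \oo] --> survival c V x.
  have -> : (fun N => \int[m]_w exp_opp (forward_occ_partial N w)) = killed_partial c killing ^~ x.
    by apply/funext => N; rewrite /Rintegral integral_partial.
  exact: cvg_killed.
rewrite -(@fineK _ (integral _ _ _)); last exact: integrable_fin_num.
congr EFin; exact: (eq_cvg_lim (fun=> erefl) cv cv2).
Qed.

End conditioned.

Section restriction.
Variable Q : {finite_measure set (bipath_space R E) -> \bar R}.
Hypothesis isQ : is_interlacement_Q c P [set` K] Q.

Let start (x : E) : set (bipath_space R E) := [set w | bipathZ w 0 = x].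

Let mstart x : measurable (start x).
Proof.
rewrite -[X in measurable X]setTI.
exact: (measurable_bipathZ 0 measurableT (Y := [set x]) Logic.I).
Qed.

Let Q_start x : Q (start x) = (escape c K x * total_weight c x * (x \in K)%:R)%:E.
Proof.
have [_ h _] := isQ; rewrite /start h /equilibrium (no_return_prob gc)// indicE -!EFinM.
congr (_ * _%:R)%:E; congr nat_of_bool.
by apply/idP/idP => [/set_mem//|?]; exact/mem_set.
Qed.

Let mf : measurable_fun setT (fun w : bipath_space R E => (1 - exp_opp (bipath_occ v w))%:E).
Proof.
apply/measurable_EFinP/measurable_funB => //; apply: measurable_funexp_opp.
exact: measurable_bipath_occ.
Qed.

Let f0 (w : bipath_space R E) : (0 <= (1 - exp_opp (bipath_occ v w))%:E)%E.
Proof.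
rewrite lee_fin subr_ge0.
by have /exp_opp01/andP[] := bipath_occ_ge0 v0 w.
Qed.

Let integral_start x : x \in K ->
  (\int[Q]_(w in start x) (1 - exp_opp (bipath_occ v w))%:E =
   (total_weight c x * escape c K x * (1 - survival c V x))%:E)%E.
Proof.
move=> xK; have Qx := Q_start x; rewrite xK mulr1 in Qx.
(* If the escape probability is 0 the conditional law is not prescribed, but then [start x] is null
   and both sides vanish. *)
have [e0|ne0] := eqVneq (escape c K x) 0.
  rewrite e0 mulr0 mul0r; rewrite e0 mul0r in Qx.
  apply: null_set_integral => //; exact: measurable_funTS.
have Qgt0 : (0 < Q (start x))%E.
  rewrite lt0e measure_ge0 andbT Qx eqe mulf_neq0// gt_eqF//; exact: lam0.
have qgt0 : 0 < escape c K x * total_weight c x by move: Qgt0; rewrite Qx lte_fin.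
set q := escape c K x * total_weight c x in Qx qgt0.
(* [conditional] is only a set function; the normalized restriction agrees with it on measurable
   sets and is a probability. The Dirac mass is the default that [mnormalize] requires for
   degenerate total mass. *)
pose m := mnormalize (mrestr Q (mstart x)) (dirac (point : bipath_space R E)).
have mE A : measurable A -> m A = conditional Q (start x) A.
  move=> mA; rewrite /m /mnormalize /= /mrestr setTI Qx eqe gt_eqF//= /conditional.
  by rewrite Qx inver gt_eqF.
have eq_pos : (0 < equilibrium c P [set` K] x)%E by have [_ <- _] := isQ.
have [_ _ /(_ x eq_pos)[indep fwd bwd iid]] := isQ.
have mpreF A : measurable A -> measurable (@forwardZ R E @^-1` A).
  by apply: measurable_preimage; exact: measurable_forwardZ.
have mpreB A : measurable A -> measurable (@backwardZ R E @^-1` A).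
  by apply: measurable_preimage; exact: measurable_backwardZ.
have mpreS A : measurable A -> measurable (@bipathsigma R E @^-1` A).
  by apply: measurable_preimage; exact: measurable_bipathsigma.
have fwd' A : measurable A -> m (@forwardZ R E @^-1` A) = P x (@pathZ R E @^-1` A).
  by move=> mA; rewrite mE ?fwd//; exact: mpreF.
have bwd' A : measurable A -> m (@backwardZ R E @^-1` A) =
    conditional (P x) (no_return [set` K]) (@pathZ R E @^-1` A).
  by move=> mA; rewrite mE ?bwd//; exact: mpreB.
have indep' (A B : set (prod_space nat (vertex E))) (C : set (prod_space int R)) :
    measurable A -> measurable B -> measurable C ->
  m (@forwardZ R E @^-1` A `&` @backwardZ R E @^-1` B `&` @bipathsigma R E @^-1` C) =
  (m (@forwardZ R E @^-1` A) * m (@backwardZ R E @^-1` B)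
     * m (@bipathsigma R E @^-1` C))%E.
  move=> mA mB' mC; rewrite !mE ?indep//; [exact: mpreS|exact: mpreB|exact: mpreF|].
  by do 2?apply: measurableI; [exact: mpreF|exact: mpreB|exact: mpreS].
have msig i (B : set R) : measurable B ->
    measurable [set w : bipath_space R E | B (bipathsigma w i)].
  by apply: measurable_preimage; exact: measurable_bipathsigma_at.
have iid' : iid_exp1 m (@bipathsigma R E).
  split=> [J B uJ mB'|i B mB']; last by rewrite mE ?iid.2//; exact: msig.
  rewrite mE; last first.
    rewrite bigcap_seq; apply: bigsetI_measurable => i _; exact: msig.
  rewrite [LHS](iid.1 J B uJ mB'); apply: eq_bigr => i _; rewrite mE//; exact: msig.
have m1 : (\int[m]_w (1 - exp_opp (bipath_occ v w))%:E = (1 - survival c V x)%:E)%E.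
  have h : (\int[m]_w (1 - exp_opp (bipath_occ v w))%:E + (survival c V x)%:E = 1)%E.
    rewrite -(integral_exp_opp_bipath_occ fwd' bwd' indep' iid') -ge0_integralD//.
    - transitivity (\int[m]_w (cst 1%E w))%E.
        by apply: eq_integral => w _; rewrite -EFinD subrK.
      by rewrite integral_cst// mul1e; exact: probability_setT.
    - by move=> w _; rewrite lee_fin exp_opp_ge0.
    - apply/measurable_EFinP; apply: measurable_funexp_opp; exact: measurable_bipath_occ.
  by rewrite EFinB -h addeK.
rewrite [total_weight c x * _]mulrC -/q EFinM -m1.
have := @eq_weighted_integral _ _ _ _ _ (bipath_space R E) R Q m
  \1_(start x) (cst q) id id _ _ _ _ _ _ _
  (fun w => (1 - exp_opp (bipath_occ v w))%:E) mf f0.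
have -> : (\int[Q]_w ((1 - exp_opp (bipath_occ v w))%:E * (\1_(start x) w)%:E) =
    \int[Q]_(w in start x) (1 - exp_opp (bipath_occ v w))%:E)%E.
  rewrite [RHS]integral_mkcond; apply: eq_integral => w _.
  by rewrite patchE indicE; case: ifP => _; rewrite ?mule1 ?mule0.
have -> : (\int[m]_w ((1 - exp_opp (bipath_occ v w))%:E * (cst q w)%:E) =
   q%:E * \int[m]_w (1 - exp_opp (bipath_occ v w))%:E)%E.
  by rewrite /= ge0_integralZr//= ?lee_fin 1?ltW// muleC.
apply => //; first by move=> w; exact: ltW.
move=> B mB'; rewrite !preimage_id integral_indic//=.
transitivity (q%:E * m B)%E; last by rewrite -integral_cst.
by rewrite mE// /conditional Qx setIC inver gt_eqF// muleCA -EFinM divff ?mule1// gt_eqF.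
Qed.

Lemma integral_interlacement_Q : 
  (\int[Q]_w (1 - exp_opp (bipath_occ v w))%:E =
   (\sum_(x <- K) total_weight c x * escape c K x * (1 - survival c V x))%:E)%E.
Proof.
have [e es] := vertex_enum gc.
pose D := \big[setU/set0]_(x <- K) start x.
have tstart : trivIset [set` K] start by move=> x y _ _ [w [<- <-]].
have mD : measurable D by apply: bigsetU_measurable => x _; exact: mstart.
rewrite (ge0_negligible_integral (measurableC mD))//; last first.
  apply/eqP; rewrite -measure_le0.
  (* The complement of [D] is covered by the events [start y] with [y] outside [K]; they are
     countably many, and null because the equilibrium measure lives on [K]. *)
  pose F n := if e n \in K then set0 else start (e n).
  have mF n : measurable (F n) by rewrite /F; case: ifP.
  apply: (le_trans (measure_sigma_subadditive Q mF (measurableC mD) _)).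
    move=> w; rewrite /D -bigcup_seq => nD; have [n en] := es (bipathZ w 0).
    exists n => //; rewrite /F en; case: ifP => // zK.
    by apply: nD; exists (bipathZ w 0).
  rewrite eseries0// => n _ _; rewrite /F; case: ifP => [_|nK]; first exact: measure0.
  by have := Q_start (e n); rewrite nK mulr0.
rewrite setTD setCK ge0_integral_bigsetU//; last exact: measurable_funTS.
by rewrite -sumEFin big_seq [RHS]big_seq; apply: eq_bigr => x; exact: integral_start.
Qed.

End restriction.

End interlacement_marginal.

(** * Laplace functional of the occupation field *)

Section interlacement_occupation.
Context (R : realType) (E : pointedType) (c : E -> E -> R)
  (P : E -> probability (path_space R E) R).
Hypotheses (gc : weighted_graph c) (walkP : forall x, walk_law c x (P x)).
Variable nu : {sigma_finite_measure set (traj_space R E) -> \bar R}.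
Hypothesis inter : interlacement_measure c P nu.
Variables (K : seq E) (V : E -> R).
Hypotheses (uK : uniq K) (V0 : forall y, 0 <= V y) (VK : forall y, y \notin K -> V y = 0).

Let lam0 := total_weight_gt0 gc walkP.

Let v (y : E) : R := V y / total_weight c y.

Let v0 y : 0 <= v y.
Proof. by rewrite divr_ge0// ltW. Qed.

(** The integrand below vanishes off [A], and an admissible trajectory in [A] must enter [K]. As
    [nu] charges only admissible trajectories, it coincides on [A] with the image of [Q_K]. *)
Let A : set (traj_space R E) := [set t | traj_occ v t != 0%E].

Let mA : measurable A.
Proof.
have -> : A = ~` (traj_occ v @^-1` [set 0%E]).
  by apply/seteqP; split => t /= /eqP.
by apply/measurableC/measurable_preimage => //; exact: measurable_traj_occ.
Qed.

Let sub_entering : A `&` traj_admissible c = A `&` traj_entering c [set` K].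
Proof.
apply/seteqP; split => t [At [w cw wt]]; split => //; rewrite -wt.
  apply: (@imageP _ _ _ [set w | admissible c w /\ exists n, [set` K] (bipathZ w n)]).
  split=> //; apply: contrapT => nK; have /eqP h : traj_occ v t != 0%E := At; apply: h.
  rewrite -wt traj_occ_traj /bipath_occ esum1// => n _; rewrite /v VK ?mul0r//.
  by apply/negP => nn; apply: nK; exists n.
by apply: imageP; case: cw.
Qed.

Let finK : finite_set [set` K].
Proof. exact: finite_seq. Qed.

Let nu_pushforward (Q : {finite_measure set (bipath_space R E) -> \bar R}) B :
    (forall A : set (traj_space R E), measurable A ->
      nu (A `&` traj_entering c [set` K]) = pushforward Q (@traj R E) A) ->
  measurable B -> nu (B `&` A) = Q (@traj R E @^-1` (B `&` A)).
Proof.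
move=> nuQ mB; have [nu0 _] := inter.
have mBA : measurable (B `&` A) by exact: measurableI.
have mad := measurable_traj_admissible gc.
have := nuQ _ mBA; rewrite -setIA -sub_entering setIA => e.
transitivity (nu (B `&` A `&` traj_admissible c)); last exact: e.
rewrite [LHS](measureDI nu mBA mad) [X in (X + _)%E](_ : _ = 0%E) ?add0e//.
apply/eqP; rewrite -measure_le0.
have : (nu (B `&` A `\` traj_admissible c) <= nu (~` traj_admissible c))%E.
  apply: le_measure.
  - by apply/mem_set; apply: measurableD.
  - by apply/mem_set; apply: measurableC.
  - by move=> t [].
by move=> h; apply: (le_trans h); rewrite [X in (X <= _)%E]nu0.
Qed.

Let mf : measurable_fun setT (fun t : traj_space R E => (1 - exp_opp (traj_occ v t))%:E).
Proof.
apply/measurable_EFinP/measurable_funB => //; apply: measurable_funexp_opp.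
exact: measurable_traj_occ.
Qed.

Let f0 (t : traj_space R E) : (0 <= (1 - exp_opp (traj_occ v t))%:E)%E.
Proof.
rewrite lee_fin subr_ge0.
by have /exp_opp01/andP[] := traj_occ_ge0 v0 t.
Qed.

Let f_indic t : ((1 - exp_opp (traj_occ v t))%:E * (\1_A t)%:E =
  (1 - exp_opp (traj_occ v t))%:E)%E.
Proof.
rewrite indicE; have [_|] := boolP (t \in A); first by rewrite mule1.
rewrite mule0 notin_setE /A /= => /negP; rewrite negbK => /eqP ->.
by rewrite exp_opp0 subrr.
Qed.

Lemma finite_measure_traj_occ : (nu [set t | traj_occ v t != 0%E] < +oo)%E.
Proof.
have [_ /(_ _ finK)[Q isQ nuQ]] := inter.
have := nu_pushforward nuQ measurableT; rewrite setTI => e.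
rewrite [X in (X < _)%E]e -ge0_fin_numE; last exact: measure_ge0.
by apply: fin_num_measure; exact: mA.
Qed.

Lemma integral_traj_occ :
  (\int[nu]_t (1 - exp_opp (traj_occ v t))%:E =
   (\sum_(x <- K) total_weight c x * escape c K x * (1 - survival c V x))%:E)%E.
Proof.
have [_ /(_ _ finK)[Q isQ nuQ]] := inter.
rewrite -(integral_interlacement_Q gc walkP uK V0 VK isQ).
have mA' : measurable (@traj R E @^-1` A) by exact: mA.
have := @eq_weighted_integral _ _ _ _ _ (traj_space R E) R nu Q
  \1_A \1_(@traj R E @^-1` A) id (@traj R E) _ _ _ _ _ _ _ _ mf f0.
under eq_integral do rewrite f_indic.
move=> ->//.
- apply: eq_integral => w _; rewrite -traj_occ_traj// -[in RHS]f_indic.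
- exact: measurable_traj.
- move=> B mB; rewrite !integral_indic//.
  by have := nu_pushforward nuQ mB; rewrite setIC preimage_setI setIC => e; exact: e.
Qed.

Variables (d : measure_display) (Omega : measurableType d) (Pr : probability Omega R)
  (p : Omega -> nat -> traj_space R E * R).
Hypothesis ppp : poisson_point_process Pr p (intensity nu).
Variable u : R.
Hypothesis u0 : 0 <= u.

Definition occ_at (v : E -> R) (z : traj_space R E * R) : \bar R :=
  (traj_occ v z.1 * (\1_`[0, u] z.2)%:E)%E.

Let pos : set (traj_space R E * R) := setT `*` [set t : R | (0 <= t)%R].

Let mpos : measurable pos.
Proof.
apply: measurableX => //; rewrite (_ : [set t | _] = `[0, +oo[%classic)//.
by apply/seteqP; split => t /=; rewrite in_itv /= andbT.
Qed.

Let D : set (traj_space R E * R) := A `*` `[0, u].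

Let mD : measurable D.
Proof. exact: measurableX. Qed.

(** The set function [intensity nu], written as a restriction of the product measure so that it
    carries a measure structure. *)
Let mu := mrestr (nu \x @lebesgue_measure R)%E mpos.

Let mu_sub B : B `<=` D -> mu B = (nu \x @lebesgue_measure R)%E B.
Proof.
move=> BD; rewrite /mu /mrestr setIidl// => z /BD [_ /=].
by rewrite in_itv /= => /andP[].
Qed.

Let m_occ_at : measurable_fun setT (occ_at v).
Proof.
apply: emeasurable_funM.
  exact: (measurableT_comp (measurable_traj_occ v0) measurable_fst).
apply/measurable_EFinP.
have mI : measurable_fun setT (\1_`[0, u] : R -> R) by exact: measurable_indic.
exact: (measurableT_comp mI measurable_snd).
Qed.

Let occ_at_ge0 z : (0 <= occ_at v z)%E.
Proof. by rewrite mule_ge0 ?traj_occ_ge0// lee_fin. Qed.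

Let occ_at0 z : ~ D z -> occ_at v z = 0%E.
Proof.
move=> nD; rewrite /occ_at indicE.
have [/set_mem zu|_] := boolP (z.2 \in _); last by rewrite mule0.
rewrite mule1; apply/eqP/negPn/negP => At; exact: nD.
Qed.

(** The functional is supported in the product of [A] and [[0, u]], of finite intensity. Integrating
    out the label multiplies by [u] the integral over one trajectory, which is computed under
    [Q_K]. *)
Lemma occupation_laplace :
  measurable_fun setT (fun om => \sum_(i <oo) occ_at v (p om i))%E /\
  (\int[Pr]_om (exp_opp (\sum_(i <oo) occ_at v (p om i)))%:E =
   (expR (- (u * \sum_(x <- K) total_weight c x * escape c K x * (1 - survival c V x))))%:E)%E.
Proof.
have leb : @lebesgue_measure R `[0, u]%classic = u%:E.
  rewrite lebesgue_measure_itv/= lte_fin.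
  by move: u0; rewrite le_eqVlt => /predU1P[<-|->]; rewrite ?ltxx// sube0.
have muD : (mu D < +oo)%E.
  have -> : mu D = (nu A * u%:E)%E by rewrite mu_sub// -leb; exact: product_measure1E.
  rewrite -ge0_fin_numE; last by rewrite mule_ge0.
  by rewrite fin_numM// ge0_fin_numE//; exact: finite_measure_traj_occ.
have [h1 h2] := poisson_process_laplace (mu := mu) ppp mD muD m_occ_at occ_at_ge0 occ_at0.
split => //; rewrite h2; congr ((expR (- _))%:E).
have E0 z : ~ D z -> (1 - exp_opp (occ_at v z))%:E = 0%E.
  by move=> /occ_at0 ->; rewrite exp_opp0 subrr.
have mF : measurable_fun setT (fun z => (1 - exp_opp (occ_at v z))%:E).
  by apply/measurable_EFinP/measurable_funB => //; exact: measurable_funexp_opp.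
have F0 z : (0 <= (1 - exp_opp (occ_at v z))%:E)%E.
  by rewrite lee_fin subr_ge0; have /exp_opp01/andP[] := occ_at_ge0 z.
have rD z : ((fun z => (1 - exp_opp (occ_at v z))%:E) \_ D) z =
    (1 - exp_opp (occ_at v z))%:E.
  rewrite patchE.
  by case: ifPn => // /negP nD; rewrite E0// => Dz; apply: nD; exact/mem_set.
have -> : (\int[mu]_z (1 - exp_opp (occ_at v z))%:E =
    \int[(nu \x @lebesgue_measure R)%E]_z (1 - exp_opp (occ_at v z))%:E)%E.
  transitivity (\int[mu]_(z in D) (1 - exp_opp (occ_at v z))%:E)%E.
    by rewrite [RHS]integral_mkcond; apply: eq_integral => z _; exact/esym/rD.
  transitivity (\int[(nu \x @lebesgue_measure R)%E]_(z in D) (1 - exp_opp (occ_at v z))%:E)%E.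
    by apply: eq_measure_integral => B mB BD; exact: mu_sub.
  by rewrite [LHS]integral_mkcond; apply: eq_integral => z _; exact: rD.
rewrite fubini_tonelli1//= /fubini_F /=.
transitivity (fine (\int[nu]_t ((1 - exp_opp (traj_occ v t))%:E * u%:E)))%E.
  congr fine; apply: eq_integral => t _.
  transitivity (\int[lebesgue_measure]_(y in `[(0%R : R), u]) (cst (1 - exp_opp (traj_occ v t))%:E y))%E.
    rewrite [RHS]integral_mkcond; apply: eq_integral => y _; rewrite patchE /occ_at /= indicE.
    by case: ifP => _; rewrite ?mule1// mule0 exp_opp0 subrr.
  transitivity ((1 - exp_opp (traj_occ v t))%:E * @lebesgue_measure R `[(0%R : R), u]%classic)%E.
    exact: integral_cst.
  by rewrite leb.
by rewrite ge0_integralZr ?lee_fin//= integral_traj_occ /= mulrC.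
Qed.

End interlacement_occupation.

(** * The isomorphism theorem *)

Section gaussian_covariance.
Context (R : realType) (E : pointedType) (c : E -> E -> R)
  (P : E -> probability (path_space R E) R) (PG : probability (prod_space E R) R).
Hypothesis gff : gaussian_free_field c P PG.

Let mphi x : measurable_fun setT (fun phi : prod_space E R => phi x).
Proof. exact: measurable_prod_coordinate. Qed.

(** By symmetry [x >= 0], and then squaring [1 + x / 2 <= expR (x / 2)] gives
    [x ^ 2 / 4 <= expR x]. *)
Let sqr_le_exp (x : R) : x ^+ 2 <= 4 * (expR x + expR (- x)).
Proof.
wlog x0 : x / 0 <= x.
  move=> h; have [|/ltW x0] := leP 0 x; first exact: h.
  by rewrite -sqrrN addrC -[X in expR X + _]opprK -[X in _ + expR X]opprK opprK h ?oppr_ge0.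
have h := expR_ge1Dx (x / 2).
have -> : expR x = expR (x / 2) ^+ 2 by rewrite expr2 -expRD -splitr.
have := expR_ge0 (- x).
nra.
Qed.

Let integrable_sqr x : PG.-integrable setT (fun phi : prod_space E R => (phi x ^+ 2)%:E).
Proof.
have [sd law] := gff.1 [:: x] (fun=> 1).
have law' (B : set R) : measurable B -> PG [set phi : prod_space E R | B (phi x)] = centered_normal sd B.
  move=> mB; rewrite -law//; congr (PG _).
  by apply/seteqP; split => phi /=; rewrite big_seq1 mul1r.
have mexp t : measurable_fun setT (fun phi : prod_space E R => (expR (t * phi x))%:E).
  by apply/measurable_EFinP; apply: measurableT_comp => //; exact: measurable_funM.
have iexp t : PG.-integrable setT (fun phi : prod_space E R => (expR (t * phi x))%:E).
  apply/integrableP; split => //.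
  under eq_integral do rewrite gee0_abs ?lee_fin ?expR_ge0//.
  by rewrite (normal_law_mgf (mphi x) law') ltry.
apply: (le_integrable _ _ _ (integrableZl measurableT 4 (integrableD measurableT (iexp 1) (iexp (-1))))) => //.
  by apply/measurable_EFinP; exact: measurable_funX.
move=> phi _ /=; rewrite lee_fin [leRHS]ger0_norm ?mulr_ge0 ?addr_ge0 ?expR_ge0//.
by rewrite ger0_norm ?sqr_ge0// mul1r mulN1r; exact: sqr_le_exp.
Qed.

(** The covariance is prescribed as an identity of extended reals; the exponential moments of the
    normal law make its left side finite. *)
Lemma green_fin_num x y : (green c P x y \is a fin_num)%E.
Proof.
rewrite -gff.2 unlock; apply: integrable_fin_num => //.
exact: (integrable_mul_sqr (mphi x) (mphi y) (integrable_sqr x) (integrable_sqr y)).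
Qed.

Lemma covariance_green x y :
  (\int[PG]_phi (phi x * phi y)%:E = (fine (green c P x y))%:E)%E.
Proof. by rewrite fineK ?green_fin_num// -gff.2 unlock. Qed.

Lemma green_sym x y : fine (green c P x y) = fine (green c P y x).
Proof. by rewrite -!gff.2 !unlock; congr fine; apply: eq_integral => phi _; rewrite mulrC. Qed.

End gaussian_covariance.

Section occupation_series.
Context (R : realType) (E : pointedType) (c : E -> E -> R).

Lemma esum_intZ (r : R) (a : int -> \bar R) : (0 <= r)%R -> (forall n, (0 <= a n)%E) ->
  (\esum_(n in [set: int]) (r%:E * a n) = r%:E * \esum_(n in [set: int]) a n)%E.
Proof.
move=> r0 a0; rewrite !esum_int//; last by move=> n; rewrite mule_ge0.
by rewrite !nneseriesZl// ge0_muleDr//; apply: nneseries_ge0.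
Qed.

Lemma bipath_occZ (r : R) (v : E -> R) w : 0 <= r -> (forall x, 0 <= v x) ->
  bipath_occ (fun x => r * v x) w = (r%:E * bipath_occ v w)%E.
Proof.
move=> r0 v0; rewrite -esum_intZ//; last by move=> n; rewrite lee_fin mulr_ge0.
by apply: eq_esum => n _; rewrite -mulrA EFinM.
Qed.

Lemma occ_at_ge0 u (v : E -> R) z : (forall x, 0 <= v x) -> (0 <= occ_at u v z)%E.
Proof. by move=> v0; rewrite mule_ge0 ?traj_occ_ge0// lee_fin. Qed.

Lemma occ_at_sum u (l : seq E) (V : E -> R) (f : E -> E -> R) z :
    (forall x, 0 <= V x) -> (forall x y, 0 <= f x y) ->
  (occ_at u (fun y => \sum_(x <- l) (V x * f x y))%R z =
   \sum_(x <- l) (V x)%:E * occ_at u (f x) z)%E.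
Proof.
move=> V0 f0; rewrite /occ_at /traj_occ bipath_occ_sum; last by move=> x y; rewrite mulr_ge0.
rewrite ge0_sume_distrl; last by move=> x _; apply: bipath_occ_ge0 => y; rewrite mulr_ge0.
by apply: eq_bigr => x _; rewrite bipath_occZ// muleA.
Qed.

(** Admissibility makes the holding times positive, which removes the absolute value in
    [bipath_occ], and nonnegative labels turn [s i <= u] into membership in [[0, u]]. *)
Lemma occupation_timeE (w : nat -> bipath_space R E) (s : nat -> R) x u :
    (forall i, admissible c (w i) /\ 0 <= s i) -> 0 < total_weight c x ->
  (occupation_time c w s x u =
   \sum_(i <oo) occ_at u (fun y => (y == x)%:R / total_weight c y)%R (traj (w i), s i))%E.
Proof.
move=> adm lx; have l0 : 0 <= (total_weight c x)^-1 by rewrite invr_ge0 ltW.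
have E1 i : (occ_at u (fun y => (y == x)%:R / total_weight c y)%R (traj (w i), s i) =
   if (s i <= u)%R then (total_weight c x)^-1%:E *
     \esum_(n in [set n : int | bipathZ (w i) n = x]) (bipathsigma (w i) n)%:E else 0)%E.
  have [[sig0 _ _ _ _] si] := adm i.
  rewrite /occ_at /= traj_occ_traj indicE.
  have -> : (s i \in `[0, u]%classic) = (s i <= u).
    apply/idP/idP => [/set_mem|h]; first by rewrite /= in_itv /= => /andP[].
    by apply/mem_set; rewrite /= in_itv /= si.
  case: ifP => _; last by rewrite mule0.
  rewrite mule1 esum_mkcond -esum_intZ//; last by move=> n; case: ifP => // _; rewrite lee_fin ltW.
  apply: eq_esum => n _.
  have -> : (n \in [set n : int | bipathZ (w i) n = x]) = (bipathZ (w i) n == x).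
    by apply/idP/eqP => [/set_mem//|h]; exact/mem_set.
  by case: eqP => [->|_]; rewrite ?mul0r ?mule0// mul1r gtr0_norm.
rewrite (eq_eseriesr (fun i _ => E1 i)) -eseries_mkcond nneseriesZl.
  rewrite nneseries_esum// => i _; apply: esum_ge0 => n _.
  by have [[sig0 _ _ _ _] _] := adm i; rewrite lee_fin ltW.
move=> i _; apply: esum_ge0 => n _.
by have [[sig0 _ _ _ _] _] := adm i; rewrite lee_fin ltW.
Qed.

End occupation_series.

Section isomorphism.
Context (R : realType) (E : pointedType) (c : E -> E -> R)
  (P : E -> probability (path_space R E) R)
  (nu : {sigma_finite_measure set (traj_space R E) -> \bar R})
  (d : measure_display) (Omega : measurableType d) (Pr : probability Omega R)
  (w : Omega -> nat -> bipath_space R E) (s : Omega -> nat -> R)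
  (PG : probability (prod_space E R) R) (u : R).
Hypotheses (gc : weighted_graph c) (walkP : forall x, walk_law c x (P x))
  (inter : interlacement_measure c P nu)
  (adm : forall om i, admissible c (w om i) /\ 0 <= s om i)
  (ppp : poisson_point_process Pr (fun om i => (traj (w om i), s om i)) (intensity nu))
  (gff : gaussian_free_field c P PG) (u0 : 0 <= u).

Let lam0 := total_weight_gt0 gc walkP.

Let L om x := occupation_time c (w om) (s om) x u.

Let g x y := fine (green c P x y).

Let cvg_g x y : green_partial c (fun z => (z == y)%:R) n x @[n --> \oo] -->
  g x y * total_weight c y.
Proof. by apply: cvg_green => //; exact: green_fin_num gff _ _. Qed.

Let gC x y : g x y = g y x.
Proof. exact: green_sym gff _ _. Qed.

Let v_ x (y : E) : R := (y == x)%:R / total_weight c y.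

Let v_ge0 x y : 0 <= v_ x y.
Proof. by rewrite divr_ge0// ltW. Qed.

Let LE om x :
  L om x = (\sum_(i <oo) occ_at u (v_ x) (traj (w om i), s om i))%E.
Proof. exact: occupation_timeE. Qed.

Let L_ge0 om x : (0 <= L om x)%E.
Proof. by rewrite LE; apply: nneseries_ge0 => i _ _; exact: occ_at_ge0. Qed.

Let mL x : measurable_fun setT (L ^~ x).
Proof.
rewrite (funext (fun om => LE om x)).
have x0 y : y \notin [:: x] -> (y == x)%:R = 0 :> R.
  by rewrite inE => /negbTE ->.
by have [] := occupation_laplace gc walkP inter (isT : uniq [:: x])
  (fun y => ler0n R (y == x)) x0 ppp u0.
Qed.

Section finite_set.
Variables (l : seq E) (V : E -> R).
Hypotheses (ul : uniq l) (V0 : forall y, 0 <= V y).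

(** The Laplace criterion supplies a [V] on all of [E] but tests only the sites of [l]; the
    truncation has the finite support that the potential theory requires. *)
Let V' y := if y \in l then V y else 0.

Let V'0 y : 0 <= V' y. Proof. by rewrite /V'; case: ifP. Qed.

Let V'l y : y \notin l -> V' y = 0. Proof. by rewrite /V' => /negbTE ->. Qed.

Let sum_V' (f : E -> R) : \sum_(x <- l) V' x * f x = \sum_(x <- l) V x * f x.
Proof. by rewrite !big_seq; apply: eq_bigr => x xl; rewrite /V' xl. Qed.

Let h := survival c V'.

Let exponent := u * \sum_(x <- l) V x * h x.

(** By linearity the combination of the [L om x] is the occupation functional of [V'], and
    [equilibrium_survival] rewrites the exponent. *)
Lemma occupation_field_laplace :
  (\int[Pr]_om (exp_opp (\sum_(x <- l) (V x)%:E * L om x))%:E = (expR (- exponent))%:E)%E.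
Proof.
have [_] := occupation_laplace gc walkP inter ul V'0 V'l ppp u0.
rewrite (equilibrium_survival gc lam0 cvg_g gC ul V'0 V'l) sum_V' => <-.
apply: eq_integral => om _; congr (exp_opp _)%:E.
transitivity (\sum_(x <- l) \sum_(i <oo)
    ((V x)%:E * occ_at u (v_ x) (traj (w om i), s om i)))%E.
  apply: eq_bigr => x _; rewrite LE nneseriesZl// => i _; exact: occ_at_ge0.
rewrite -nneseries_sum; last first.
  by move=> x i _; rewrite mule_ge0 ?lee_fin ?occ_at_ge0.
apply: eq_eseriesr => i _; rewrite -occ_at_sum//; congr (occ_at _ _ _).
apply/funext => y; under eq_bigr do rewrite mulrA.
rewrite -mulr_suml; congr (_ / _); rewrite /V'; case: ifP => [yl|/negP yl].
  rewrite (bigD1_seq y)//= eqxx mulr1 big1 ?addr0// => x xy.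
  by rewrite eq_sym (negbTE xy) mulr0.
rewrite big_seq big1// => x xl; case: eqP => [yx|_]; last by rewrite mulr0.
by case: yl; rewrite yx.
Qed.

Lemma gaussian_square_laplace :
  \int[PG]_phi expR (- \sum_(x <- l) V x * ((phi x + Num.sqrt (2 * u)) ^+ 2 / 2)) =
  expR (- exponent) * \int[PG]_phi expR (- \sum_(x <- l) V x * (phi x ^+ 2 / 2)).
Proof.
set b := Num.sqrt (2 * u).
have bE : b ^+ 2 = 2 * u by rewrite sqr_sqrtr// mulr_ge0.
(* The function [b h] solves the equation of [gaussian_square_shift]: this is [survival_green]
   multiplied by [b]. *)
have gs x : x \in l -> b * h x + \sum_(y <- l) g x y * (V' y * (b * h y)) = b.
  move=> _; rewrite -[RHS]mulr1 -(survival_green gc lam0 cvg_g ul V'0 V'l x) mulrDr.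
  by congr (_ + _); rewrite mulr_sumr; apply: eq_bigr => y _; rewrite /h; ring.
have := gaussian_square_shift gff.1 (covariance_green gff) ul V'0 gs.
under eq_Rintegral do rewrite sum_V'.
under [in X in _ = X]eq_Rintegral do rewrite sum_V'.
move=> ->; congr (expR (- _) * _); rewrite sum_V' /exponent.
under eq_bigr do rewrite mulrCA.
rewrite -mulr_sumr mulrA; congr (_ * _).
by rewrite mulrAC -expr2 bE mulrAC divff ?mul1r.
Qed.

Lemma exponent_bounds : 0 <= exponent <= u * \sum_(x <- l) V x.
Proof.
rewrite mulr_ge0 ?sumr_ge0//=; last by move=> x _; rewrite mulr_ge0// survival_ge0.
rewrite ler_wpM2l//; apply: ler_sum => x _.
by rewrite -[leRHS]mulr1 ler_wpM2l// survival_le1.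
Qed.

End finite_set.

(** With weight [1 / (n + 1)] at [x], the Laplace transform [expR (- q)] is at most the probability
    that [L om x] is finite, and [q <= u / (n + 1)]. Hence infinity has probability at most
    [1 - expR (- q) <= q], for every [n]. *)
Lemma occupation_time_finite x : Pr [set om | L om x = +oo%E] = 0%E.
Proof.
set B := [set om | L om x = +oo%E].
have mB : measurable B.
  exact: (measurable_preimage (mL x) (emeasurable_set1 +oo%E)).
have Bfin : (Pr B \is a fin_num)%E by rewrite fin_num_measure.
suff h (n : nat) : fine (Pr B) <= u / n.+1%:R.
  rewrite -(fineK Bfin); congr EFin; apply/eqP; rewrite eq_le fine_ge0// andbT leNgt.
  apply/negP => r0; have := h (Num.truncn (u / fine (Pr B))).
  rewrite leNgt ltr_pdivrMr// mulrC -ltr_pdivrMr// => /negP; apply.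
  exact: truncnS_gt.
have ul : uniq [:: x] by [].
have th0 : 0 <= n.+1%:R^-1 :> R by rewrite invr_ge0.
have := occupation_field_laplace ul (V := fun=> n.+1%:R^-1) (fun=> th0).
have /andP[_] := exponent_bounds [:: x] (V := fun=> n.+1%:R^-1) (fun=> th0).
rewrite !big_seq1; set q := u * _ => qle e.
have : ((expR (- q))%:E <= 1 - Pr B)%E.
  have PBC : Pr (~` B) = (\int[Pr]_om (\1_(~` B) om)%:E)%E.
    by rewrite integral_indic ?setIT//; exact: measurableC.
  rewrite -probability_setC// -e [leRHS]PBC.
  apply: ge0_le_integral => //.
  - by move=> om _; rewrite lee_fin exp_opp_ge0.
  - apply/measurable_EFinP; apply: measurable_funexp_opp.
    under eq_fun do rewrite big_seq1.
    by apply: measurable_funeM; exact: mL.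
  - by apply/measurable_EFinP; apply: measurable_indic; exact: measurableC.
  move=> om _; rewrite big_seq1 lee_fin indicE.
  have [_|] := boolP (om \in ~` B).
    have h0 : (0 <= n.+1%:R^-1%:E * L om x)%E by rewrite mule_ge0.
    by have /andP[] := exp_opp01 h0.
  rewrite notin_setE => /contrapT ->.
  by rewrite gt0_muley// lte_fin invr_gt0.
rewrite -(fineK Bfin) -EFinB lee_fin => h1.
have h2 := expR_ge1Dx (- q).
by apply: le_trans qle; lra.
Qed.

Lemma occupation_time_ae_finite : {ae Pr, forall om, forall x, (L om x < +oo)%E}.
Proof.
have [e es] := vertex_enum gc.
apply: (@negligibleS _ _ _ _ (\bigcup_n [set om | L om (e n) = +oo%E])).
  move=> om /= /existsNP[x /negP]; rewrite -leNgt leye_eq => /eqP Lx.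
  by have [n en] := es x; exists n => //=; rewrite en.
apply: negligible_bigcup => n; exists [set om | L om (e n) = +oo%E]; split => //.
  exact: (measurable_preimage (mL (e n)) (emeasurable_set1 +oo%E)).
exact: occupation_time_finite.
Qed.

Let Y1 x (z : Omega * prod_space E R) : R := fine (L z.1 x) + (z.2 x) ^+ 2 / 2.

Let Y2 x (phi : prod_space E R) : R := (phi x + Num.sqrt (2 * u)) ^+ 2 / 2.

Let mphi x : measurable_fun setT (fun phi : prod_space E R => phi x).
Proof. exact: measurable_prod_coordinate. Qed.

Let msqr x b : measurable_fun setT (fun phi : prod_space E R => (phi x + b) ^+ 2 / 2).
Proof. by apply: measurable_funM => //; apply: measurable_funX; exact: measurable_funD. Qed.

Let msqr0 x : measurable_fun setT (fun phi : prod_space E R => (phi x) ^+ 2 / 2).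
Proof. by apply: measurable_funM => //; exact: measurable_funX. Qed.

Let mfineL x : measurable_fun setT (fun om => fine (L om x)).
Proof. exact: (measurableT_comp (fine_measurable measurableT) (mL x)). Qed.

Let mY1 x : measurable_fun setT (Y1 x).
Proof.
apply: measurable_funD; first exact: (measurableT_comp (mfineL x) measurable_fst).
exact: (measurableT_comp (msqr0 x) measurable_snd).
Qed.

Let mY2 x : measurable_fun setT (Y2 x).
Proof. exact: msqr. Qed.

Let sqr2_ge0 (x : R) : 0 <= x ^+ 2 / 2.
Proof. by rewrite divr_ge0 ?sqr_ge0. Qed.

Let Y1_ge0 x z : 0 <= Y1 x z.
Proof. by rewrite addr_ge0 ?fine_ge0. Qed.

Let Y2_ge0 x phi : 0 <= Y2 x phi.
Proof. exact: sqr2_ge0. Qed.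

Let eq_laplace (l : seq E) (V : E -> R) : uniq l -> (forall x, 0 <= V x) ->
  \int[(Pr \x PG)%E]_z expR (- \sum_(x <- l) V x * Y1 x z) =
  \int[PG]_phi expR (- \sum_(x <- l) V x * Y2 x phi).
Proof.
move=> ul V0; rewrite [RHS](gaussian_square_laplace ul V0).
set I := \int[PG]_phi _.
pose b (phi : prod_space E R) := expR (- \sum_(x <- l) V x * (phi x ^+ 2 / 2)).
have mb : measurable_fun setT b.
  apply: measurableT_comp => //; apply: measurableT_comp => //.
  by apply: measurable_sum => x; exact: measurable_funM.
have IE : (\int[PG]_phi (b phi)%:E = I%:E)%E.
  rewrite /I /Rintegral fineK//; apply: integrable_fin_num => //.
  apply: (@bounded_integrable _ _ _ _ _ 1) => //.
  move=> phi; rewrite ger0_norm ?expR_ge0// expR_le1 oppr_le0 sumr_ge0// => x _.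
  by rewrite mulr_ge0.
have ma : measurable_fun setT (fun om => expR (- \sum_(x <- l) V x * fine (L om x))).
  apply: measurableT_comp => //; apply: measurableT_comp => //.
  by apply: measurable_sum => x; exact: measurable_funM.
have I0 : (0 <= I%:E)%E by rewrite -IE integral_ge0// => phi _; rewrite lee_fin expR_ge0.
rewrite [LHS]/Rintegral -[RHS]/(fine (_)%:E); congr fine.
rewrite fubini_tonelli1/=; last 2 first.
- apply/measurable_EFinP; apply: measurableT_comp => //; apply: measurableT_comp => //.
  by apply: measurable_sum => x; exact: measurable_funM.
- by move=> z; rewrite lee_fin expR_ge0.
rewrite /fubini_F /=.
transitivity (\int[Pr]_om ((expR (- \sum_(x <- l) V x * fine (L om x)))%:E * I%:E))%E.
  apply: eq_integral => om _; rewrite -IE -ge0_integralZl_EFin//.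
  - apply: eq_integral => phi _; rewrite -EFinM -expRD; congr ((expR _)%:E).
    rewrite -opprD -big_split; congr (- _); apply: eq_bigr => x _.
    by rewrite /= /Y1 mulrDr.
  - by move=> phi _; rewrite lee_fin expR_ge0.
  - exact/measurable_EFinP.
rewrite ge0_integralZr//; last exact/measurable_EFinP.
rewrite EFinM; congr (_ * _)%E; rewrite -occupation_field_laplace//.
apply: ge0_ae_eq_integral => //.
- exact/measurable_EFinP.
- apply/measurable_EFinP; apply: measurable_funexp_opp.
  by apply: emeasurable_sum => x; apply: measurable_funeM; exact: mL.
- by move=> om _; rewrite lee_fin exp_opp_ge0.
(* Since [fine] sends [+oo] to 0, the two integrands may differ where some [L om x] is infinite,
   which happens only on a null event. *)
apply: filterS occupation_time_ae_finite => om Lfin _.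
have -> : (\sum_(x <- l) (V x)%:E * L om x = (\sum_(x <- l) V x * fine (L om x))%:E)%E.
  rewrite -sumEFin; apply: eq_bigr => x _.
  by rewrite EFinM fineK// ge0_fin_numE.
by [].
Qed.

Let F1 (z : Omega * prod_space E R) : prod_space E R := fun x => Y1 x z.

Let F2 (phi : prod_space E R) : prod_space E R := fun x => Y2 x phi.

Lemma occupation_field_law : same_field_law (Pr \x PG)%E F1 PG F2.
Proof.
have mF1 : measurable_fun setT F1 by exact: measurable_prod_space.
have mF2 : measurable_fun setT F2 by exact: measurable_prod_space.
(* With weight 1 these are the laws of the two fields as measures, to which uniqueness on rectangles
   applies. *)
pose m1 := weighted_law (Pr \x PG)%E (H := cst (1 : R)) (fun=> ler01) (measurable_cst _) mF1.
pose m2 := weighted_law PG (H := cst (1 : R)) (fun=> ler01) (measurable_cst _) mF2.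
have m1E A : measurable A -> m1 A = (Pr \x PG)%E (F1 @^-1` A).
  move=> mA; have mA' : measurable (F1 @^-1` A) by exact: measurable_preimage mA.
  transitivity (1%:E * (Pr \x PG) (F1 @^-1` A))%E; last exact: mul1e.
  rewrite -integral_cst//.
have m2E A : measurable A -> m2 A = PG (F2 @^-1` A).
  move=> mA; have mA' : measurable (F2 @^-1` A) by exact: measurable_preimage mA.
  transitivity (1%:E * PG (F2 @^-1` A))%E; last exact: mul1e.
  rewrite -integral_cst//.
move=> A mA; rewrite /pushforward -m1E// -m2E//.
apply: prod_space_measure_unique => //.
  have e : m1 setT = 1%E by rewrite m1E// preimage_setT; exact: probability_setT.
  by rewrite [X in (X < _)%E]e ltry.
move=> _ [l [B [ul mB ->]]].
have mR : measurable (\bigcap_(i in [set` l]) (fun f : prod_space E R => f i) @^-1` B i).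
  apply: fin_bigcap_measurable => // i _; rewrite -[X in measurable X]setTI.
  exact: measurable_prod_coordinate.
transitivity ((Pr \x PG)%E (\bigcap_(i in [set` l]) Y1 i @^-1` B i)); first exact: m1E.
transitivity (PG (\bigcap_(i in [set` l]) Y2 i @^-1` B i)); last exact/esym/m2E.
exact: (multivariate_laplace_unique mY1 mY2 Y1_ge0 Y2_ge0 eq_laplace ul mB).
Qed.

End isomorphism.

Theorem theorem0p1 (R : realType) (E : pointedType) (c : E -> E -> R)
    (P : E -> probability (path_space R E) R)
    (nu : {sigma_finite_measure set (traj_space R E) -> \bar R})
    (d : measure_display) (Omega : measurableType d) (Pr : probability Omega R)
    (w : Omega -> nat -> bipath_space R E) (s : Omega -> nat -> R)
    (PG : probability (prod_space E R) R) (u : R) :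
  weighted_graph c ->
  (forall x, walk_law c x (P x)) ->
  transient P ->
  interlacement_measure c P nu ->
  (forall om i, admissible c (w om i) /\ 0 <= s om i) ->
  poisson_point_process Pr (fun om i => (traj (w om i), s om i))
    (intensity nu) ->
  gaussian_free_field c P PG ->
  0 <= u ->
  let L om x := occupation_time c (w om) (s om) x u in
  {ae Pr, forall om, forall x, (L om x < +oo)%E} /\
  same_field_law
    (Pr \x PG)%E
    (fun z : Omega * prod_space E R => fun x => fine (L z.1 x) + (z.2 x) ^+ 2 / 2)
    PG
    (fun (phi : prod_space E R) x => (phi x + Num.sqrt (2 * u)) ^+ 2 / 2).

Proof.
move=> gc walkP _ inter adm ppp gff u0 L; split.
  exact: (occupation_time_ae_finite gc walkP inter adm ppp gff u0).
exact: (occupation_field_law gc walkP inter adm ppp gff u0).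
Qed.
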